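(* Let $s>3\mathfrak s_0$ and $\theta\in(0,\theta_* )$, $\theta_*:=\min\big(\frac{s-3\mathfrak s_0}{2s-\mathfrak s_0},\frac15\big)$, and fix $T_0>0$. There exists $\epsilon_\star=\epsilon_\star(s,\theta,T_0)>0$ such that for any $\epsilon\in(0,\epsilon_\star)$ the following holds. Let $z(t)$ be a solution of system (S) of the context which is long-time controlled with parameters $(s,\theta,T_\star,\epsilon)$, with $T_\star\le\frac{T_0}{\epsilon^2}\log\frac1\epsilon$. Then $z(t)=(z_1(t),z_{-1}(t),z^\perp(t))$ fulfills $$\begin{cases}\partial_tz_1=-\mathrm{i}(1+|z_1(0)|^2)z_1+d_1(t)\\ \partial_tz_{-1}=-\mathrm{i}(1-|z_{-1}(0)|^2)z_{-1}+d_{-1}(t)\\ \partial_tz^\perp=-\mathrm{i}|D|^\alpha z^\perp+\mathrm{i}\,\mathrm{Op}^{BW}\big(\mathfrak v(x-J_1t)\xi+V(t;x)\xi+b(t;x,\xi)\big)z^\perp+Y(t)\end{cases}$$ where: - $J_1:=\frac{|z_1(0)|^2+|z_{-1}(0)|^2}2$ and $\mathfrak v(x):=2\,\mathrm{Re}\big(z_1(0)\overline{z_{-1}(0)}e^{\mathrm{i}2x}\big)$; - $V(t;x)$ is real valued and $\|V(t;\cdot)\|_{W^{2,\infty}}\le C\epsilon^{4-\theta}$ for all $0\le t\le T_\star$; - $b(t;x,\xi)\in\Gamma^\alpha_{W^{2,\infty}}$ is a real valued symbol such that for every $n\in\mathbb N_0$ there is $C_n>0$ with $|b(t;\cdot)|_{\alpha,W^{2,\infty},n}\le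 C_n\epsilon^2$ for all $0\le t\le T_\star$; - $|d_{\pm1}(t)|\le\epsilon^{5-\theta}$ for all $0\le t\le T_\star$; - $\|Y(t;\cdot)\|_s\le C\epsilon^{3-\theta}$ for all $0\le t\le T_\star$.
   Context: **Notation.** $\alpha\in(0,1)$ fixed; $\mathbb T=\mathbb R/2\pi\mathbb Z$; $\langle k\rangle=\max(1,|k|)$; $\|u\|_s^2=\sum_k\langle k\rangle^{2s}|u_k|^2$ with $u_k$ the Fourier coefficients; $\|\cdot\|_{L^2}=\|\cdot\|_0$; $|D|^\alpha e^{\mathrm{i}kx}=|k|^\alpha e^{\mathrm{i}kx}$. For $m\in\mathbb R$, $N\in\mathbb N_0$: $\Gamma^m_{W^{N,\infty}}$ is the set of $a(x,\xi)$, smooth in $\xi$, with finite norms $|a|_{m,W^{N,\infty},n}=\max_{0\le\beta\le n}\sup_\xi\|\langle\xi\rangle^{-m+\beta}\partial_\xi^\beta a(\cdot,\xi)\|_{W^{N,\infty}}$, $n\in\mathbb N_0$. A quadratic homogeneous symbol $a\in\widetilde\Gamma_2^m$ is $a(z;x,\xi)=\sum a_{j_1,j_2}^{\sigma_1,\sigma_2}(\xi)z_{j_1}^{\sigma_1}z_{j_2}^{\sigma_2}e^{\mathrm{i}(\sigma_1j_1+\sigma_2j_2)x}$ ($z_j^+=z_j$, $z_j^-=\overline{z_j}$) with $|\partial_\xi^\beta a^{\sigma_1,\sigma_2}_{j_1,j_2}(\xi)|\le C_\beta\max(\langle j_1\rangle,\langle j_2\rangle)^\mu\langle\xi\rangle^{m-\beta}$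 for some $\mu\ge0$. **Bony-Weyl quantization.** $\mathrm{Op}^{BW}(a)v=\sum_{j,k}\chi(k-j,\frac{j+k}2)\hat a(k-j,\frac{j+k}2)v_je^{\mathrm{i}kx}$, with $\hat a(n,\xi)$ the $n$-th Fourier coefficient of $a(\cdot,\xi)$ and $\chi(\xi',\xi)$ a smooth cut-off, even in each argument, supported in $|\xi'|\le\delta_0\langle\xi\rangle$ ($0<\delta_0\le\frac1{10}$), equal to $1$ for $|\xi'|\le\delta_0\langle\xi\rangle/2$, with $|\partial_\xi^\ell\partial_{\xi'}^\beta\chi|\lesssim\langle\xi\rangle^{-\ell-\beta}$; for quadratic homogeneous symbols viewed as functions of $z$, the cut-off is instead an analogous $\chi_2(j_1,j_2,\frac{j+k}2)$ inserted in the sum over $\sigma_1j_1+\sigma_2j_2+j=k$. **System (S).** Write $z=z^\top+z^\perp$, $z^\top=z_1e^{\mathrm{i}x}+z_{-1}e^{-\mathrm{i}x}$, $z^\perp=\sum_{|j|\ne1}z_je^{\mathrm{i}jx}$. Fixed are numbers $\mathfrak s_0$ (sufficiently large) and $\mathfrak r>0$, and the system $$\partial_tz^\top=-\mathrm{i}|D|^\alpha z^\top+Y_3^{(\Lambda)}(z^\top)+Y_3^\top(z)+Y_{\ge5}^\top(z),\qquad \partial_tz^\perp=-\mathrm{i}|D|^\alpha z^\perp+\mathrm{Op}^{BW}(\mathrm{i}\,\mathtt m(z;x,\xi))z^\perp+Y_3^\perp(z)+Y_{\ge5}^\perp(z)$$ for $z\in H^{\mathfrak s_0}$ with $\|z\|_{\mathfrak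 s_0}<\mathfrak r$, where: $Y_3^{(\Lambda)}(z^\top)=-\mathrm{i}|z_1|^2z_1e^{\mathrm{i}x}+\mathrm{i}|z_{-1}|^2z_{-1}e^{-\mathrm{i}x}$; the maps with superscript $\top$ take values in $\mathrm{span}(e^{\pm\mathrm{i}x})$, those with $\perp$ in functions Fourier supported in $\{|j|\neq1\}$; $Y_3^\top,Y_3^\perp$ are cubic and for all $\mathtt s\ge\mathfrak s_0$ satisfy $\|Y_3^\top(z)\|_{\mathtt s}\lesssim\|z^\perp\|_{\mathfrak s_0}^3$, $\|Y_3^\perp(z)\|_{\mathtt s+4}\lesssim(\|z^\top\|_{\mathfrak s_0}+\|z^\perp\|_{\mathfrak s_0})\|z^\perp\|_{\mathfrak s_0}\|z^\perp\|_{\mathtt s}$; for every $\mathtt s\ge\mathfrak s_0$ there are $C>0$, $\mathtt r\in(0,\mathfrak r)$ with $\|Y^\top_{\ge5}(z)\|_{\mathtt s}+\|Y^\perp_{\ge5}(z)\|_{\mathtt s}\le C\|z\|_{\mathfrak s_0}^4\|z\|_{\mathtt s}$ if $\|z\|_{\mathfrak s_0}\leq\mathtt r$, $z\in H^{\mathtt s}$; and $\mathtt m=\langle\underline V\rangle(z;x)\xi+a_2^{(\alpha)}(z;x,\xi)+\widetilde V_{\ge4}(z;x)\xi+\widetilde a_{\ge4}^{(\alpha)}(z;x,\xi)$ is real valued, with $\langle\underline V\rangle(z;x)=2\mathrm{Re}\big(\sum_{n\ge1}z_n\overline{z_{-n}}e^{2\mathrm{i}nx}\big)$, $a_2^{(\alpha)}\in\widetilde\Gamma_2^\alpha$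 of zero average in $x$ and invariant under $z\mapsto e^{\mathrm{i}\vartheta}z$, and $|a_2^{(\alpha)}(z;\cdot)|_{\alpha,W^{2,\infty},n}\le C_n\|z\|_{\mathfrak s_0}^2$, $\|\widetilde V_{\ge4}(z;\cdot)\|_{W^{2,\infty}}\le C\|z\|^4_{\mathfrak s_0}$, $|\widetilde a^{(\alpha)}_{\ge4}(z;\cdot)|_{\alpha,W^{2,\infty},n}\le C_n\|z\|^4_{\mathfrak s_0}$. **Long-time controlled.** For $T_\star>0$, $\epsilon\in(0,\mathfrak r)$, a solution $z(t)\in H^s(\mathbb T,\mathbb C)$ of (S) is long-time controlled with parameters $(s,\theta,T_\star,\epsilon)$ if (A1) $\|z^\top(0)\|_{L^2}\le\epsilon$ and $\|z^\perp(0)\|_{L^2}\le\epsilon^3$; (A2) it exists on $[0,T_\star]$ and $\sup_{0\le t\le T_\star}\|z(t)\|_s\le\epsilon^{-\theta}$. *)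

(* Defs.v *)
From HB Require Import structures.
From mathcomp Require Import all_boot all_order all_algebra.
From mathcomp Require Import all_classical all_reals all_analysis.
From mathcomp Require Import complex.

Set Implicit Arguments.
Unset Strict Implicit.
Unset Printing Implicit Defensive.

Import Order.TTheory GRing.Theory Num.Theory.
Import numFieldNormedType.Exports.
Import ComplexField.Normc.

Local Open Scope classical_set_scope.
Local Open Scope ring_scope.
Local Open Scope complex_scope.

Section Prelim.
Context {R : realType}.
Local Notation C := R[i].

Definition cexp (x : R) : C := cos x +i* sin x.

Definition jap (x : R) : R := Num.max 1 `|x|.

(* Unconditional sums: positive minus negative part.  This is the usual sum
   for a summable family; otherwise the value carries no information. *)
Definition rsum (I : choiceType) (f : I -> R) : R :=
  fine (\esum_(i in [set: I]) (Num.max (f i) 0)%:E)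
  - fine (\esum_(i in [set: I]) (Num.max (- f i) 0)%:E).

Definition csum (I : choiceType) (f : I -> C) : C :=
  rsum (fun i => complex.Re (f i)) +i* rsum (fun i => complex.Im (f i)).

(* Integral over one period. *)
Definition cint (f : R -> C) : C :=
  (\int[lebesgue_measure]_(x in `[0, 2 * pi]) complex.Re (f x))
  +i* (\int[lebesgue_measure]_(x in `[0, 2 * pi]) complex.Im (f x)).

Definition fcoef (f : R -> C) (n : int) : C :=
  ((2 * pi)^-1)%:C * cint (fun x => f x * cexp (- (n%:~R * x))).

Definition periodic T (f : R -> T) : Prop := forall x, f (x + 2 * pi) = f x.

Definition smooth (f : R -> R) : Prop :=
  forall n x, derivable (derive1n n f) x 1.

Definition csmooth (f : R -> C) : Prop :=
  smooth (fun x => complex.Re (f x)) /\ smooth (fun x => complex.Im (f x)).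

Definition cderive1n (n : nat) (f : R -> C) (x : R) : C :=
  derive1n n (fun y => complex.Re (f y)) x +i* derive1n n (fun y => complex.Im (f y)) x.

Definition cmeasurable (f : R -> C) : Prop :=
  measurable_fun `[0, 2 * pi] (fun x => complex.Re (f x)) /\
  measurable_fun `[0, 2 * pi] (fun x => complex.Im (f x)).

(* g is the k-th weak derivative of f on the torus. *)
Definition weak_derive (k : nat) (f g : R -> C) : Prop :=
  forall phi : R -> R, smooth phi -> periodic phi ->
    cint (fun x => f x * (derive1n k phi x)%:C)
    = (-1) ^+ k * cint (fun x => g x * (phi x)%:C).

(* max_(k <= N) of the L^infinity norms of the weak derivatives of f; the
   infimum is over an empty set, hence +oo, when f is not in W^{N,infinity}. *)
Definition Winf (N : nat) (f : R -> C) : \bar R :=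
  ereal_inf [set M%:E | M in [set M : R | periodic f /\
    exists g : nat -> R -> C, g 0%N = f /\
      forall k, (k <= N)%N ->
        [/\ cmeasurable (g k), weak_derive k f (g k) &
            {ae lebesgue_measure,
               forall x : R, 0 <= x <= 2 * pi -> normc (g k x) <= M}]]].

(* Functions of (x, xi). *)
Definition symbol := R -> R -> C.

Definition symnorm (m : R) (N n : nat) (a : symbol) : \bar R :=
  ereal_sup [set y | exists (b : nat) (xi : R), (b <= n)%N /\
    y = Winf N (fun x => (jap xi `^ (- m + b%:R))%:C * cderive1n b (a x) xi)].

Definition Gamma (m : R) (N : nat) (a : symbol) : Prop :=
  (forall x, csmooth (a x)) /\ (forall n, (symnorm m N n a < +oo)%E).

(* A function on the torus is given by its Fourier coefficients. *)
Definition fseq := int -> C.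

Definition sobE (s : R) (u : fseq) : \bar R :=
  ((\esum_(k in [set: int]) (jap k%:~R `^ (2 * s) * normc (u k) ^+ 2)%:E)
     `^ (2^-1)%R)%E.

Definition inH (s : R) (u : fseq) : Prop := (sobE s u < +oo)%E.

(* Only meaningful under inH s u. *)
Definition sob (s : R) (u : fseq) : R := fine (sobE s u).

Definition top (u : fseq) : fseq := fun k => if `|k|%N == 1%N then u k else 0.
Definition perp (u : fseq) : fseq := fun k => if `|k|%N == 1%N then 0 else u k.

Definition supp_top (u : fseq) : Prop := forall k, `|k|%N != 1%N -> u k = 0.
Definition supp_perp (u : fseq) : Prop := forall k, `|k|%N = 1%N -> u k = 0.

(* Coefficients a^{s1,s2}_{j1,j2}(xi) of a quadratic symbol; true is the sign +. *)
Definition qcoef := bool -> bool -> int -> int -> R -> C.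

Definition sgnz (s : bool) : int := if s then 1 else -1.
Definition zsgn (s : bool) (w : C) : C := if s then w else w^*.

Definition Gamma2 (m mu : R) (A : qcoef) : Prop :=
  (forall s1 s2 j1 j2, csmooth (A s1 s2 j1 j2)) /\
  forall b : nat, exists K : R, forall s1 s2 j1 j2 xi,
    normc (cderive1n b (A s1 s2 j1 j2) xi)
    <= K * Num.max (jap j1%:~R) (jap j2%:~R) `^ mu * jap xi `^ (m - b%:R).

Definition qeval (A : qcoef) (z : fseq) : symbol := fun x xi =>
  csum (fun p : bool * bool * (int * int) =>
    let: (s1, s2, (j1, j2)) := p in
    A s1 s2 j1 j2 xi * zsgn s1 (z j1) * zsgn s2 (z j2)
    * cexp ((sgnz s1 * j1 + sgnz s2 * j2)%:~R * x)).

(* Cut-offs: p = 1 for ordinary symbols, p = 2 for quadratic ones.  The norm of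
   xi' in R^p is the maximum norm. *)
Definition dir (p : nat) (o : option 'I_p) : 'rV[R]_p * R :=
  if o is Some i then (delta_mx 0 i, 0) else (0, 1).

Definition partials (p : nat) (l : seq (option 'I_p))
    (f : 'rV[R]_p * R -> R) : 'rV[R]_p * R -> R :=
  foldr (fun o g => fun x => 'D_(dir o) g x) f l.

Definition flip (p : nat) (i : 'I_p) (v : 'rV[R]_p) : 'rV[R]_p :=
  \row_j (if j == i then - v 0 j else v 0 j).

Definition cutoff (p : nat) (delta0 : R) (chi : 'rV[R]_p * R -> R) : Prop :=
  [/\ forall l, continuous (partials l chi)
        /\ forall o x, derivable (partials l chi) x (dir o),
      (forall i v xi, chi (flip i v, xi) = chi (v, xi))
        /\ (forall v xi, chi (v, - xi) = chi (v, xi)),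
      forall v xi, chi (v, xi) != 0 -> `|v| <= delta0 * jap xi,
      forall v xi, `|v| <= delta0 * jap xi / 2 -> chi (v, xi) = 1 &
      forall l, exists K : R, forall v xi,
        `|partials l chi (v, xi)| <= K * jap xi `^ (- (size l)%:R)].

Definition vec1 (x : R) : 'rV[R]_1 := \row_i x.
Definition vec2 (x y : R) : 'rV[R]_2 := \row_i (if i == 0 then x else y).

Definition OpBW (chi : 'rV[R]_1 * R -> R) (a : symbol) (v : fseq) : fseq :=
  fun k => csum (fun j : int =>
    let xi := (j + k)%:~R / 2 in
    (chi (vec1 (k - j)%:~R, xi))%:C * fcoef (fun x => a x xi) (k - j) * v j).

(* Quantization of the quadratic symbol with coefficients A, evaluated at z. *)
Definition OpBW2 (chi2 : 'rV[R]_2 * R -> R) (A : qcoef) (z v : fseq) : fseq :=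
  fun k => csum (fun p : bool * bool * (int * int) =>
    let: (s1, s2, (j1, j2)) := p in
    let j := k - (sgnz s1 * j1 + sgnz s2 * j2) in
    let xi := (j + k)%:~R / 2 in
    (chi2 (vec2 j1%:~R j2%:~R, xi))%:C
    * A s1 s2 j1 j2 xi * zsgn s1 (z j1) * zsgn s2 (z j2) * v j).

(* The n-th term of the sum is that of index n + 1. *)
Definition Vavg (z : fseq) (x : R) : R :=
  2 * complex.Re (csum (fun n : nat =>
    z n.+1%:Z * (z (- n.+1%:Z))^* * cexp ((2 * n.+1)%:R * x))).

(* Coefficients of the quadratic symbol Vavg(z; x) xi: z_n (z_{-n})^* e^{2inx}
   and its conjugate, n >= 1. *)
Definition Vavg_coef : qcoef := fun s1 s2 j1 j2 xi =>
  if [&& 0 < j1, j2 == - j1 & s1 != s2] then xi%:C else 0.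

(* Restriction to the diagonal of a real-trilinear map on H^{s0}. *)
Definition cubic (s0 : R) (Y : fseq -> fseq) : Prop :=
  exists M : fseq -> fseq -> fseq -> fseq,
    [/\ forall (c : R) u u' v w, inH s0 u -> inH s0 u' -> inH s0 v -> inH s0 w ->
          M (fun k => c%:C * u k + u' k) v w
          =1 (fun k => c%:C * M u v w k + M u' v w k),
        forall (c : R) u u' v w, inH s0 u -> inH s0 u' -> inH s0 v -> inH s0 w ->
          M v (fun k => c%:C * u k + u' k) w
          =1 (fun k => c%:C * M v u w k + M v u' w k),
        forall (c : R) u u' v w, inH s0 u -> inH s0 u' -> inH s0 v -> inH s0 w ->
          M v w (fun k => c%:C * u k + u' k)
          =1 (fun k => c%:C * M v w u k + M v w u' k) &
        forall z, inH s0 z -> Y z =1 M z z z].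

Definition Y3Lambda (z : fseq) : fseq := fun k =>
  if k == 1 then - 'i * (normc (z 1) ^+ 2)%:C * z 1
  else if k == -1 then 'i * (normc (z (-1)) ^+ 2)%:C * z (-1)
  else 0.

Record system := System {
  Y3top : fseq -> fseq;
  Y3perp : fseq -> fseq;
  Y5top : fseq -> fseq;
  Y5perp : fseq -> fseq;
  a2 : qcoef;
  V4 : fseq -> R -> C;
  a4 : fseq -> symbol
}.

Definition msym (S : system) (z : fseq) : symbol := fun x xi =>
  (Vavg z x * xi)%:C + qeval (a2 S) z x xi + V4 S z x * xi%:C + a4 S z x xi.

(* Op^BW(i m(z)) v: the quadratic part of m is quantized with chi2. *)
Definition OpBW_im (chi : 'rV[R]_1 * R -> R) (chi2 : 'rV[R]_2 * R -> R)
    (S : system) (z v : fseq) : fseq := fun k =>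
  OpBW2 chi2 (fun s1 s2 j1 j2 xi =>
    'i * (Vavg_coef s1 s2 j1 j2 xi + a2 S s1 s2 j1 j2 xi)) z v k
  + OpBW chi (fun x xi => 'i * (V4 S z x * xi%:C + a4 S z x xi)) v k.

Definition inball (s0 r : R) (z : fseq) : Prop := (sobE s0 z < r%:E)%E.

(* mu is the loss exponent of the quadratic symbol a2. *)
Definition admissible (alpha s0 r mu : R) (S : system) : Prop :=
  [/\ (cubic s0 (Y3top S) /\ cubic s0 (Y3perp S)) /\
      (forall z, inball s0 r z ->
        [/\ supp_top (Y3top S z), supp_top (Y5top S z),
            supp_perp (Y3perp S z) & supp_perp (Y5perp S z)]),
      forall s, s0 <= s -> exists K : R, forall z, inball s0 r z -> inH s z ->
        (sobE s (Y3top S z) <= (K * sob s0 (perp z) ^+ 3)%:E)%E /\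
        (sobE (s + 4)%R (Y3perp S z)
           <= (K * (sob s0 (top z) + sob s0 (perp z))
                 * sob s0 (perp z) * sob s (perp z))%:E)%E,
      forall s, s0 <= s -> exists K rs : R, 0 < K /\ 0 < rs < r /\
        forall z, (sobE s0 z <= rs%:E)%E -> inH s z ->
        (sobE s (Y5top S z) + sobE s (Y5perp S z)
           <= (K * sob s0 z ^+ 4 * sob s z)%:E)%E,
      [/\ Gamma2 alpha mu (a2 S),
          forall z, inball s0 r z -> forall xi,
            fcoef (fun x => qeval (a2 S) z x xi) 0 = 0,
          forall z, inball s0 r z -> forall th x xi,
            qeval (a2 S) (fun k => cexp th * z k) x xi = qeval (a2 S) z x xi &
          forall n, exists K : R, forall z, inball s0 r z ->
            (symnorm alpha 2 n (qeval (a2 S) z) <= (K * sob s0 z ^+ 2)%:E)%E] &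
      [/\ forall z, inball s0 r z -> forall x xi, complex.Im (msym S z x xi) = 0,
          exists K : R, forall z, inball s0 r z ->
            (Winf 2 (V4 S z) <= (K * sob s0 z ^+ 4)%:E)%E,
          forall z, inball s0 r z -> Gamma alpha 2 (a4 S z) &
          forall n, exists K : R, forall z, inball s0 r z ->
            (symnorm alpha 2 n (a4 S z) <= (K * sob s0 z ^+ 4)%:E)%E]].

(* w is the time derivative of z on [0, T] (one-sided at the end points), as a
   curve in H^s. *)
Definition is_dt (s T : R) (z w : R -> fseq) : Prop :=
  forall t, 0 <= t <= T ->
    sobE s (fun k => ((t' - t)^-1)%:C * (z t' k - z t k) - w t k)
      @[t' --> within `[0, T] t^'] --> (0 : \bar R).

Definition is_cdt (T : R) (f g : R -> C) : Prop :=
  forall t, 0 <= t <= T ->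
    normc (((t' - t)^-1)%:C * (f t' - f t) - g t)
      @[t' --> within `[0, T] t^'] --> (0 : R).

Definition is_continuous (s T : R) (z : R -> fseq) : Prop :=
  forall t, 0 <= t <= T ->
    sobE s (fun k => z t' k - z t k) @[t' --> within `[0, T] (nbhs t)]
      --> (0 : \bar R).

Definition absD (alpha : R) (u : fseq) : fseq :=
  fun k => (`|k%:~R| `^ alpha)%:C * u k.

Definition solution (alpha s0 r : R) (chi : 'rV[R]_1 * R -> R)
    (chi2 : 'rV[R]_2 * R -> R) (S : system) (s T : R) (z : R -> fseq) : Prop :=
  [/\ forall t, 0 <= t <= T -> inH s (z t) /\ inball s0 r (z t),
      is_continuous s T z,
      is_dt (s - 1) T (fun t => top (z t)) (fun t k =>
        - 'i * absD alpha (top (z t)) k + Y3Lambda (top (z t)) k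
        + Y3top S (z t) k + Y5top S (z t) k) &
      is_dt (s - 1) T (fun t => perp (z t)) (fun t k =>
        - 'i * absD alpha (perp (z t)) k
        + OpBW_im chi chi2 S (z t) (perp (z t)) k
        + Y3perp S (z t) k + Y5perp S (z t) k)].

Definition long_time_controlled (alpha s0 r : R) (chi : 'rV[R]_1 * R -> R)
    (chi2 : 'rV[R]_2 * R -> R) (S : system) (s theta T eps : R)
    (z : R -> fseq) : Prop :=
  [/\ 0 < T, 0 < eps < r,
      solution alpha s0 r chi chi2 S s T z,
      (sobE 0%R (top (z 0%R)) <= eps%:E)%E /\ (sobE 0%R (perp (z 0%R)) <= (eps ^+ 3)%:E)%E &
      forall t, 0 <= t <= T -> (sobE s (z t) <= (eps `^ (- theta))%:E)%E].

End Prelim.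

Arguments fseq R : clear implicits.
Arguments symbol R : clear implicits.
Arguments qcoef R : clear implicits.
Arguments system R : clear implicits.

(* Main.v *)
Require Import Defs.
From mathcomp Require Import all_boot all_order all_algebra.
From mathcomp Require Import all_classical all_reals all_analysis.
From mathcomp Require Import measurable_realfun complex.
From mathcomp Require Import ring lra zify.

Import Order.TTheory GRing.Theory Num.Theory.
Import numFieldNormedType.Exports.
Import ComplexField.Normc.

Local Open Scope classical_set_scope.
Local Open Scope ring_scope.
Local Open Scope complex_scope.

Set Implicit Arguments.
Unset Strict Implicit.
Unset Printing Implicit Defensive.

(* The part of the symbol m that is quadratic in z^top alone acts as a Hermitian
   band matrix, so it drops out of d/dt |z^perp|_{L^2}^2; everything else that
   drives z^perp is of size eps^5 in L^2.  A continuity argument then gives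
   |z^perp|_{L^2} <= eps^(3-theta) on the whole interval, and interpolation with
   |z|_s <= eps^(-theta) yields |z^perp|_{s0} <~ eps^2.  Hence |z_1| and |z_{-1}|
   are almost conserved, z_1 conj(z_{-1}) rotates with speed 2 J_1 up to a small
   error, and <V>(z) is v(x - J_1 t) up to O(eps^(4-theta)).  Replacing chi2 by
   chi costs a remainder in H^s, because both cut-offs are 1 unless xi is
   dominated by the frequencies of z. *)

(** The obstacle is the time scale: over a time of size [eps^-2 ln(1/eps)] a forcing of size [eps^5]
    accumulates to [eps^3 ln(1/eps)], so a bound by a multiple of [eps^3] does not close. The loss
    [eps^-theta] is split: the logarithm is at most a constant times [eps^(-theta/4)], and the
    remaining power swallows every constant, which is why the bounds on [d1] and [dm1] carry none. A
    second obstacle is that the equation for z^perp holds only in H^(s-1). The energy is therefore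
    computed mode by mode on finite frequency boxes, and the interactions across the boundary vanish
    as the box grows. The Hermitian structure is not given directly: only the full symbol m is real,
    and the reality of its part quadratic in z^top is extracted by scaling z. Evenness of chi2 makes
    the cut-off equal for all pairs of frequencies 1 and -1, so it does not spoil the symmetry. The
    bound on theta comes from interpolating between L^2 and H^s: both terms are at most [eps^2] as
    soon as [theta s <= s - 3 s0]. *)

Lemma le_of_eq d (T : porderType d) (x y : T) : x = y -> (x <= y)%O.
Proof. by move->. Qed.

(** * Summation of families through their finite partial sums *)

Section Sums.
Context {R : realType}.
Local Notation C := R[i].
Implicit Types (I : choiceType).

Lemma normc_ge0 (x : C) : 0 <= normc x.
Proof. by case: x => a b; rewrite /normc sqrtr_ge0. Qed.

Lemma normc_Re (x : C) : `|complex.Re x| <= normc x.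
Proof. by case: x => a b /=; rewrite -sqrtr_sqr ler_wsqrtr // lerDl sqr_ge0. Qed.

Lemma normc_Im (x : C) : `|complex.Im x| <= normc x.
Proof. by case: x => a b /=; rewrite -sqrtr_sqr ler_wsqrtr // lerDr sqr_ge0. Qed.

Lemma normc_le_ReIm (x : C) : normc x <= `|complex.Re x| + `|complex.Im x|.
Proof.
case: x => a b /=; have h : 0 <= `|a| + `|b| by rewrite addr_ge0.
rewrite -(ger0_norm h) -sqrtr_sqr ler_wsqrtr // sqrrD !real_normK ?num_real //.
by rewrite lerD2r lerDl mulrn_wge0 // mulr_ge0.
Qed.

Lemma normc_real (x : R) : normc x%:C = `|x|.
Proof. by rewrite /= expr0n /= addr0 sqrtr_sqr. Qed.

Lemma normcB (x y : C) : normc (x - y) = normc (y - x).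
Proof. by rewrite -opprB normcN. Qed.

Lemma le_normcB (x y : C) : normc (x - y) <= normc x + normc y.
Proof. by rewrite -(normcN y); exact: le_normcD. Qed.

Lemma normc_conj (x : C) : normc (x^*%C) = normc x.
Proof. by case: x => a b /=; rewrite sqrrN. Qed.

Lemma sqr_normc_ReIm (x : C) : normc x ^+ 2 = complex.Re x ^+ 2 + complex.Im x ^+ 2.
Proof. by case: x => a b /=; rewrite sqr_sqrtr // addr_ge0 ?sqr_ge0. Qed.

Lemma normc_cexp (x : R) : normc (cexp x) = 1.
Proof. by rewrite /cexp /= cos2Dsin2 sqrtr1. Qed.

Lemma normc_i : normc ('i%C : C) = 1.
Proof. by rewrite /= expr0n /= add0r expr1n sqrtr1. Qed.

Lemma cexpD (x y : R) : cexp (x + y) = cexp x * cexp y.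
Proof.
rewrite /cexp cosD sinD; apply/eqP; rewrite eq_complex /=.
by apply/andP; split; apply/eqP; ring.
Qed.

Lemma cexp0 : cexp 0 = 1 :> C.
Proof. by rewrite /cexp cos0 sin0. Qed.

Lemma ReD (x y : C) : complex.Re (x + y) = complex.Re x + complex.Re y.
Proof. by case: x => a b; case: y. Qed.

Lemma ImD (x y : C) : complex.Im (x + y) = complex.Im x + complex.Im y.
Proof. by case: x => a b; case: y. Qed.

Lemma ReN (x : C) : complex.Re (- x) = - complex.Re x.
Proof. by case: x. Qed.

Lemma ImN (x : C) : complex.Im (- x) = - complex.Im x.
Proof. by case: x. Qed.

Lemma ReM (x y : C) : complex.Re (x * y)
  = complex.Re x * complex.Re y - complex.Im x * complex.Im y.
Proof. by case: x => a b; case: y. Qed.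

Lemma ImM (x y : C) : complex.Im (x * y)
  = complex.Re x * complex.Im y + complex.Im x * complex.Re y.
Proof. by case: x => a b; case: y => c d /=; rewrite [b * c]mulrC. Qed.

Lemma Re_sum T (F : seq T) (f : T -> C) :
  complex.Re (\sum_(i <- F) f i) = \sum_(i <- F) complex.Re (f i).
Proof. by elim: F => [|a F IH]; rewrite ?big_nil // !big_cons ReD IH. Qed.

Lemma Im_sum T (F : seq T) (f : T -> C) :
  complex.Im (\sum_(i <- F) f i) = \sum_(i <- F) complex.Im (f i).
Proof. by elim: F => [|a F IH]; rewrite ?big_nil // !big_cons ImD IH. Qed.

Lemma complex_eqP (x y : C) :
  complex.Re x = complex.Re y -> complex.Im x = complex.Im y -> x = y.
Proof. by case: x => a b; case: y => c d /= -> ->. Qed.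

Lemma normc_sum T (F : seq T) (f : T -> C) :
  normc (\sum_(i <- F) f i) <= \sum_(i <- F) normc (f i).
Proof.
elim: F => [|a F IH]; rewrite ?big_nil ?normc0 // !big_cons.
by apply: (le_trans (le_normcD _ _)); rewrite lerD2l.
Qed.

Lemma normc_eq0_le (x : C) : normc x <= 0 -> x = 0.
Proof. by move=> h; apply: eq0_normc; apply/eqP; rewrite eq_le h normc_ge0. Qed.

(** For a nonnegative family this says that the extended sum is at most [B] ([esum_EFin_leE]); the
    form with finite lists keeps extended real arithmetic out of the later estimates. *)
Definition bsum I (f : I -> R) (B : R) : Prop :=
  forall F : seq I, uniq F -> \sum_(i <- F) f i <= B.

Lemma bsum_ge0 I (f : I -> R) B : bsum f B -> 0 <= B.
Proof. by move=> /(_ [::] isT); rewrite big_nil. Qed.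

Lemma bsum_le I (f g : I -> R) B : (forall i, f i <= g i) -> bsum g B -> bsum f B.
Proof. by move=> h H F /H; apply: le_trans; apply: ler_sum. Qed.

Lemma bsum_leB I (f : I -> R) B B' : B <= B' -> bsum f B -> bsum f B'.
Proof. by move=> h H F /H /le_trans; apply. Qed.

Lemma bsumD I (f g : I -> R) B B' :
  bsum f B -> bsum g B' -> bsum (fun i => f i + g i) (B + B').
Proof. by move=> h H F u; rewrite big_split /= lerD ?h ?H. Qed.

Lemma bsumZ I (f : I -> R) B (c : R) :
  0 <= c -> bsum f B -> bsum (fun i => c * f i) (c * B).
Proof. by move=> c0 h F u; rewrite -mulr_sumr ler_wpM2l // h. Qed.

Lemma bsum1 I (f : I -> R) B i : bsum f B -> f i <= B.
Proof. by move=> /(_ [:: i] isT); rewrite big_seq1. Qed.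

Lemma bsum_inj I (J : choiceType) (h : J -> I) (f : I -> R) B :
  injective h -> bsum f B -> bsum (fun j => f (h j)) B.
Proof.
move=> hi H F u; have := H (map h F); rewrite map_inj_uniq // big_map.
by apply.
Qed.

Lemma ler_sum_subset I (f : I -> R) (F G : seq I) :
  (forall i, 0 <= f i) -> uniq F -> uniq G -> {subset F <= G} ->
  \sum_(i <- F) f i <= \sum_(i <- G) f i.
Proof.
move=> f0 uF uG s; rewrite (bigID (mem F) _ (fun i => f i) (r := G)) /=.
rewrite -[X in _ <= X + _]big_filter (_ : \sum_(i <- F) _ =
   \sum_(i <- [seq i <- G | i \in F]) f i); last first.
  apply: perm_big; apply: uniq_perm; rewrite ?filter_uniq // => i.
  by rewrite mem_filter; case: (boolP (i \in F)) => // /s ->.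
by rewrite lerDl sumr_ge0.
Qed.

(** A finite set of pairs is contained in the product of its two projections, where the double sum
    factors. *)
Lemma bsum_prod I (J : choiceType) (f : I -> R) (g : J -> R) A B :
  (forall i, 0 <= f i) -> (forall j, 0 <= g j) -> bsum f A -> bsum g B ->
  bsum (fun p : I * J => f p.1 * g p.2) (A * B).
Proof.
move=> f0 g0 hf hg F u.
pose F1 := undup (map fst F); pose F2 := undup (map snd F).
apply: (@le_trans _ _ (\sum_(p <- [seq (i, j) | i <- F1, j <- F2]) f p.1 * g p.2)).
  apply: ler_sum_subset => //.
  - by move=> p; rewrite mulr_ge0.
  - by apply: allpairs_uniq; rewrite ?undup_uniq // => -[a b] [c d] /= _ _ ->.
  - move=> [i j] h; apply/allpairsP; exists (i, j); split=> //=.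
      by rewrite mem_undup; apply/mapP; exists (i, j).
    by rewrite mem_undup; apply/mapP; exists (i, j).
rewrite big_allpairs_dep /=.
under eq_bigr do rewrite -mulr_sumr.
rewrite -mulr_suml ler_pM ?sumr_ge0 //.
  by apply: hf; rewrite undup_uniq.
by apply: hg; rewrite undup_uniq.
Qed.

Lemma bsum_fin I (f : I -> R) (F : seq I) :
  (forall i, 0 <= f i) -> (forall i, i \notin F -> f i = 0) -> uniq F ->
  bsum f (\sum_(i <- F) f i).
Proof.
move=> f0 h uF G uG; rewrite (bigID (mem F)) /= [X in _ + X]big1 ?addr0; last first.
  by move=> i /h.
rewrite -big_filter; apply: ler_sum_subset; rewrite ?filter_uniq // => i.
by rewrite mem_filter => /andP[].
Qed.

(** [F] is chosen with a sum within [e] of the supremum of all finite sums; a disjoint [G] adds at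
    most [e], since [F ++ G] stays below the supremum. *)
Lemma bsum_tail I (w : I -> R) B e : 0 < e -> bsum w B ->
  exists F, uniq F /\ forall G, uniq G -> (forall i, i \in G -> i \notin F) ->
    \sum_(i <- G) w i <= e.
Proof.
move=> e0 h.
pose A := [set x : R | exists F, uniq F /\ x = \sum_(i <- F) w i].
have hs : has_sup A.
  split; first by exists 0, [::]; rewrite big_nil.
  by exists B => x [F [u ->]]; exact: h.
have [x [F [u ->]] hx] := sup_adherent e0 hs.
exists F; split=> // G uG d.
have : \sum_(i <- F ++ G) w i <= sup A.
  apply: sup_upper_bound => //; exists (F ++ G); split=> //.
  rewrite cat_uniq u uG andbT /=; apply/hasPn => i /d.
  by [].
rewrite big_cat /= => h1; have := le_lt_trans h1 _; lra.
Qed.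

Lemma esum_EFin_ge I (f : I -> R) (F : seq I) : (forall i, 0 <= f i) -> uniq F ->
  ((\sum_(i <- F) f i)%:E <= \esum_(i in [set: I]) (f i)%:E)%E.
Proof.
move=> f0 u; rewrite /esum; apply: ereal_sup_ubound.
exists [set` F].
  by split=> //; exact: finite_seq.
by rewrite -sumEFin; apply/esym; apply: (@fsbig_seq _ _ _ _ _ (fun i => (f i)%:E)).
Qed.

Lemma esum_EFin_le I (f : I -> R) (B : R) : bsum f B ->
  (\esum_(i in [set: I]) (f i)%:E <= B%:E)%E.
Proof.
move=> h; rewrite /esum; apply: ge_ereal_sup => _ [A [fA _] <-].
by rewrite fsbig_finite //= sumEFin lee_fin; apply: h; exact: finmap.fset_uniq.
Qed.

Lemma esum_EFin_leE I (f : I -> R) (B : R) : (forall i, 0 <= f i) ->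
  (\esum_(i in [set: I]) (f i)%:E <= B%:E)%E <-> bsum f B.
Proof.
move=> f0; split; last exact: esum_EFin_le.
move=> h F u; rewrite -lee_fin; apply: le_trans h; exact: esum_EFin_ge.
Qed.

Lemma esum_ge0_tail I (f w : I -> R) (F : seq I) e :
  (forall i, 0 <= f i <= w i) -> uniq F ->
  (forall G, uniq G -> (forall i, i \in G -> i \notin F) -> \sum_(i <- G) w i <= e) ->
  0 <= fine (\esum_(i in [set: I]) (f i)%:E) - \sum_(i <- F) f i <= e.
Proof.
move=> hf uF tl.
have f0 i : 0 <= f i by have /andP[] := hf i.
have fw i : f i <= w i by have /andP[] := hf i.
have hl := esum_EFin_ge f0 uF.
have hu : (\esum_(i in [set: I]) (f i)%:E <= (\sum_(i <- F) f i + e)%:E)%E.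
  apply: esum_EFin_le => G uG; rewrite (bigID (mem F)) /= lerD //.
    rewrite -big_filter; apply: ler_sum_subset; rewrite ?filter_uniq // => i.
    by rewrite mem_filter => /andP[].
  rewrite -big_filter; apply: (@le_trans _ _ (\sum_(i <- [seq i <- G | i \notin F]) w i)).
    exact: ler_sum.
  by apply: tl; rewrite ?filter_uniq // => i; rewrite mem_filter => /andP[].
case: (\esum_(i in _) _) hl hu => [r||] //=; rewrite !lee_fin => h1 h2.
by apply/andP; split; lra.
Qed.

(** [rsum] is a difference of two nonnegative sums. Both are dominated by [w] and both tails lie in
    [[0, e]], so the difference is within [e] without a factor 2. *)
Lemma rsum_tail I (f w : I -> R) (F : seq I) e :
  (forall i, `|f i| <= w i) -> uniq F ->
  (forall G, uniq G -> (forall i, i \in G -> i \notin F) -> \sum_(i <- G) w i <= e) ->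
  `|rsum f - \sum_(i <- F) f i| <= e.
Proof.
move=> fw uF tl.
have p1 i : 0 <= Num.max (f i) 0 <= w i.
  rewrite le_max lexx orbT ge_max /= (le_trans _ (fw i)) ?ler_norm //=.
  exact: le_trans (fw i).
have p2 i : 0 <= Num.max (- f i) 0 <= w i.
  have h := fw i; have := ler_norm (- f i); rewrite normrN => h1.
  rewrite le_max lexx orbT ge_max /= (le_trans h1) //=.
  exact: le_trans (fw i).
have := esum_ge0_tail p1 uF tl; have := esum_ge0_tail p2 uF tl.
have -> : \sum_(i <- F) f i = \sum_(i <- F) Num.max (f i) 0 - \sum_(i <- F) Num.max (- f i) 0.
  rewrite -sumrB; apply: eq_bigr => i _.
  by case: (leP (f i) 0) => h; case: (leP (- f i) 0) => h'; lra.
rewrite /rsum => /andP[a b] /andP[c d]; rewrite ler_norml; apply/andP; split; lra.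
Qed.

Lemma csum_tail I (f : I -> C) (w : I -> R) (F : seq I) e :
  (forall i, normc (f i) <= w i) -> uniq F ->
  (forall G, uniq G -> (forall i, i \in G -> i \notin F) -> \sum_(i <- G) w i <= e) ->
  normc (csum f - \sum_(i <- F) f i) <= 2 * e.
Proof.
move=> fw uF tl; apply: (le_trans (normc_le_ReIm _)).
rewrite ReD ReN ImD ImN Re_sum Im_sum mulr2n mulrDl mul1r lerD //.
  by apply: (rsum_tail (w := w)) => // i; apply: le_trans (fw i); exact: normc_Re.
by apply: (rsum_tail (w := w)) => // i; apply: le_trans (fw i); exact: normc_Im.
Qed.

(** Unordered convergence, a notion of sum that does not mention positive and negative parts.
    Additivity is direct for it and is transferred to [csum] through uniqueness. *)
Definition has_csum I (f : I -> C) (S : C) : Prop :=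
  forall e, 0 < e -> exists F0, uniq F0 /\ forall F, uniq F -> {subset F0 <= F} ->
    normc (S - \sum_(i <- F) f i) <= e.

(** [F0] depends on the majorant [w] alone, so the approximation is uniform over all [f] below [w];
    this is the source of uniformity in [x] for trigonometric series. *)
Lemma csum_dom I (w : I -> R) B e : 0 < e -> bsum w B -> exists F0, uniq F0 /\
  forall (f : I -> C) F, (forall i, normc (f i) <= w i) -> uniq F ->
    {subset F0 <= F} -> normc (csum f - \sum_(i <- F) f i) <= e.
Proof.
move=> e0 h; have [|F0 [u tl]] := @bsum_tail _ w B (e / 2) _ h; first lra.
exists F0; split=> // f F fw uF s.
rewrite (_ : e = 2 * (e / 2)); last by lra.
apply: (csum_tail fw) => // G uG d; apply: tl => // i /d.
by apply: contra => /s.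
Qed.

Lemma has_csum_csum I (f : I -> C) B : bsum (fun i => normc (f i)) B ->
  has_csum f (csum f).
Proof.
move=> h e e0; have [F0 [u H]] := csum_dom e0 h; exists F0; split=> // F uF s.
exact: (H f).
Qed.

Lemma has_csum_unique I (f : I -> C) S S' : has_csum f S -> has_csum f S' -> S = S'.
Proof.
move=> h h'; apply/eqP; rewrite -subr_eq0; apply/eqP/normc_eq0_le.
rewrite leNgt; apply/negP => p.
have e0 : 0 < normc (S - S') / 3 by lra.
have [F [u H]] := h _ e0; have [F' [u' H']] := h' _ e0.
have uF : uniq (undup (F ++ F')) by rewrite undup_uniq.
have s : {subset F <= undup (F ++ F')} by move=> i; rewrite mem_undup mem_cat => ->.
have s' : {subset F' <= undup (F ++ F')} by move=> i; rewrite mem_undup mem_cat orbC => ->.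
have := H _ uF s; have := H' _ uF s'; rewrite [X in X <= _ -> _]normcB.
set T := \sum_(i <- _) _ => a b.
have := le_normcD (S - T) (T - S'); rewrite addrA subrK; lra.
Qed.

Lemma has_csumD I (f g : I -> C) S S' : has_csum f S -> has_csum g S' ->
  has_csum (fun i => f i + g i) (S + S').
Proof.
move=> h h' e e0; have e2 : 0 < e / 2 by lra.
have [F [u H]] := h _ e2; have [F' [u' H']] := h' _ e2.
exists (undup (F ++ F')); rewrite undup_uniq; split=> // G uG s.
have s1 : {subset F <= G} by move=> i hi; apply: s; rewrite mem_undup mem_cat hi.
have s2 : {subset F' <= G} by move=> i hi; apply: s; rewrite mem_undup mem_cat hi orbT.
rewrite big_split /= opprD addrACA; apply: (le_trans (le_normcD _ _)).
by have := H _ uG s1; have := H' _ uG s2; lra.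
Qed.

Lemma has_csum_fin I (f : I -> C) (F : seq I) : uniq F ->
  (forall i, i \notin F -> f i = 0) -> has_csum f (\sum_(i <- F) f i).
Proof.
move=> u h e e0; exists F; split=> // G uG s.
rewrite (bigID (mem F) _ _ (r := G)) /= [X in _ - (_ + X)]big1 ?addr0; last by move=> i /h.
rewrite -[X in _ - X]big_filter (_ : \sum_(i <- F) _ = \sum_(i <- [seq i <- G | i \in F]) f i).
  by rewrite subrr normc0 ltW.
apply: perm_big; apply: uniq_perm; rewrite ?filter_uniq // => i.
by rewrite mem_filter; case: (boolP (i \in F)) => // /s ->.
Qed.

Lemma csum_fin I (f : I -> C) (F : seq I) : uniq F ->
  (forall i, i \notin F -> f i = 0) -> csum f = \sum_(i <- F) f i.
Proof.
move=> u h; apply: (@has_csum_unique _ f); last exact: has_csum_fin.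
apply: (@has_csum_csum _ _ (\sum_(i <- F) normc (f i))).
by apply: bsum_fin => // [i|i /h ->]; rewrite ?normc_ge0 ?normc0.
Qed.

Lemma csum_ext I (f g : I -> C) : f =1 g -> csum f = csum g.
Proof. by move=> /funext ->. Qed.

Lemma normc_csum_le I (f : I -> C) B : bsum (fun i => normc (f i)) B ->
  normc (csum f) <= B.
Proof.
move=> h; apply/ler_addgt0Pr => e e0.
have [F [u H]] := has_csum_csum h e0.
have := H F u (fun _ => id); have := h F u; have := normc_sum F f.
move=> a b c; have := le_normcD (csum f - \sum_(i <- F) f i) (\sum_(i <- F) f i).
rewrite subrK; lra.
Qed.

(* Cauchy-Schwarz with a weight, the mechanism of all the operator bounds. *)
Lemma sqr_sum_weight_le T (F : seq T) (w b : T -> R) : (forall i, 0 <= w i) ->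
  (\sum_(i <- F) w i * b i) ^+ 2 <= (\sum_(i <- F) w i) * \sum_(i <- F) w i * b i ^+ 2.
Proof.
move=> w0; elim: F => [|a F IH]; first by rewrite !big_nil expr0n /= mul0r.
rewrite !big_cons.
set W := \sum_(i <- F) w i in IH *; set S := \sum_(i <- F) w i * b i in IH *.
set Q := \sum_(i <- F) w i * b i ^+ 2 in IH *.
have W0 : 0 <= W by rewrite sumr_ge0.
have Q0 : 0 <= Q by rewrite sumr_ge0 // => i _; rewrite mulr_ge0 ?sqr_ge0.
have wa := w0 a.
suff h : 2 * S * b a <= Q + W * b a ^+ 2.
  have := ler_wpM2l wa h; nra.
have [W00|Wn] := eqVneq W 0.
  have S0 : S = 0.
    move: IH; rewrite W00 mul0r => h; apply/eqP; rewrite -sqrf_eq0 eq_le h sqr_ge0 //.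
  by rewrite S0 W00 !mul0r mulr0 mul0r addr0.
have Wp : 0 < W by rewrite lt_def Wn.
rewrite -(ler_pM2l Wp); have := sqr_ge0 (S - W * b a); nra.
Qed.

End Sums.

(** * Integrals over one period and Fourier coefficients *)

Section Integrals.
Context {R : realType}.
Local Notation C := R[i].
Local Notation mu := (@lebesgue_measure R).
Local Notation D := (`[0%R, (2 * pi)%R]%classic : set R).

Lemma twopi_gt0 : 0 < 2 * pi :> R.
Proof. by rewrite mulr_gt0 // pi_gt0. Qed.

Lemma cexp_2pi (n : int) (x : R) : cexp (n%:~R * (x + 2 * pi)) = cexp (n%:~R * x).
Proof.
have h1 (y : R) : cexp (y + 2 * pi) = cexp y.
  by rewrite /cexp mulr2n mulrDl mul1r addrA !cosDpi !sinDpi !opprK.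
have hn (m : nat) (y : R) : cexp (y + m%:R * (2 * pi)) = cexp y.
  elim: m y => [|m IH] y; first by rewrite mul0r addr0.
  by rewrite -natr1 mulrDl mul1r addrA h1 IH.
case: n => m.
  by rewrite mulrDr hn.
rewrite NegzE mulrNz !mulNr mulrDr opprD -[LHS](hn m.+1); congr cexp.
exact: subrK.
Qed.

Lemma aeS (P Q : set R) : {ae mu, forall x, P x} -> (forall x, P x -> Q x) ->
  {ae mu, forall x, Q x}.
Proof. by move=> h PQ; apply: filterS h => //; exact: (ae_filter_ringOfSetsType mu). Qed.

Lemma aeS2 (P P' Q : set R) : {ae mu, forall x, P x} -> {ae mu, forall x, P' x} ->
  (forall x, P x -> P' x -> Q x) -> {ae mu, forall x, Q x}.
Proof.
by move=> h h' PQ; apply: filterS2 h h' => //; exact: (ae_filter_ringOfSetsType mu).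
Qed.

Lemma aeT (Q : set R) : (forall x, Q x) -> {ae mu, forall x, Q x}.
Proof. by move=> h; apply: (@filterE _ _ (ae_filter_ringOfSetsType mu)). Qed.

(** Essential boundedness on one period serves as the integrability criterion; its complex version
    [cbm] is stable under sums and products ([cbmD], [cbmM]). *)
Definition rbm (f : R -> R) (M : R) : Prop :=
  measurable_fun D f /\ {ae mu, forall x, 0 <= x <= 2 * pi -> `|f x| <= M}.

Lemma mu_D : mu D = (2 * pi)%:E.
Proof. by rewrite lebesgue_measure_itv /= lte_fin twopi_gt0 sube0. Qed.

Lemma mD : measurable D. Proof. exact: measurable_itv. Qed.

Lemma rbm_int_le f M : rbm f M -> (\int[mu]_(x in D) `|f x|%:E <= (M * (2 * pi))%:E)%E.
Proof.
move=> [mf bf].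
apply: (@le_trans _ _ (\int[mu]_(x in D) (`|M|%:E))%E).
  apply: ae_ge0_le_integral => //=.
  - by apply/measurable_EFinP; apply: measurableT_comp => //; exact: normr_measurable.
  - apply: (aeS bf) => x h; rewrite /= in_itv /= => /h h1.
    by rewrite lee_fin; apply: le_trans h1 (ler_norm _).
rewrite integral_cst; last exact: mD.
rewrite [X in (_ * X)%E]mu_D -EFinM lee_fin.
have [M0|M0] := leP 0 M; first by rewrite ger0_norm.
(* A negative essential bound would make the whole period a null set. *)
exfalso.
have : mu D = 0%E.
  apply: (proj1 (@negligibleP _ _ _ mu D mD)).
  apply: negligibleS bf => x; rewrite /= in_itv /= => xD h.
  by have := le_lt_trans (h xD) M0; rewrite normr_lt0.
rewrite mu_D => -[h]; have := twopi_gt0; rewrite h ltxx //.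
Qed.

Lemma rbm_integrable f M : rbm f M -> mu.-integrable D (EFin \o f).
Proof.
move=> h; apply/integrableP; split; first by apply/measurable_EFinP; case: h.
by apply: (le_lt_trans (rbm_int_le h)); rewrite ltry.
Qed.

Lemma rbm_le f M : rbm f M -> `|\int[mu]_(x in D) f x| <= M * (2 * pi).
Proof.
move=> h; apply: (le_trans (@le_normr_Rintegral _ _ _ mu D f mD (rbm_integrable h))).
rewrite -lee_fin /Rintegral fineK; first exact: rbm_int_le h.
apply: integrable_fin_num; first exact: mD.
exact: (@integrable_norm _ _ _ mu D f (rbm_integrable h)).
Qed.

Lemma Re_funD (f g : R -> C) : (fun x => complex.Re (f x + g x)) =
  (fun x => complex.Re (f x) + complex.Re (g x)).
Proof. by apply/funext => x; rewrite ReD. Qed.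

Lemma Im_funD (f g : R -> C) : (fun x => complex.Im (f x + g x)) =
  (fun x => complex.Im (f x) + complex.Im (g x)).
Proof. by apply/funext => x; rewrite ImD. Qed.

Lemma Re_funM (f g : R -> C) : (fun x => complex.Re (f x * g x)) =
  (fun x => complex.Re (f x) * complex.Re (g x) - complex.Im (f x) * complex.Im (g x)).
Proof. by apply/funext => x; rewrite ReM. Qed.

Lemma Im_funM (f g : R -> C) : (fun x => complex.Im (f x * g x)) =
  (fun x => complex.Re (f x) * complex.Im (g x) + complex.Im (f x) * complex.Re (g x)).
Proof. by apply/funext => x; rewrite ImM. Qed.

Definition cbm (f : R -> C) (M : R) : Prop :=
  cmeasurable f /\ {ae mu, forall x, 0 <= x <= 2 * pi -> normc (f x) <= M}.

Lemma cbm_Re f M : cbm f M -> rbm (fun x => complex.Re (f x)) M.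
Proof.
move=> [[m1 _] b]; split=> //; apply: (aeS b) => x h /h.
by apply: le_trans; exact: normc_Re.
Qed.

Lemma cbm_Im f M : cbm f M -> rbm (fun x => complex.Im (f x)) M.
Proof.
move=> [[_ m1] b]; split=> //; apply: (aeS b) => x h /h.
by apply: le_trans; exact: normc_Im.
Qed.

Lemma cbmD f g M N : cbm f M -> cbm g N -> cbm (fun x => f x + g x) (M + N).
Proof.
move=> [[m1 m2] b] [[n1 n2] c]; split.
  by split; rewrite ?Re_funD ?Im_funD; exact: measurable_funD.
apply: (aeS2 b c) => x h h' xD; apply: (le_trans (le_normcD _ _)).
by rewrite lerD ?h ?h'.
Qed.

Lemma cbmM f g M N : cbm f M -> cbm g N -> cbm (fun x => f x * g x) (M * N).
Proof.
move=> [[m1 m2] b] [[n1 n2] c]; split.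
  split; rewrite ?Re_funM ?Im_funM.
    by apply: measurable_funB; exact: measurable_funM.
  by apply: measurable_funD; exact: measurable_funM.
apply: (aeS2 b c) => x h h' xD; rewrite normcM.
by rewrite ler_pM ?normc_ge0 ?h ?h'.
Qed.

Lemma cbm_cst (c : C) : cbm (fun=> c) (normc c).
Proof.
split; last by apply: aeT.
by split; exact: measurable_cst.
Qed.

Lemma cbmZ (c : C) f M : cbm f M -> cbm (fun x => c * f x) (normc c * M).
Proof. by move=> h; exact: (cbmM (cbm_cst c) h). Qed.

Lemma cbm_cont f M : continuous (fun x => complex.Re (f x)) ->
  continuous (fun x => complex.Im (f x)) -> (forall x, normc (f x) <= M) -> cbm f M.
Proof.
move=> c1 c2 b; split; last by apply: aeT.
by split; apply: measurable_funTS; exact: continuous_measurable_fun.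
Qed.

Lemma continuous_lin (a : R) : continuous (fun x => a * x).
Proof. by move=> x; apply: continuousM; [exact: cvg_cst | exact: cvg_id]. Qed.

Lemma continuous_cos_lin (a : R) : continuous (fun x : R => cos (a * x)).
Proof.
move=> x; apply: (@continuous_comp R R R (fun x : R => a * x) cos x).
  exact: continuous_lin.
exact: continuous_cos.
Qed.

Lemma continuous_sin_lin (a : R) : continuous (fun x : R => sin (a * x)).
Proof.
move=> x; apply: (@continuous_comp R R R (fun x : R => a * x) sin x).
  exact: continuous_lin.
exact: continuous_sin.
Qed.

Lemma cbm_cexp (a : R) : cbm (fun x => cexp (a * x)) 1.
Proof.
apply: cbm_cont => [||x]; last by rewrite normc_cexp.
  exact: continuous_cos_lin.
exact: continuous_sin_lin.
Qed.

Lemma cbm_ext f g M : f =1 g -> cbm f M -> cbm g M.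
Proof. by move=> /funext ->. Qed.

Lemma cbm_sum T (F : seq T) (f : T -> R -> C) (M : T -> R) :
  (forall i, cbm (f i) (M i)) -> cbm (fun x => \sum_(i <- F) f i x) (\sum_(i <- F) M i).
Proof.
move=> h; elim: F => [|a F IH].
  rewrite big_nil; apply: (cbm_ext (f := fun=> 0)); first by move=> x; rewrite big_nil.
  by have := cbm_cst 0; rewrite normc0.
rewrite big_cons; apply: (cbm_ext (f := fun x => f a x + \sum_(i <- F) f i x)).
  by move=> x; rewrite big_cons.
exact: cbmD.
Qed.

(** The factor 2 comes from bounding real and imaginary parts separately; it persists in all bounds
    on Fourier coefficients. *)
Lemma cint_le f M : cbm f M -> normc (cint f) <= 2 * (M * (2 * pi)).
Proof.
move=> h; apply: (le_trans (normc_le_ReIm _)); rewrite mulr2n mulrDl mul1r.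
by apply: lerD; [exact: rbm_le (cbm_Re h) | exact: rbm_le (cbm_Im h)].
Qed.

Lemma cintD f g M N : cbm f M -> cbm g N -> cint (fun x => f x + g x) = cint f + cint g.
Proof.
move=> h h'; apply: complex_eqP; rewrite ?ReD ?ImD /cint [LHS]/=.
  rewrite Re_funD RintegralD //; [exact: rbm_integrable (cbm_Re h)|
   exact: rbm_integrable (cbm_Re h')].
rewrite Im_funD RintegralD //; [exact: rbm_integrable (cbm_Im h)|
 exact: rbm_integrable (cbm_Im h')].
Qed.

Lemma rbmZ (a : R) f M : rbm f M -> rbm (fun x => a * f x) (`|a| * M).
Proof.
move=> [m b]; split; first by apply: measurable_funM => //; exact: measurable_cst.
by apply: (aeS b) => x h /h h'; rewrite normrM ler_wpM2l.
Qed.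

Lemma cintZ (c : C) f M : cbm f M -> cint (fun x => c * f x) = c * cint f.
Proof.
move=> h; have h1 := cbm_Re h; have h2 := cbm_Im h.
apply: complex_eqP; rewrite ?ReM ?ImM /cint [LHS]/=.
  rewrite (Re_funM (fun=> c) f) RintegralB ?RintegralZl //; try exact: mD; try exact: rbm_integrable (rbmZ _ _);
    try exact: rbm_integrable h1; try exact: rbm_integrable h2;
    try exact: rbm_integrable (rbmZ _ h1); exact: rbm_integrable (rbmZ _ h2).
rewrite (Im_funM (fun=> c) f) RintegralD ?RintegralZl //; try exact: mD;
    try exact: rbm_integrable h1; try exact: rbm_integrable h2;
    try exact: rbm_integrable (rbmZ _ h1); exact: rbm_integrable (rbmZ _ h2).
Qed.

Lemma cbm_coef f M (n : int) : cbm f M -> cbm (fun x => f x * cexp (- (n%:~R * x))) M.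
Proof.
move=> h; rewrite -[M]mulr1; apply: cbmM h _.
by apply: (cbm_ext _ (cbm_cexp (- n%:~R))) => x; rewrite mulNr.
Qed.

Lemma fcoefD f g M N n : cbm f M -> cbm g N ->
  fcoef (fun x => f x + g x) n = fcoef f n + fcoef g n.
Proof.
move=> h h'; rewrite /fcoef -mulrDr -(cintD (cbm_coef n h) (cbm_coef n h')).
by congr (_ * cint _); apply/funext => x; rewrite mulrDl.
Qed.

Lemma fcoefZ (c : C) f M n : cbm f M -> fcoef (fun x => c * f x) n = c * fcoef f n.
Proof.
move=> h; rewrite /fcoef mulrCA -(cintZ c (cbm_coef n h)).
by congr (_ * cint _); apply/funext => x; rewrite mulrA.
Qed.

Lemma fcoef_le f M n : cbm f M -> normc (fcoef f n) <= 2 * M.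
Proof.
move=> h; have := cint_le (cbm_coef n h); rewrite /fcoef normcM normc_real => h1.
have p := twopi_gt0.
rewrite ger0_norm ?invr_ge0 ?(ltW p) // mulrC ler_pdivrMr // -mulrA //.
Qed.

Lemma fcoef_sum T (F : seq T) (f : T -> R -> C) (M : T -> R) n :
  (forall i, cbm (f i) (M i)) ->
  fcoef (fun x => \sum_(i <- F) f i x) n = \sum_(i <- F) fcoef (f i) n.
Proof.
move=> h; elim: F => [|a F IH].
  rewrite big_nil.
  rewrite (_ : (fun x => _) = (fun x => 0 * (0 : C))); last first.
    by apply/funext => x; rewrite big_nil mul0r.
  by rewrite (fcoefZ 0 n (cbm_cst 0)) mul0r.
rewrite big_cons -IH.
rewrite -(@fcoefD (f a) (fun x => \sum_(i <- F) f i x) _ _ n (h a) (cbm_sum F h)).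
congr (fcoef _ n).
by apply/funext => x; rewrite big_cons.
Qed.

(** Applied to the real symbol m, this is where the Hermitian symmetry of the operator acting on
    z^perp originates. *)
Lemma fcoef_conj (f : R -> C) M n : cbm f M -> (forall x, complex.Im (f x) = 0) ->
  fcoef f (- n) = (fcoef f n)^*%C.
Proof.
move=> bf h; rewrite /fcoef.
have -> : (((2 * pi)^-1)%:C * cint (fun x => f x * cexp (- (n%:~R * x))))^*%C =
  ((2 * pi)^-1)%:C * (cint (fun x => f x * cexp (- (n%:~R * x))))^*%C.
  by rewrite rmorphM /= oppr0.
congr (_ * _); apply: complex_eqP; rewrite /cint [LHS]/= [RHS]/=.
  congr Rintegral; apply/funext => x; rewrite !ReM h !mul0r !subr0 /cexp.
  by rewrite mulrNz mulNr opprK /= cosN.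
rewrite -mulN1r -RintegralZl; first last.
- exact: rbm_integrable (cbm_Im (cbm_coef n bf)).
- exact: mD.
congr Rintegral; apply/funext => x; rewrite !ImM h !mul0r !addr0 /cexp.
by rewrite mulrNz mulNr opprK /= sinN mulN1r mulrN opprK.
Qed.

Lemma cont_der (F : R -> R) : (forall x, derivable F x 1) -> continuous F.
Proof. by move=> h x; apply/differentiable_continuous/derivable1_diffP/h. Qed.

Lemma FTC2_period (F f : R -> R) : (forall x : R, is_derive x (1 : R) F (f x)) -> continuous f ->
  \int[mu]_(x in D) f x = F (2 * pi) - F 0.
Proof.
move=> dF cf; have dF1 x : derivable F x 1 by have [] := dF x.
have cF := cont_der dF1.
rewrite /Rintegral (@continuous_FTC2 _ f F) ?twopi_gt0 //.
- exact: continuous_subspaceT.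
- split=> [x _ //||]; first by apply: cvg_at_right_filter; exact: cF.
  by apply: cvg_at_left_filter; exact: cF.
- by move=> x _; rewrite derive1E; have [_ ->] := dF x.
Qed.

(** For nonzero [m] the primitives [sin (m x) / m] and [- cos (m x) / m] take the same value at both
    ends of the period. *)
Lemma cint_cexp (m : int) :
  cint (fun x : R => cexp (m%:~R * x)) = if m == 0 then ((2 * pi)%:C : C) else 0.
Proof.
have c0 : cexp (m%:~R * (2 * pi)) = cexp 0 :> C by have := @cexp_2pi m 0; rewrite add0r mulr0.
have [m0|mn] := eqVneq m 0.
  rewrite m0; apply: complex_eqP; rewrite /cint [LHS]/=.
    rewrite (_ : (fun x => _) = (fun=> 1)); last by apply/funext => x; rewrite mul0r cos0.
    rewrite Rintegral_cst; last exact: mD.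
    by rewrite [X in fine X]mu_D mul1r.
  rewrite (_ : (fun x => _) = (fun=> 0)); last by apply/funext => x; rewrite mul0r sin0.
  by rewrite Rintegral_cst ?mul0r //; exact: mD.
have mr : (m%:~R : R) != 0 by rewrite intr_eq0.
have [cc ss] : cos (m%:~R * (2 * pi)) = 1 :> R /\ sin (m%:~R * (2 * pi)) = 0 :> R.
  by move: c0; rewrite cexp0 /cexp => -[].
have dl x : is_derive x (1 : R) (fun y : R => m%:~R * y) m%:~R.
  by apply: (is_derive_eq (is_deriveZ m%:~R (is_derive_id x 1))); rewrite scaler1.
apply: complex_eqP; rewrite /cint [LHS]/=.
  have d1 (x : R) : is_derive x (1 : R) (fun x => m%:~R^-1 * sin (m%:~R * x)) (cos (m%:~R * x)).
    have d2 := @is_derive1_comp _ sin (fun y : R => m%:~R * y) x _ _ (is_derive_sin _) (dl x).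
    apply: (is_derive_eq (is_deriveZ _ d2)).
    by rewrite -[_ *: _]/(_ * _) mulrCA mulVf // mulr1.
  rewrite (FTC2_period d1); first by rewrite ss !mulr0 sin0 mulr0 subrr.
  exact: continuous_cos_lin.
have d1 (x : R) : is_derive x (1 : R) (fun x => - m%:~R^-1 * cos (m%:~R * x)) (sin (m%:~R * x)).
  have d2 := @is_derive1_comp _ cos (fun y : R => m%:~R * y) x _ _ (is_derive_cos _) (dl x).
  apply: (is_derive_eq (is_deriveZ _ d2)).
  by rewrite -[_ *: _]/(_ * _); field.
rewrite (FTC2_period d1); first by rewrite cc mulr0 cos0 subrr.
exact: continuous_sin_lin.
Qed.

Lemma fcoef_cexp (m n : int) : fcoef (fun x : R => cexp (m%:~R * x)) n = (m == n)%:R.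
Proof.
rewrite /fcoef (_ : (fun x => _) = (fun x => cexp ((m - n)%:~R * x))); last first.
  by apply/funext => x; rewrite -cexpD intrB mulrBl.
rewrite cint_cexp subr_eq0; case: eqP => _; last by rewrite mulr0.
by rewrite -rmorphM mulVf // gt_eqF // twopi_gt0.
Qed.

Lemma fcoef_trig T (F : seq T) (c : T -> C) (m : T -> int) n :
  fcoef (fun x => \sum_(i <- F) c i * cexp ((m i)%:~R * x)) n = \sum_(i <- F | m i == n) c i.
Proof.
rewrite (@fcoef_sum _ _ (fun i x => c i * cexp ((m i)%:~R * x)) (fun i => normc (c i) * 1)).
  rewrite [RHS]big_mkcond; apply: eq_bigr => i _.
  rewrite (fcoefZ (c i) n (cbm_cexp (m i)%:~R)) fcoef_cexp.
  by case: eqP => _; rewrite ?mulr1 ?mulr0.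
by move=> i; exact: cbmZ (cbm_cexp _).
Qed.

Lemma cbm_trig T (F : seq T) (c : T -> C) (m : T -> int) :
  cbm (fun x => \sum_(i <- F) c i * cexp ((m i)%:~R * x)) (\sum_(i <- F) normc (c i) * 1).
Proof.
by apply: (@cbm_sum _ F (fun i x => c i * cexp ((m i)%:~R * x))) => i;
  exact: cbmZ (cbm_cexp _).
Qed.

(** By orthogonality the coefficient of the trigonometric sum collects the terms of frequency [n];
    the difference is handled by [fcoef_le], whence the factor 2. *)
Lemma fcoef_approx T (F : seq T) (c : T -> C) (m : T -> int) n f M e : cbm f M ->
  (forall x, normc (f x - \sum_(i <- F) c i * cexp ((m i)%:~R * x)) <= e) ->
  normc (fcoef f n - \sum_(i <- F | m i == n) c i) <= 2 * e.
Proof.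
move=> bf h; rewrite -fcoef_trig.
have bt := cbm_trig F c m.
rewrite -mulN1r -(fcoefZ (-1) n bt) -(fcoefD n bf (cbmZ (-1) bt)).
apply: fcoef_le; split; first by case: (cbmD bf (cbmZ (-1) bt)).
by apply: aeT => x _; rewrite mulN1r.
Qed.

End Integrals.

(** * Weak derivatives and the norm of W^(N,infinity) *)

Section Winf.
Context {R : realType}.
Local Notation C := R[i].
Local Notation mu := (@lebesgue_measure R).
Local Notation D := (`[0%R, (2 * pi)%R]%classic : set R).

(** Membership in the set whose infimum is [Winf N f]. The infimum is not shown to be attained, so
    passing from [Winf] to [winf] costs an arbitrary positive [e] ([Winf_ex]). *)
Definition winf (N : nat) (f : R -> C) (M : R) : Prop :=
  Defs.periodic f /\ exists g : nat -> R -> C, g 0%N = f /\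
    forall k, (k <= N)%N -> [/\ cmeasurable (g k), weak_derive k f (g k) &
      {ae mu, forall x : R, 0 <= x <= 2 * pi -> normc (g k x) <= M}].

Lemma Winf_le N f M : winf N f M -> (Winf N f <= M%:E)%E.
Proof. by move=> h; apply: ereal_inf_lbound; exists M. Qed.

Lemma winf_mono N f M M' : M <= M' -> winf N f M -> winf N f M'.
Proof.
move=> MM [p [g [g0 h]]]; split=> //; exists g; split=> // k /h [a b c]; split=> //.
by apply: (aeS c) => x cx /cx cx'; exact: le_trans cx' MM.
Qed.

Lemma Winf_ex N f B e : (Winf N f <= B%:E)%E -> 0 < e -> winf N f (B + e).
Proof.
move=> h e0.
have : (Winf N f < (B + e)%:E)%E by apply: (le_lt_trans h); rewrite lte_fin ltrDl.
move=> /ereal_inf_lt [_ [M hM <-]]; rewrite lte_fin => /ltW MM.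
exact: winf_mono MM hM.
Qed.

Lemma winf_cbm N f M : winf N f M -> cbm f M.
Proof. by move=> [_ [g [<- /(_ 0%N isT) [a _ b]]]]. Qed.

Lemma fcoef_Winf N (f : R -> C) B n : (Winf N f <= B%:E)%E -> normc (fcoef f n) <= 2 * B.
Proof.
move=> h; apply/ler_addgt0Pr => e e0.
have e2 : 0 < e / 2 by lra.
have := fcoef_le n (winf_cbm (Winf_ex h e2)); lra.
Qed.

Lemma cont_bounded (phi : R -> R) : continuous phi ->
  exists M, forall x, 0 <= x <= 2 * pi -> `|phi x| <= M.
Proof.
move=> c; have h : {within `[0, 2 * pi], continuous (fun x => `|phi x|)}.
  apply: continuous_subspaceT => x.
  by apply: (@continuous_comp _ _ _ phi); [exact: c | exact: norm_continuous].
have [x _ hx] := EVT_max (ltW twopi_gt0) h.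
by exists `|phi x| => y yD; apply: hx; rewrite in_itv.
Qed.

Lemma cbm_contR (phi : R -> R) : continuous phi -> exists M, cbm (fun x => (phi x)%:C) M.
Proof.
move=> c; have [M h] := cont_bounded c; exists M; split.
  by split; apply: measurable_funTS; [exact: continuous_measurable_fun|exact: measurable_cst].
by apply: aeT => x xD; rewrite normc_real h.
Qed.

Lemma smooth_continuous (phi : R -> R) k : smooth phi -> continuous (derive1n k phi).
Proof. by move=> h; apply: cont_der => x; exact: h. Qed.

Lemma signC k : (-1) ^+ k = ((-1) ^+ k)%:C :> C.
Proof. by rewrite rmorphXn /= rmorphN1. Qed.

(** Test functions are real, so taking real parts commutes with the pairing; hence the real part of
    a weak derivative is the weak derivative of the real part. *)
Lemma cint_Re f (phi : R -> R) :
  cint (fun x => (complex.Re (f x))%:C * (phi x)%:C) =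
  (complex.Re (cint (fun x => f x * (phi x)%:C)))%:C.
Proof.
apply: complex_eqP; rewrite /cint [RHS]/= [LHS]/=.
  by congr Rintegral; apply/funext => x; rewrite !ReM /= mulr0 mulr0.
rewrite (_ : (fun x => _) = (fun=> 0)); last first.
  by apply/funext => x /=; rewrite mulr0 mul0r addr0.
by rewrite Rintegral_cst ?mul0r //; exact: mD.
Qed.

(** The real part is built in because [V4] and [a4] are complex valued, whereas the coefficients [V]
    and [b] of the reduced equation must be real. *)
Lemma winf_ReD N f g M M' : winf N f M -> winf N g M' ->
  winf N (fun x => (complex.Re (f x + g x))%:C) (M + M').
Proof.
move=> hf hg; have bf := winf_cbm hf; have bg := winf_cbm hg.
case: hf => pf [F [F0 hF]]; case: hg => pg [G [G0 hG]].
split; first by move=> x; rewrite pf pg.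
exists (fun k x => (complex.Re (F k x + G k x))%:C); split; first by rewrite F0 G0.
move=> k kN; have [mF wF bF] := hF k kN; have [mG wG bG] := hG k kN.
have cF : cbm (F k) M by []. have cG : cbm (G k) M' by [].
have [[m1 m2] bFG] := cbmD cF cG.
split.
- by split=> //=; exact: measurable_cst.
- move=> phi sphi pphi.
  rewrite (cint_Re (fun x => f x + g x)) (cint_Re (fun x => F k x + G k x)).
  have [P1 hP1] := cbm_contR (smooth_continuous (k := k) sphi).
  have [P2 hP2] := cbm_contR (smooth_continuous (k := 0) sphi).
  rewrite (_ : (fun x => (f x + g x) * _) =
     (fun x => f x * (derive1n k phi x)%:C + g x * (derive1n k phi x)%:C)); last first.
    by apply/funext => x; rewrite mulrDl.
  rewrite (_ : (fun x => (F k x + G k x) * _) =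
     (fun x => F k x * (phi x)%:C + G k x * (phi x)%:C)); last first.
    by apply/funext => x; rewrite mulrDl.
  rewrite (cintD (cbmM bf hP1) (cbmM bg hP1)) (cintD (cbmM cF hP2) (cbmM cG hP2)).
  by rewrite wF // wG // -mulrDr signC ReM /= mul0r subr0 rmorphM.
- apply: (aeS bFG) => x h /h h'; rewrite normc_real.
  exact: le_trans (normc_Re _) h'.
Qed.

Lemma Winf_ReD N (f g : R -> C) (M M' : R) : (Winf N f <= M%:E)%E -> (Winf N g <= M'%:E)%E ->
  (Winf N (fun x => (complex.Re (f x + g x)%R)%:C) <= (M + M')%:E)%E.
Proof.
move=> hf hg; apply/lee_addgt0Pr => e e0; have e2 : 0 < e / 2 by lra.
have := Winf_le (winf_ReD (Winf_ex hf e2) (Winf_ex hg e2)).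
by rewrite -EFinD (_ : M + e / 2 + (M' + e / 2) = M + M' + e); last by field.
Qed.

Lemma derive1_periodic (phi : R -> R) : (forall x, derivable phi x 1) -> Defs.periodic phi ->
  Defs.periodic (derive1 phi).
Proof.
move=> d p x.
have h : is_derive x (1 : R) (fun y => phi (y + 2 * pi)) ((derive1 phi) (x + 2 * pi)).
  have h1 : is_derive x (1 : R) (fun y : R => y + 2 * pi) 1.
    by apply: (is_derive_eq (is_deriveD (is_derive_id x 1) (is_derive_cst (2 * pi) x 1)));
      rewrite addr0.
  have h2 : is_derive (x + 2 * pi) (1 : R) phi ((derive1 phi) (x + 2 * pi)).
    by rewrite derive1E; apply: DeriveDef.
  by have := @is_derive1_comp _ phi (fun y => y + 2 * pi) x _ _ h2 h1; rewrite mulr1.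
move: h; rewrite (_ : (fun y => _) = phi); last by apply/funext => y; rewrite p.
by move=> [_ <-]; rewrite derive1E.
Qed.

Lemma ibp_period (F F1 G G1 : R -> R) :
  (forall x : R, is_derive x (1 : R) F (F1 x)) -> continuous F1 -> Defs.periodic F ->
  (forall x : R, is_derive x (1 : R) G (G1 x)) -> continuous G1 -> Defs.periodic G ->
  cint (fun x => (F x)%:C * (G1 x)%:C) = - cint (fun x => (F1 x)%:C * (G x)%:C).
Proof.
move=> dF cF1 pF dG cG1 pG.
have cF : continuous F by apply: cont_der => x; have [] := dF x.
have cG : continuous G by apply: cont_der => x; have [] := dG x.
have [A hA] := cbm_contR cF; have [A1 hA1] := cbm_contR cF1.
have [B hB] := cbm_contR cG; have [B1 hB1] := cbm_contR cG1.
apply/eqP; rewrite -subr_eq0 opprK -(cintD (cbmM hA hB1) (cbmM hA1 hB)); apply/eqP.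
rewrite /cint; apply: complex_eqP; rewrite [LHS]/= [RHS]/=.
  rewrite (_ : (fun x => _) = (fun x => F x * G1 x + G x * F1 x)); last first.
    by apply/funext => x; rewrite !mulr0 !subr0 [F1 x * _]mulrC.
  have dFG (x : R) : is_derive x (1 : R) (fun x => F x * G x) (F x * G1 x + G x * F1 x).
    exact: is_deriveM.
  rewrite (FTC2_period dFG); first by have := pF 0; have := pG 0; rewrite !add0r => -> ->; rewrite subrr.
  by move=> x; apply: (@continuousD _ R R (fun x => F x * G1 x) (fun x => G x * F1 x));
    apply: continuousM; [exact: cF|exact: cG1|exact: cG|exact: cF1].
rewrite (_ : (fun x => _) = (fun=> 0)).
  by rewrite Rintegral_cst ?mul0r //; exact: mD.
by apply/funext => x; rewrite !mulr0 !mul0r !addr0.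
Qed.

(** Classical derivatives of a periodic function are weak derivatives, by integrating by parts once
    or twice over a period. *)
Lemma winf_C2 (F F1 F2 : R -> R) M :
  (forall x : R, is_derive x (1 : R) F (F1 x)) ->
  (forall x : R, is_derive x (1 : R) F1 (F2 x)) -> continuous F2 -> Defs.periodic F ->
  (forall x, [/\ `|F x| <= M, `|F1 x| <= M & `|F2 x| <= M]) ->
  winf 2 (fun x => (F x)%:C) M.
Proof.
move=> d1 d2 cF2 pF b.
have cF1 : continuous F1 by apply: cont_der => x; have [] := d2 x.
have cF : continuous F by apply: cont_der => x; have [] := d1 x.
have pF1 : Defs.periodic F1.
  have -> : F1 = derive1 F by apply/funext => x; rewrite derive1E; have [_ ->] := d1 x.
  by apply: derive1_periodic => // x; have [] := d1 x.
split; first by move=> x; rewrite pF.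
exists (fun k x => (match k with 0 => F | 1 => F1 | _ => F2 end x)%:C); split=> // k kN.
have hc : continuous (match k with 0 => F | 1 => F1 | _ => F2 end) by case: k kN => [|[|k]].
split.
- by split; apply: measurable_funTS; [exact: continuous_measurable_fun|exact: measurable_cst].
- move=> phi sphi pphi.
  have dphi n (x : R) : is_derive x (1 : R) (derive1n n phi) (derive1n n.+1 phi x).
    by rewrite derive1nS derive1E; apply: DeriveDef => //; exact: sphi.
  have cphi n : continuous (derive1n n phi) by exact: smooth_continuous.
  have pphi1 : Defs.periodic (derive1n 1 phi).
    by rewrite derive1n1; apply: derive1_periodic => // x; exact: (sphi 0%N).
  case: k kN {hc} => [|[|[|//]]] _ /=.
  + by rewrite expr0 mul1r.
  + by rewrite expr1 mulN1r (ibp_period d1 cF1 pF (dphi 0%N) (cphi 1%N) pphi).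
  + rewrite (ibp_period d1 cF1 pF (dphi 1%N) (cphi 2%N) pphi1).
    by rewrite (ibp_period d2 cF2 pF1 (dphi 0%N) (cphi 1%N) pphi) opprK sqrrN expr1n mul1r.
- apply: aeT => x _; rewrite normc_real; case: (b x).
  by case: k kN {hc} => [|[|k]].
Qed.

End Winf.

(** * Termwise differentiation of series *)

Section Series.
Context {R : realType}.

Lemma is_derive_quad (S : R -> R) (x G B d : R) : 0 < d ->
  (forall h, `|h| < d -> `|S (x + h) - S x - h * G| <= B * h ^+ 2) ->
  is_derive x (1 : R) S G.
Proof.
move=> d0 hS.
have key : (fun h => h^-1 *: ((S \o shift x) (h *: (1 : R)) - S x)) @ 0^' --> G.
  apply/cvgrPdist_le => e e0.
  have B1 : 0 < `|B| + 1 by rewrite ltr_wpDl.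
  near=> h.
  have hn : h != 0 by near: h; exact: nbhs_dnbhs_neq.
  have hd : `|h| < Num.min d (e / (`|B| + 1)).
    near: h; apply: dnbhs0_lt; rewrite lt_min d0 divr_gt0 //.
  move: hd; rewrite lt_min => /andP[hd he].
  rewrite /= -[h *: 1]/(h * 1) mulr1 [h + x]addrC distrC.
  rewrite -[h^-1 *: _]/(h^-1 * _).
  rewrite (_ : _ - G = h^-1 * (S (x + h) - S x - h * G)); last first.
    by rewrite [RHS]mulrBr mulKf.
  rewrite normrM normfV mulrC ler_pdivrMr ?normr_gt0 //.
  apply: (le_trans (hS h hd)); rewrite -real_normK ?num_real // expr2 mulrA.
  rewrite ler_wpM2r //; have := ler_norm B; have := normr_ge0 h.
  move: he; rewrite ltr_pdivlMr //; nra.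
by apply: DeriveDef; [apply/cvg_ex; exists G | exact: (cvg_lim _ key)].
Unshelve. all: by end_near. Qed.

Lemma mvt_between (f g : R -> R) (a b x y : R) :
  (forall z : R, a < z < b -> is_derive z (1 : R) f (g z)) -> a < x < b -> a < y < b ->
  exists c, [/\ a < c < b, `|c - x| <= `|y - x| & f y - f x = g c * (y - x)].
Proof.
move=> d.
have aux u v : u < v -> a < u < b -> a < v < b ->
    exists c, [/\ u < c, c < v & f v - f u = g c * (v - u)].
  move=> uv /andP[au ub] /andP[av vb].
  have [||c] := @MVT _ f g u v uv.
  - move=> z; rewrite in_itv /= => /andP[uz zv]; apply: d.
    by rewrite (lt_trans au) // (lt_trans zv).
  - apply: derivable_within_continuous => z; rewrite in_itv /= => /andP[uz zv].
    have h : a < z < b by rewrite (lt_le_trans au) // (le_lt_trans zv).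
    by have [] := d z h.
  - rewrite in_itv /= => /andP[h1 h2] e; exists c; split=> //.
move=> hx hy; have [xy|yx|xy] := ltgtP x y.
- have [c [c1 c2 e]] := aux _ _ xy hx hy; exists c; split=> //.
    move: hx hy; lra.
  by rewrite !ger0_norm; lra.
- have [c [c1 c2 e]] := aux _ _ yx hy hx; exists c; split=> //.
  + move: hx hy; lra.
  + by rewrite !ler0_norm; lra.
  + by rewrite -opprB e -mulrN opprB.
- by exists x; rewrite xy !subrr mulr0; split=> //; rewrite -?xy.
Qed.

(** The majorant also bounds the second derivatives, so each term has a Taylor remainder of at most
    [w i * k ^+ 2]. Over any finite list these add up to at most [B * k ^+ 2], and [is_derive_quad]
    concludes. *)
Lemma is_derive_rsum (I : choiceType) (f g h : I -> R -> R) (w : I -> R) B (a b : R) :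
  bsum w B ->
  (forall i (x : R), a < x < b -> is_derive x (1 : R) (f i) (g i x)) ->
  (forall i (x : R), a < x < b -> is_derive x (1 : R) (g i) (h i x)) ->
  (forall i x, a < x < b -> [/\ `|f i x| <= w i, `|g i x| <= w i & `|h i x| <= w i]) ->
  forall x : R, a < x < b ->
    is_derive x (1 : R) (fun y => rsum (fun i => f i y)) (rsum (fun i => g i x)).
Proof.
move=> bw df dg bd x xab.
pose d := Num.min (x - a) (b - x).
have d0 : 0 < d by rewrite lt_min; move: xab; lra.
apply: (@is_derive_quad _ _ _ B d d0) => k; rewrite lt_min => /andP[k1 k2].
have xk : a < x + k < b by move: (ler_norm k) (ler_norm (- k)); rewrite normrN; lra.
apply/ler_addgt0Pr => e e0.
have k0 := normr_ge0 k.
(* Three tails enter: two for values of the series and one, multiplied by [k], for the series of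
   derivatives. Together they amount to [(2 + |k|) * e'], which is below [e]. *)
have e4 : 0 < e / (3 + `|k|) by rewrite divr_gt0 //; lra.
have [F [uF tl]] := bsum_tail e4 bw.
set e' := e / _ in e4 tl.
have ee : e = e' * (3 + `|k|) by rewrite /e' divfK //; apply: lt0r_neq0; lra.
have T1 := @rsum_tail _ _ (fun i => f i (x + k)) w F e' (fun i => let: And3 a _ _ := bd i _ xk in a) uF tl.
have T2 := @rsum_tail _ _ (fun i => f i x) w F e' (fun i => let: And3 a _ _ := bd i _ xab in a) uF tl.
have T3 := @rsum_tail _ _ (fun i => g i x) w F e' (fun i => let: And3 _ a _ := bd i _ xab in a) uF tl.
have T4 : `|\sum_(i <- F) f i (x + k) - \sum_(i <- F) f i x - k * \sum_(i <- F) g i x| <= B * k ^+ 2.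
  rewrite mulr_sumr -!sumrB; apply: (le_trans (ler_norm_sum _ _ _)).
  apply: (@le_trans _ _ (\sum_(i <- F) w i * k ^+ 2)); last first.
    by rewrite -mulr_suml ler_wpM2r ?sqr_ge0 // bw.
  apply: ler_sum => i _.
  (* The mean value theorem is used twice: the remainder is [k * (g c - g x)], and
     [|c - x| <= |k|]. *)
  have [c [cab cx ->]] := mvt_between (df i) xab xk.
  have [c' [cab' cx' e1]] := mvt_between (dg i) xab cab.
  rewrite (_ : x + k - x = k) in cx *; last by ring.
  rewrite [k * g i x]mulrC -mulrBl e1 !normrM.
  have [_ _ hw] := bd i c' cab'.
  rewrite -[k ^+ 2]real_normK ?num_real // expr2 mulrA ler_wpM2r //.
  by rewrite ler_pM.
set S1 := rsum _ in T1 *; set S2 := rsum _ in T2 *; set S3 := rsum _ in T3 *.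
set s1 := \sum_(i <- F) _ in T1 T4; set s2 := \sum_(i <- F) _ in T2 T4.
set s3 := \sum_(i <- F) _ in T3 T4.
have -> : S1 - S2 - k * S3 = (s1 - s2 - k * s3) + ((S1 - s1) - (S2 - s2) - k * (S3 - s3)) by ring.
apply: (le_trans (ler_normD _ _)); apply: lerD => //.
apply: (le_trans (ler_normB _ _)); rewrite normrM.
have := ler_wpM2l k0 T3; have := ler_normB (S1 - s1) (S2 - s2); rewrite ee; lra.
Qed.

(** Majorants are asked for on bounded intervals only, because symbols may grow polynomially in
    [xi]. Those of three consecutive orders are added to obtain the single majorant of
    [is_derive_rsum]. *)
Lemma smooth_rsum (I : choiceType) (f : I -> R -> R) :
  (forall i, smooth (f i)) ->
  (forall n (r : R), exists w B, bsum w B /\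
     forall i x, - r < x < r -> `|derive1n n (f i) x| <= w i) ->
  smooth (fun x => rsum (fun i => f i x)) /\
  forall n, derive1n n (fun x => rsum (fun i => f i x)) =
            (fun x => rsum (fun i => derive1n n (f i) x)).
Proof.
move=> sf hb.
have dn n (x : R) : is_derive x (1 : R) (fun x => rsum (fun i => derive1n n (f i) x))
    (rsum (fun i => derive1n n.+1 (f i) x)).
  pose r := `|x| + 1.
  have [w0 [B0 [b0 h0]]] := hb n r; have [w1 [B1 [b1 h1]]] := hb n.+1 r.
  have [w2 [B2 [b2 h2]]] := hb n.+2 r.
  have xr : - r < x < r.
    by rewrite /r; have := ler_norm x; have := ler_norm (- x); rewrite normrN; lra.
  have d m i (y : R) : is_derive y (1 : R) (derive1n m (f i)) (derive1n m.+1 (f i) y).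
    by rewrite derive1nS derive1E; apply: DeriveDef => //; exact: sf.
  apply: (@is_derive_rsum _ (fun i => derive1n n (f i)) (fun i => derive1n n.+1 (f i))
     (fun i => derive1n n.+2 (f i)) _ _ (- r) r (bsumD (bsumD b0 b1) b2)) => //.
  move=> i y yr; have a0 := h0 i y yr; have a1 := h1 i y yr; have a2 := h2 i y yr.
  have n0 := le_trans (normr_ge0 _) a0; have n1 := le_trans (normr_ge0 _) a1.
  have n2 := le_trans (normr_ge0 _) a2; split; lra.
have eq n : derive1n n (fun x => rsum (fun i => f i x)) =
            (fun x => rsum (fun i => derive1n n (f i) x)).
  elim: n => [//|n IH]; rewrite derive1nS IH; apply/funext => x.
  by rewrite derive1E; have [_ ->] := dn n x.
by split=> // n x; rewrite eq; have [] := dn n x.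
Qed.

End Series.

(** * Sobolev bounds, interpolation and summability over the integers *)

Section Sobolev.
Context {R : realType}.
Local Notation C := R[i].
Implicit Types (u v z : fseq R) (k : int).

Lemma jap_ge1 (x : R) : 1 <= jap x.
Proof. by rewrite /jap le_max lexx. Qed.

Lemma jap_gt0 (x : R) : 0 < jap x.
Proof. exact: lt_le_trans (jap_ge1 x). Qed.

Lemma norm_le_jap (x : R) : `|x| <= jap x.
Proof. by rewrite /jap le_max lexx orbT. Qed.

Lemma jap_le (x y : R) : 1 <= y -> `|x| <= y -> jap x <= y.
Proof. by move=> h1 h2; rewrite /jap ge_max h1 h2. Qed.

Lemma jap_case (x : R) : jap x = 1 \/ jap x = `|x|.
Proof. by rewrite /jap; case: (leP 1 `|x|) => _; [right | left]. Qed.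

Lemma japN (x : R) : jap (- x) = jap x.
Proof. by rewrite /jap normrN. Qed.

Lemma japD (x y : R) : jap (x + y) <= jap x + jap y.
Proof.
apply: jap_le; first by rewrite -[1]addr0 lerD ?jap_ge1 // ltW // jap_gt0.
by apply: (le_trans (ler_normD _ _)); rewrite lerD ?norm_le_jap.
Qed.

Lemma powR_ge1 (x a : R) : 1 <= x -> 0 <= a -> 1 <= x `^ a.
Proof. by move=> x1 a0; rewrite -[X in X <= _](powRr0 x) ler_powR. Qed.

Lemma powR_natr (x : R) n : 0 <= x -> x `^ n%:R = x ^+ n.
Proof. exact: powR_mulrn. Qed.

Lemma sqr_powR (x a : R) : 0 <= x -> (x `^ a) ^+ 2 = x `^ (2 * a).
Proof. by move=> x0; rewrite -powR_natr ?powR_ge0 // -powRrM mulrC. Qed.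

Lemma powR_pD (x a b : R) : 0 < x -> x `^ (a + b) = x `^ a * x `^ b.
Proof. by move=> x0; rewrite powRD // (gt_eqF x0) implybT. Qed.

Lemma powR_mono (a x y : R) : 0 <= a -> 0 <= x -> x <= y -> x `^ a <= y `^ a.
Proof. by move=> a0 x0 xy; apply: ge0_ler_powR => //; rewrite nnegrE // (le_trans x0). Qed.

(** Squared form of [sobE s u <= M], to which it is equivalent for nonnegative [M] ([sobE_leP]). The
    sign of [M] is recorded because the square alone would lose it. *)
Definition Hb (s : R) u (M : R) : Prop :=
  0 <= M /\ bsum (fun k => jap k%:~R `^ (2 * s) * normc (u k) ^+ 2) (M ^+ 2).

Lemma Hb_term_ge0 s u k : 0 <= jap k%:~R `^ (2 * s) * normc (u k) ^+ 2.
Proof. by rewrite mulr_ge0 ?powR_ge0 ?sqr_ge0. Qed.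

Lemma sobE_leP s u (M : R) : 0 <= M -> (sobE s u <= M%:E)%E <-> Hb s u M.
Proof.
move=> M0; rewrite /sobE /Hb.
have -> : ((\esum_(k in [set: int]) (jap k%:~R `^ (2 * s) * normc (u k) ^+ 2)%:E)
     `^ (2^-1)%R <= M%:E)%E <->
  (\esum_(k in [set: int]) (jap k%:~R `^ (2 * s) * normc (u k) ^+ 2)%:E <= (M ^+ 2)%:E)%E.
  have : (0 <= \esum_(k in [set: int]) (jap k%:~R `^ (2 * s) * normc (u k) ^+ 2)%:E)%E.
    by apply: esum_ge0 => k _; rewrite lee_fin Hb_term_ge0.
  case: (\esum_(k in _) _)%E => [r||] //= h.
    rewrite !lee_fin powR12_sqrt //.
    by rewrite -[X in _ <= X <-> _](ger0_norm M0) -sqrtr_sqr ler_sqrt ?sqr_ge0.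
  by rewrite invr_eq0 pnatr_eq0 /= leNgt ltry leNgt ltry.
split=> [h|[_ h]].
  by split=> //; apply/esum_EFin_leE => // k; exact: Hb_term_ge0.
by apply/esum_EFin_leE => // k; exact: Hb_term_ge0.
Qed.

Lemma Hb_le s u M : Hb s u M -> (sobE s u <= M%:E)%E.
Proof. by move=> h; apply/sobE_leP; case: h. Qed.

Lemma sobE_ge0 s u : (0 <= sobE s u)%E.
Proof. exact: poweR_ge0. Qed.

Lemma sobE_fin s u : inH s u -> sobE s u = (sob s u)%:E.
Proof. by rewrite /inH /sob => h; rewrite fineK // fin_numE -ltey h gt_eqF // (lt_le_trans _ (sobE_ge0 _ _)) // ltNye. Qed.

Lemma sob_ge0 s u : 0 <= sob s u.
Proof. by rewrite /sob fine_ge0 // sobE_ge0. Qed.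

Lemma Hb_sob s u : inH s u -> Hb s u (sob s u).
Proof. by move=> h; apply/sobE_leP; rewrite ?sob_ge0 // sobE_fin. Qed.

Lemma Hb_inH s u M : Hb s u M -> inH s u.
Proof. by move=> /Hb_le h; apply: le_lt_trans h (ltry _). Qed.

Lemma sob_le s u M : Hb s u M -> sob s u <= M.
Proof. by move=> h; have := Hb_le h; rewrite (sobE_fin (Hb_inH h)). Qed.

Lemma Hb_mono s u M M' : M <= M' -> Hb s u M -> Hb s u M'.
Proof.
move=> MM [M0 h]; have M'0 := le_trans M0 MM; split=> //.
by apply: bsum_leB h; rewrite ler_sqr.
Qed.

Lemma Hb_dom s u v M : (forall k, normc (u k) <= normc (v k)) -> Hb s v M -> Hb s u M.
Proof.
move=> uv [M0 h]; split=> //; apply: bsum_le h => k.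
by rewrite ler_wpM2l ?powR_ge0 // lerXn2r // nnegrE normc_ge0.
Qed.

Lemma Hb_weak s s' u M : s <= s' -> Hb s' u M -> Hb s u M.
Proof.
move=> ss [M0 h]; split=> //; apply: bsum_le h => k.
by rewrite ler_wpM2r ?sqr_ge0 // ler_powR ?jap_ge1 // ler_pM2l.
Qed.

Lemma Hb_coef s u M k : Hb s u M -> jap k%:~R `^ s * normc (u k) <= M.
Proof.
move=> [M0 h]; have := bsum1 k h.
have p := ltW (jap_gt0 k%:~R).
rewrite -sqr_powR // -exprMn ler_sqr // nnegrE ?mulr_ge0 ?powR_ge0 ?normc_ge0 //.
Qed.

Lemma Hb_coef0 s u M k : 0 <= s -> Hb s u M -> normc (u k) <= M.
Proof.
move=> s0 h; apply: le_trans (Hb_coef k h); rewrite ler_peMl ?normc_ge0 //.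
by rewrite powR_ge1 // jap_ge1.
Qed.

(** The inequality [|a + b|^2 <= 2 |a|^2 + 2 |b|^2] replaces the triangle inequality. The extra
    factor 2 only costs constants, and it fixes the denominator 4 in [improve_perp]. *)
Lemma HbD s u v A B : Hb s u A -> Hb s v B -> Hb s (fun k => u k + v k) (2 * (A + B)).
Proof.
move=> [A0 hA] [B0 hB]; split; first by rewrite mulr_ge0 ?addr_ge0.
apply: (@bsum_leB _ _ _ (2 * A ^+ 2 + 2 * B ^+ 2)); first by nra.
apply: bsum_le (bsumD (bsumZ _ hA) (bsumZ _ hB)) => // k.
set w := _ `^ _; have w0 : 0 <= w by rewrite powR_ge0.
rewrite !(mulrCA 2) -mulrDr ler_wpM2l //.
have h := le_normcD (u k) (v k).
have a0 := normc_ge0 (u k); have b0 := normc_ge0 (v k); have c0 := normc_ge0 (u k + v k).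
have := sqr_ge0 (normc (u k) - normc (v k)); nra.
Qed.

Lemma HbZ s u A (c : C) : Hb s u A -> Hb s (fun k => c * u k) (normc c * A).
Proof.
move=> [A0 hA]; split; first by rewrite mulr_ge0 ?normc_ge0.
rewrite exprMn; apply: bsum_le (bsumZ _ hA); rewrite ?sqr_ge0 // => k.
by rewrite normcM exprMn mulrCA.
Qed.

Lemma Hb_ext s u v A : u =1 v -> Hb s u A -> Hb s v A.
Proof. by move=> /funext ->. Qed.

Lemma Hb_top s u M : Hb s u M -> Hb s (top u) M.
Proof. by apply: Hb_dom => k; rewrite /top; case: ifP => // _; rewrite normc0 normc_ge0. Qed.

Lemma Hb_perp s u M : Hb s u M -> Hb s (perp u) M.
Proof. by apply: Hb_dom => k; rewrite /perp; case: ifP => // _; rewrite normc0 normc_ge0. Qed.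

Lemma top_perp u k : top u k + perp u k = u k.
Proof. by rewrite /top /perp; case: ifP; rewrite ?addr0 ?add0r. Qed.

(* Interpolation between 0 and s, by splitting the frequencies at L. *)
Lemma Hb_interp (s0 s L : R) u A B : 0 <= s0 -> s0 <= s -> 1 <= L -> Hb 0 u A -> Hb s u B ->
  Hb s0 u (L `^ s0 * A + L `^ (s0 - s) * B).
Proof.
move=> s00 ss L1 [A0 hA] [B0 hB].
have L0 : 0 < L by apply: lt_le_trans L1.
split; first by rewrite addr_ge0 ?mulr_ge0 ?powR_ge0.
apply: (@bsum_leB _ _ _ (L `^ (2 * s0) * A ^+ 2 + L `^ (2 * (s0 - s)) * B ^+ 2)).
  rewrite -!sqr_powR ?(ltW L0) // -!exprMn.
  have p : 0 <= L `^ s0 * A by rewrite mulr_ge0 ?powR_ge0.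
  have q : 0 <= L `^ (s0 - s) * B by rewrite mulr_ge0 ?powR_ge0.
  nra.
apply: bsum_le (bsumD (bsumZ _ hA) (bsumZ _ hB)); rewrite ?powR_ge0 // => k.
rewrite mulr0 powRr0 mul1r mulrA -mulrDl ler_wpM2r ?sqr_ge0 //.
set J := jap _; have J1 : 1 <= J by exact: jap_ge1.
have J0 : 0 < J by exact: jap_gt0.
have [JL|LJ] := leP J L.
  rewrite -[X in X <= _]addr0; apply: lerD; last by rewrite mulr_ge0 ?powR_ge0.
  by apply: powR_mono; rewrite ?mulr_ge0 // (ltW J0).
rewrite -[X in X <= _]add0r; apply: lerD; first by rewrite powR_ge0.
have -> : 2 * s0 = 2 * (s0 - s) + 2 * s by ring.
rewrite powR_pD // ler_wpM2r ?powR_ge0 //.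
have -> : 2 * (s0 - s) = - (2 * (s - s0)) by ring.
rewrite !powRN lef_pV2 ?posrE ?powR_gt0 //.
by apply: powR_mono; rewrite ?mulr_ge0 ?subr_ge0 ?(ltW L0) ?(ltW LJ).
Qed.

Definition zbox (N : nat) : seq int :=
  [seq Posz n | n <- iota 0 N.+1] ++ [seq Negz n | n <- iota 0 N].

Lemma mem_zbox N k : (k \in zbox N) = (`|k| <= N)%N.
Proof.
rewrite /zbox mem_cat; case: k => n.
  rewrite (mem_map (f := Posz)) ?mem_iota ?add0n ?ltnS; last by move=> a b [].
  rewrite [X in _ || X](_ : _ = false) ?orbF //.
  by apply/negP => /mapP[m _].
rewrite [X in X || _](_ : _ = false); last by apply/negP => /mapP[m _].
by rewrite orFb (mem_map (f := Negz)) ?mem_iota ?add0n //; move=> a b [].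
Qed.

Lemma uniq_zbox N : uniq (zbox N).
Proof.
rewrite /zbox cat_uniq !map_inj_uniq ?iota_uniq /= ?andbT.
- by apply/hasPn => k /mapP[m _ ->]; apply/negP => /mapP[n _].
- by move=> a b [].
- by move=> a b [].
Qed.

Lemma absz_jap k (N : nat) : (`|k| <= N)%N = (`|k%:~R : R| <= N%:R).
Proof. by rewrite -intr_norm -[N%:R]/(N%:~R) ler_int lez_nat. Qed.

Lemma bsum_int_nat (g : nat -> R) B : (forall n, 0 <= g n) -> bsum g B ->
  bsum (fun k : int => g `|k|%N) (2 * B).
Proof.
move=> g0 h F uF; rewrite (bigID (fun k : int => 0 <= k)) /= mulr2n mulrDl mul1r.
have aux (P : pred int) : {in P &, injective absz} ->
    \sum_(k <- F | P k) g `|k|%N <= B.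
  move=> inj; rewrite -big_filter -(big_map absz xpredT g); apply: h.
  rewrite map_inj_in_uniq ?filter_uniq // => a b.
  by rewrite !mem_filter => /andP[Pa _] /andP[Pb _]; exact: inj.
by apply: lerD; apply: aux => a b; rewrite -!topredE /=; lia.
Qed.

Lemma bsum_inv_sqr : exists B : R, bsum (fun n : nat => (Num.max 1 n%:R : R) ^- 2) B.
Proof.
exists 3 => F uF.
pose g (n : nat) : R := (Num.max 1 n%:R) ^- 2.
have g0 n : 0 <= g n by rewrite invr_ge0 sqr_ge0.
(* Telescoping with [1 / (x + 1)^2 <= 1 / x - 1 / (x + 1)]. The indices 0 and 1 both contribute 1,
   hence the constant 3. *)
have hN N : \sum_(n <- iota 0 N.+2) g n <= 3 - (N.+1%:R)^-1.
  elim: N => [|N IH]; first by rewrite /= !big_cons big_nil /g !maxEle lexx ler10 expr1n invr1; lra.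
  rewrite (_ : iota 0 N.+3 = rcons (iota 0 N.+2) N.+2); last first.
    by rewrite -cats1 -[N.+3]addn1 iotaD.
  rewrite -cats1 big_cat big_seq1; apply: (le_trans (lerD IH (lexx _))).
  rewrite /g maxEle ler1n /=.
  have p1 : 0 < N.+1%:R :> R by rewrite ltr0n.
  have -> : N.+2%:R = N.+1%:R + 1 :> R by rewrite -natr1.
  move: (N.+1%:R : R) p1 => x p1.
  have xn : x != 0 by rewrite gt_eqF. have xn1 : x + 1 != 0 by rewrite gt_eqF // addr_gt0.
  rewrite -subr_ge0.
  have -> : 3 - (x + 1)^-1 - (3 - x^-1 + (x + 1) ^- 2) = x^-1 * (x + 1) ^- 2.
    by field; rewrite ?xn ?xn1 //; apply/andP.
  by rewrite mulr_ge0 ?invr_ge0 ?sqr_ge0 ?ltW.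
pose N := \max_(n <- F) n.
apply: (@le_trans _ _ (\sum_(n <- iota 0 N.+2) g n)).
  apply: ler_sum_subset; rewrite ?iota_uniq // => n nF.
  by rewrite mem_iota add0n ltnS leqW //; exact: (@leq_bigmax_seq _ F xpredT id n nF isT).
by apply: (le_trans (hN N)); rewrite gerBl invr_ge0.
Qed.

Lemma bsum_jap2 : exists2 B : R, 0 <= B & bsum (fun k : int => jap (k%:~R : R) ^- 2) B.
Proof.
have [B h] := bsum_inv_sqr; exists (2 * B).
  by rewrite mulr_ge0 // (bsum_ge0 h).
apply: bsum_le (bsum_int_nat _ h) => [k|n]; last by rewrite invr_ge0 sqr_ge0.
by rewrite /jap -intr_norm -abszE.
Qed.

(** Passing from a square sum to an absolutely convergent sum costs one power of [jap k], by
    Cauchy-Schwarz with the summable weight [jap k ^- 2]. *)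
Lemma l1_bound : exists2 c : R, 0 < c & forall a s u M, a + 1 <= s -> Hb s u M ->
  bsum (fun k => jap k%:~R `^ a * normc (u k)) (c * M).
Proof.
have [B B0 hB] := bsum_jap2; exists (B + 1); first by rewrite ltr_wpDl.
move=> a s u M ass /(Hb_weak ass) [M0 hM] F uF.
have S0 : 0 <= \sum_(k <- F) jap k%:~R `^ a * normc (u k).
  by apply: sumr_ge0 => k _; rewrite mulr_ge0 ?powR_ge0 ?normc_ge0.
rewrite -ler_sqr ?nnegrE //; last by rewrite mulr_ge0 // addr_ge0.
have -> : \sum_(k <- F) jap k%:~R `^ a * normc (u k) =
  \sum_(k <- F) jap k%:~R ^- 2 * (jap k%:~R `^ (a + 2) * normc (u k)).
  apply: eq_bigr => k _; have p := jap_gt0 (k%:~R : R).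
  rewrite powR_pD // powR_natr ?ltW // [_ `^ a * _ ^+ 2]mulrC -mulrA mulKf //.
  by rewrite expf_neq0 // gt_eqF.
apply: (le_trans (sqr_sum_weight_le _ _ _)); first by move=> k; rewrite invr_ge0 sqr_ge0.
rewrite exprMn.
apply: (@le_trans _ _ (B * M ^+ 2)); last by rewrite ler_wpM2r ?sqr_ge0 //; nra.
apply: ler_pM.
- by apply: sumr_ge0 => k _; rewrite invr_ge0 sqr_ge0.
- by apply: sumr_ge0 => k _; rewrite mulr_ge0 ?invr_ge0 ?sqr_ge0.
- exact: hB.
apply: le_trans (hM F uF); apply: ler_sum => k _; have p := jap_gt0 (k%:~R : R).
rewrite exprMn mulrA ler_wpM2r ?sqr_ge0 // sqr_powR ?(ltW p) //.
rewrite (_ : 2 * (a + 2) = 2%:R + 2 * (a + 1)); last by rewrite mulrDr; ring.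
by rewrite powR_pD // powR_natr ?(ltW p) // mulKf // expf_neq0 // gt_eqF.
Qed.

Definition I4 : choiceType := (bool * bool * (int * int))%type.

Definition freq (p : I4) : int :=
  let: (s1, s2, (j1, j2)) := p in sgnz s1 * j1 + sgnz s2 * j2.

Definition zz z (p : I4) : C :=
  let: (s1, s2, (j1, j2)) := p in zsgn s1 (z j1) * zsgn s2 (z j2).

Definition ibox (N : nat) : seq I4 :=
  [seq (b, j) | b <- [seq (x, y) | x <- [:: true; false], y <- [:: true; false]],
                j <- [seq (i, j) | i <- zbox N, j <- zbox N]].

Lemma mem_ibox N (p : I4) : (p \in ibox N) = (`|p.2.1| <= N)%N && (`|p.2.2| <= N)%N.
Proof.
case: p => -[s1 s2] [j1 j2]; rewrite -[(_, _).2.1]/j1 -[(_, _).2.2]/j2 -!mem_zbox /ibox.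
move: (zbox N) => Z; apply/allpairsP/andP => [[[b [i1 i2]] [_ h [_ -> ->]]]|[h1 h2]].
  by move/allpairsP: h => [[i j] [h1 h2 [-> ->]]].
exists ((s1, s2), (j1, j2)); split=> //; first by case: s1; case: s2.
by apply/allpairsP; exists (j1, j2).
Qed.

Lemma uniq_ibox N : uniq (ibox N).
Proof.
apply: allpairs_uniq => //.
  by apply: allpairs_uniq; rewrite ?uniq_zbox // => -[a b] [c d] /= _ _ ->.
by move=> [a b] [c d] /= _ _ ->.
Qed.

Lemma normc_zsgn b (w : C) : normc (zsgn b w) = normc w.
Proof. by case: b => //=; rewrite normc_conj. Qed.

Lemma normc_zz z p : normc (zz z p) = normc (z p.2.1) * normc (z p.2.2).
Proof. by case: p => -[s1 s2] [j1 j2] /=; rewrite normcM !normc_zsgn. Qed.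

(** The factor 4 counts the pairs of signs. *)
Lemma bsum_I4 (f g : int -> R) A B : (forall i, 0 <= f i) -> (forall i, 0 <= g i) ->
  bsum f A -> bsum g B -> bsum (fun p : I4 => f p.2.1 * g p.2.2) (4 * (A * B)).
Proof.
move=> f0 g0 hf hg.
have h4 : bsum (fun b : bool * bool => 1 : R) 4.
  move=> F uF; apply: (@le_trans _ _ (\sum_(i <- enum {: bool * bool}) 1)).
    apply: ler_sum_subset => //; first exact: enum_uniq.
    by move=> i _; rewrite mem_enum.
  by rewrite big_enum /= sumr_const card_prod card_bool.
have := bsum_prod (fun=> ler01) (fun q : int * int => mulr_ge0 (f0 q.1) (g0 q.2)) h4
  (bsum_prod f0 g0 hf hg).
by apply: bsum_le => p; rewrite mul1r.
Qed.

End Sobolev.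

(** * Comparison of frequencies on the support of the cut-offs *)

Section Cutoff.
Context {R : realType}.

Lemma norm_vec1 (x : R) : `|vec1 x| = `|x|.
Proof.
rewrite [LHS]mx_normrE; apply/eqP; rewrite eq_le; apply/andP; split.
  by apply: bigmax_le => // i _; rewrite mxE.
have := @le_bigmax _ _ _ 0 (fun ij : 'I_1 * 'I_1 => `|vec1 x ij.1 ij.2|) (0, 0).
by rewrite mxE.
Qed.

Lemma norm_vec2_le (x y M : R) : `|x| <= M -> `|y| <= M -> `|vec2 x y| <= M.
Proof.
move=> hx hy; rewrite [X in X <= _]mx_normrE; apply: bigmax_le => [|[i j] _].
  exact: le_trans hx.
by rewrite mxE; case: ifP.
Qed.

Lemma norm_vec2_ge (x y : R) : `|x| <= `|vec2 x y| /\ `|y| <= `|vec2 x y|.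
Proof.
have e : `|vec2 x y| = \big[Num.max/0]_ij `|vec2 x y ij.1 ij.2| := mx_normrE _.
have h := @le_bigmax _ _ _ 0 (fun ij : 'I_1 * 'I_2 => `|vec2 x y ij.1 ij.2|).
by rewrite e; split; [have := h (0, 0) | have := h (0, 1)]; rewrite /= mxE.
Qed.

Lemma flip_vec2_0 (x y : R) : flip 0 (vec2 x y) = vec2 (- x) y.
Proof. by apply/rowP => j; rewrite !mxE; case: eqP. Qed.

Lemma flip_vec2_1 (x y : R) : flip 1 (vec2 x y) = vec2 x (- y).
Proof. by apply/rowP => j; rewrite !mxE; case: (unliftP 1 j) => [i ->|->] //; rewrite (ord1 i). Qed.

Lemma cutoff_bounded p (delta0 : R) (chi : 'rV[R]_p * R -> R) : cutoff delta0 chi ->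
  exists2 K, 0 < K & forall v xi, `|chi (v, xi)| <= K.
Proof.
move=> [_ _ _ _ /(_ [::]) [K h]]; exists (`|K| + 1); first by rewrite ltr_wpDl.
move=> v xi; have := h v xi; rewrite /= oppr0 powRr0 mulr1.
by move=> /le_trans; apply; rewrite (le_trans (ler_norm K)) // lerDl.
Qed.

(** Each of [a] and [b] differs from the midpoint by at most a tenth of its bracket, so input,
    output and midpoint frequencies are comparable. The operator estimates rest on this. *)
Lemma localized (a b : R) : `|b - a| <= jap ((a + b) / 2) / 5 ->
  [/\ jap b <= 2 * jap a, jap ((a + b) / 2) <= 2 * jap a & jap a <= 2 * jap ((a + b) / 2)].
Proof.
rewrite ler_norml.
have x1 := jap_ge1 ((a + b) / 2); have x2 := norm_le_jap ((a + b) / 2).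
have a1 := jap_ge1 a; have a2 := norm_le_jap a.
move: a2 x2; rewrite !ler_norml => /andP[a2 a3] /andP[x2 x3] /andP[h1 h2].
have h : [/\ jap ((a + b) / 2) <= 3 / 2 * jap a & jap a <= 2 * jap ((a + b) / 2)].
  split; last by apply: jap_le; rewrite ?ler_norml; lra.
  case: (jap_case ((a + b) / 2)) => e; first by lra.
  move: e; case: (ler0P ((a + b) / 2)) => h0 e; lra.
case: h => h3 h4; split=> //; last by lra.
by apply: jap_le; rewrite ?ler_norml; lra.
Qed.

End Cutoff.

(** * Bony-Weyl operators as finite sums and as limits of finite sums *)

Section Operators.
Context {R : realType}.
Local Notation C := R[i].
Variables (delta0 : R) (chi : 'rV[R]_1 * R -> R) (chi2 : 'rV[R]_2 * R -> R).
Hypotheses (hdelta0 : 0 < delta0 <= 10^-1).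
Hypotheses (hchi : cutoff delta0 chi) (hchi2 : cutoff delta0 chi2).
Implicit Types (A : qcoef R) (z v : fseq R) (k : int) (p : @I4) (a : symbol R).

Definition mid (j k : int) : R := (j + k)%:~R / 2.

Lemma chi_supp (n : R) xi : chi (vec1 n, xi) != 0 -> `|n| <= jap xi / 10.
Proof.
case: hchi => _ _ h _ _ /h; rewrite norm_vec1 => h1.
by have := jap_gt0 xi; move: hdelta0; nra.
Qed.

Lemma chi2_supp (x y : R) xi : chi2 (vec2 x y, xi) != 0 ->
  `|x| <= jap xi / 10 /\ `|y| <= jap xi / 10.
Proof.
case: hchi2 => _ _ h _ _ /h h1; have [hx hy] := norm_vec2_ge x y.
by have := jap_gt0 xi; move: hdelta0; split; nra.
Qed.

(** Each of the two frequencies is at most a tenth of [jap xi], and [freq p] is their signed sum;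
    one fifth is the threshold in [localized]. *)
Lemma chi2_supp_freq p xi :
  chi2 (vec2 p.2.1%:~R p.2.2%:~R, xi) != 0 -> `|(freq p)%:~R| <= jap xi / 5.
Proof.
case: p => -[s1 s2] [j1 j2] /chi2_supp /= [h1 h2].
have e s (j : int) : `|(sgnz s * j)%:~R : R| = `|j%:~R|.
  by case: s; rewrite ?mul1r // mulN1r rmorphN normrN.
rewrite intrD; apply: (le_trans (ler_normD _ _)); rewrite !e; lra.
Qed.

Lemma freq_shift p k : `|(freq p)%:~R| <= jap (mid (k - freq p) k) / 5 ->
  [/\ jap (k%:~R : R) <= 2 * jap (k - freq p)%:~R,
      jap (mid (k - freq p) k) <= 2 * jap (k - freq p)%:~R,
      jap (k - freq p)%:~R <= 2 * jap (mid (k - freq p) k) &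
      jap (mid (k - freq p) k) <= 2 * jap (k%:~R : R)].
Proof.
move=> h; have e : mid (k - freq p) k = ((k - freq p)%:~R + k%:~R) / 2.
  by rewrite /mid intrD.
have [|h1 h2 h3] := @localized R (k - freq p)%:~R k%:~R.
  by rewrite -e intrB subKr.
have [|_ h4 _] := @localized R k%:~R (k - freq p)%:~R.
  by rewrite [k%:~R + _]addrC -e intrB addrAC subrr add0r normrN.
by move: h2 h3 h4; rewrite [k%:~R + _]addrC -e; split.
Qed.

Lemma jap_int_le k : jap (k%:~R : R) <= `|k|%N%:R + 1.
Proof.
apply: jap_le; first by rewrite lerDr.
by rewrite -intr_norm -abszE lerDl.
Qed.

Definition At A p (xi : R) : C := let: (s1, s2, (j1, j2)) := p in A s1 s2 j1 j2 xi.

(* The summands of a quadratic symbol quantized with chi2, and with chi after evaluation at z. *)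
Definition term2 A z v k p : C :=
  (chi2 (vec2 p.2.1%:~R p.2.2%:~R, mid (k - freq p) k))%:C
    * At A p (mid (k - freq p) k) * zz z p * v (k - freq p).

Definition term1 A z v k p : C :=
  (chi (vec1 (freq p)%:~R, mid (k - freq p) k))%:C
    * At A p (mid (k - freq p) k) * zz z p * v (k - freq p).

(** On the support of [chi2] both frequencies are at most a tenth of the bracket of the midpoint,
    itself at most [2 * jap k]. A given output frequency thus sees finitely many indices. *)
Lemma term2_out A z v k N p : (`|k|.+1 <= N)%N -> p \notin ibox N -> term2 A z v k p = 0.
Proof.
move=> kN; rewrite mem_ibox => hp; rewrite /term2.
have [->|hn] := eqVneq (chi2 (vec2 p.2.1%:~R p.2.2%:~R, mid (k - freq p) k)) 0.
  by rewrite !mul0r.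
have [_ _ _ h4] := freq_shift (chi2_supp_freq hn).
have [h1 h2] := chi2_supp hn.
have kk := jap_int_le k; have k1 := jap_ge1 (k%:~R : R).
have : `|k|%N.+1%:R <= N%:R :> R by rewrite ler_nat.
rewrite -natr1 => hN.
by case/negP: hp; rewrite !(absz_jap (R := R)); apply/andP; split; [apply: (le_trans h1) | apply: (le_trans h2)]; lra.
Qed.

Lemma OpBW2_box A z v k N : (`|k|.+1 <= N)%N ->
  OpBW2 chi2 A z v k = \sum_(p <- ibox N) term2 A z v k p.
Proof.
move=> kN; rewrite -(csum_fin (uniq_ibox N)); last by move=> p; exact: term2_out.
apply: csum_ext => -[[s1 s2] [j1 j2]]; rewrite /term2 /mid /= -!mulrA.
by congr (_ * (_ * _)); rewrite !mulrA.
Qed.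

Lemma OpBW_box a v k : OpBW chi a v k = \sum_(j <- zbox (2 * `|k|.+1))
  (chi (vec1 (k - j)%:~R, mid j k))%:C * fcoef (fun x => a x (mid j k)) (k - j) * v j.
Proof.
apply: csum_fin; first exact: uniq_zbox.
move=> j; rewrite mem_zbox => hj; rewrite /= -/(mid j k).
have [->|hn] := eqVneq (chi (vec1 (k - j)%:~R, mid j k)) 0; first by rewrite !mul0r.
have h := chi_supp hn; case/negP: hj; rewrite (absz_jap (R := R)).
have x0 := jap_gt0 (mid j k).
have [|h1 _ _] := @localized R k%:~R j%:~R.
  rewrite [k%:~R + _]addrC -intrD -/(mid j k) distrC -intrB.
  by apply: (le_trans h); lra.
have := norm_le_jap (j%:~R : R); have := jap_int_le k.
rewrite natrM -natr1; lra.
Qed.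

(** Expresses that the coefficients of [a] are sums of those of [A], as a limit over growing boxes;
    summability over the indices of a given frequency need not be carried along. *)
Definition fapprox A z a : Prop := forall (xi : R) (n : int) (e : R), 0 < e ->
  exists N0, forall N, (N0 <= N)%N ->
    normc (fcoef (fun x => a x xi) n - \sum_(p <- ibox N | freq p == n) At A p xi * zz z p) <= e.

Lemma eventually_seq (T : eqType) (F : seq T) (P : T -> nat -> Prop) :
  (forall j, exists N0, forall N, (N0 <= N)%N -> P j N) ->
  exists N0, forall N, (N0 <= N)%N -> forall j, j \in F -> P j N.
Proof.
move=> h; elim: F => [|a F [N0 IH]]; first by exists 0%N.
have [N1 h1] := h a; exists (maxn N0 N1) => N; rewrite geq_max => /andP[n0 n1] j.
by rewrite inE => /orP[/eqP ->|jF]; [exact: h1 | exact: IH].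
Qed.

(** Regrouping of the indices by their total frequency [k - j]. An index whose [j] falls outside the
    box on the right is killed by [chi]. *)
Lemma term1_box A z v k N :
  \sum_(p <- ibox N) term1 A z v k p =
  \sum_(j <- zbox (2 * `|k|.+1)) (chi (vec1 (k - j)%:~R, mid j k))%:C
    * (\sum_(p <- ibox N | freq p == k - j) At A p (mid j k) * zz z p) * v j.
Proof.
under [RHS]eq_bigr => j _ do rewrite mulr_sumr mulr_suml big_mkcond /=.
rewrite exchange_big /=; apply: eq_bigr => p _.
have [jin|jout] := boolP (k - freq p \in zbox (2 * `|k|.+1)).
  rewrite (bigD1_seq (k - freq p)) ?uniq_zbox //= subKr eqxx.
  rewrite [X in _ = _ + X]big1 ?addr0.
    by rewrite /term1 !mulrA.
  by move=> j jn; case: eqP => // e; move: jn; rewrite e subKr eqxx.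
rewrite big1_seq; last first.
  move=> j /andP[_ jF]; case: eqP => // e; move: jout.
  by rewrite e subKr jF.
have [h|hn] := eqVneq (chi (vec1 (freq p)%:~R, mid (k - freq p) k)) 0.
  by rewrite /term1 h !mul0r.
case/negP: jout; rewrite mem_zbox (absz_jap (R := R)).
have x0 := jap_gt0 (mid (k - freq p) k).
have [|h1 _ _] := @localized R k%:~R (k - freq p)%:~R.
  rewrite [k%:~R + _]addrC -intrD -/(mid _ _) intrB addrAC subrr add0r normrN.
  by apply: (le_trans (chi_supp hn)); lra.
have := norm_le_jap ((k - freq p)%:~R : R); have := jap_int_le k.
rewrite natrM -natr1; lra.
Qed.

Lemma OpBW_lim A z a v k e : fapprox A z a -> 0 < e -> exists N0, forall N, (N0 <= N)%N ->
  normc (OpBW chi a v k - \sum_(p <- ibox N) term1 A z v k p) <= e.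
Proof.
move=> ha e0; pose Z := zbox (2 * `|k|.+1).
pose c j := normc ((chi (vec1 (k - j)%:~R, mid j k))%:C : C) * normc (v j).
pose S := \sum_(j <- Z) c j + 1.
have c0 j : 0 <= c j by rewrite mulr_ge0 ?normc_ge0.
have S0 : 0 < S by rewrite ltr_wpDl // sumr_ge0.
have eS : 0 < e / S by rewrite divr_gt0.
have [N0 hN] := eventually_seq Z (fun j => ha (mid j k) (k - j) _ eS).
exists N0 => N /hN h; rewrite OpBW_box term1_box -sumrB.
apply: (le_trans (normc_sum _ _)).
apply: (@le_trans _ _ (\sum_(j <- Z) c j * (e / S))).
  rewrite big_seq [X in _ <= X]big_seq; apply: ler_sum => j /h hj.
  by rewrite -mulrBl -mulrBr !normcM mulrAC; apply: ler_wpM2l; [exact: c0 | exact: hj].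
by rewrite -mulr_suml mulrCA ler_piMr ?(ltW e0) // ler_pdivrMr // mul1r /S lerDl.
Qed.

Lemma bsum_shift (f : int -> R) B (n : int) : bsum f B -> bsum (fun k => f (k - n)) B.
Proof. by apply: bsum_inj => a b /addIr. Qed.

(** Cauchy-Schwarz with the weights [W p], then exchange of the sums: each [p] acts as a translation
    by [freq p], which preserves square sums. The operator norm is at most the total weight once the
    factor [g] is moved onto [v]. *)
Lemma schur (P : seq (@I4)) (c : @I4 -> int -> C) (W : @I4 -> R) (g : int -> R) v H :
  (forall p, 0 <= W p) -> (forall j, 0 <= g j) ->
  (forall p k, p \in P -> normc (c p k) <= W p * g (k - freq p)) ->
  bsum (fun j => (g j * normc (v j)) ^+ 2) (H ^+ 2) ->
  bsum (fun k => normc (\sum_(p <- P) c p k * v (k - freq p)) ^+ 2)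
    (((\sum_(p <- P) W p) * H) ^+ 2).
Proof.
move=> W0 g0 hc hH F uF; set S := \sum_(p <- P) W p.
have S0 : 0 <= S by rewrite sumr_ge0.
apply: (@le_trans _ _ (\sum_(k <- F) S * \sum_(p <- P) W p * (g (k - freq p) * normc (v (k - freq p))) ^+ 2)).
  apply: ler_sum => k _; apply: le_trans (sqr_sum_weight_le _ _ W0).
  rewrite lerXn2r // ?nnegrE ?normc_ge0 //.
    by apply: sumr_ge0 => p _; rewrite !mulr_ge0 ?normc_ge0.
  apply: (le_trans (normc_sum _ _)); rewrite big_seq [X in _ <= X]big_seq.
  by apply: ler_sum => p pP; rewrite normcM mulrA ler_wpM2r ?normc_ge0 // hc.
rewrite -mulr_sumr exchange_big /= exprMn expr2 -mulrA ler_wpM2l //.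
rewrite mulr_suml; apply: ler_sum => p _; rewrite -mulr_sumr ler_wpM2l //.
exact: (bsum_shift (freq p) hH uF).
Qed.

(** A Fatou property: for a fixed finite list of frequencies the sums converge, so the bound passes
    to the pointwise limit. *)
Lemma bsum_sqr_lim (b : nat -> int -> C) (r : int -> C) (w : int -> R) B :
  (forall k e, 0 < e -> exists N0, forall N, (N0 <= N)%N -> normc (r k - b N k) <= e) ->
  (forall N, bsum (fun k => w k * normc (b N k) ^+ 2) B) ->
  bsum (fun k => w k * normc (r k) ^+ 2) B.
Proof.
move=> lim hb F uF.
have c1 k : (fun N => normc (b N k)) @ \oo --> normc (r k).
  apply/cvgrPdist_le => e /(lim k) [N0 h]; exists N0 => // N /= /h h1.
  rewrite ler_norml; apply/andP; split.
    have := le_normcD (b N k - r k) (r k); rewrite subrK normcB; lra.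
  have := le_normcD (r k - b N k) (b N k); rewrite subrK; lra.
have c2 : (fun N => \sum_(k <- F) w k * normc (b N k) ^+ 2) @ \oo -->
    \sum_(k <- F) w k * normc (r k) ^+ 2.
  elim: {uF} F => [|a F IH].
    rewrite big_nil (_ : (fun N => _) = (fun=> 0)); first exact: cvg_cst.
    by apply/funext => N; rewrite big_nil.
  rewrite big_cons (_ : (fun N => _) = (fun N => w a * normc (b N a) ^+ 2 +
     \sum_(k <- F) w k * normc (b N k) ^+ 2)).
    apply: cvgD IH; apply: cvgM; first exact: cvg_cst.
    by rewrite expr2; apply: cvgM.
  by apply/funext => N; rewrite big_cons.
apply: (cvgr_to_le c2); apply: nearW => N; exact: hb.
Qed.

End Operators.

(** * Operator estimates: change of cut-off, remaining interactions, crude bounds *)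

Section Estimates.
Context {R : realType}.
Local Notation C := R[i].
Variables (delta0 : R) (chi : 'rV[R]_1 * R -> R) (chi2 : 'rV[R]_2 * R -> R).
Hypotheses (hdelta0 : 0 < delta0 <= 10^-1).
Hypotheses (hchi : cutoff delta0 chi) (hchi2 : cutoff delta0 chi2).
Implicit Types (A : qcoef R) (z v : fseq R) (k : int) (p : @I4) (a : symbol R).

(* The part of the quadratic symbol that depends on z^top only. *)
Definition tt p : bool := (`|p.2.1|%N == 1%N) && (`|p.2.2|%N == 1%N).

(** Order one in [xi] accommodates both [Vavg_coef] and, since [alpha <= 1], the symbol [a2]. The
    product of the brackets dominates the maximum used in [Gamma2] and splits over the two factors
    of [z]. *)
Definition Abnd A (mu K0 : R) : Prop := forall p xi,
  normc (At A p xi) <= K0 * (jap p.2.1%:~R * jap p.2.2%:~R) `^ mu * jap xi.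

Definition cdiff p k : R := chi2 (vec2 p.2.1%:~R p.2.2%:~R, mid (k - freq p) k)
  - chi (vec1 (freq p)%:~R, mid (k - freq p) k).

Lemma freq_le p (M : R) : `|p.2.1%:~R : R| <= M -> `|p.2.2%:~R : R| <= M ->
  `|(freq p)%:~R| <= 2 * M.
Proof.
case: p => -[s1 s2] [j1 j2] /= h1 h2.
have e s (j : int) : `|(sgnz s * j)%:~R : R| = `|j%:~R|.
  by case: s; rewrite ?mul1r // mulN1r rmorphN normrN.
rewrite intrD; apply: (le_trans (ler_normD _ _)); rewrite !e; lra.
Qed.

(* Both cut-offs are 1 at low frequencies j1, j2, so their difference only sees
   xi of the size of the frequencies of z: this is the smoothing effect. *)
Lemma cdiff_supp p k : cdiff p k != 0 ->
  [/\ jap (k%:~R : R) <= 2 * jap (k - freq p)%:~R,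
      jap (k - freq p)%:~R <= 2 * jap (mid (k - freq p) k : R),
      jap (mid (k - freq p) k) <= 4 / delta0 * (jap p.2.1%:~R * jap p.2.2%:~R) &
      tt p -> jap (mid (k - freq p) k) <= 4 / delta0].
Proof.
set x := jap (mid (k - freq p) k) => hn.
have [d0 d1] := andP hdelta0.
have x0 : 0 < x := jap_gt0 _.
have hf : `|(freq p)%:~R| <= x / 5.
  have [e|n2] := eqVneq (chi2 (vec2 p.2.1%:~R p.2.2%:~R, mid (k - freq p) k)) 0.
    have n1 : chi (vec1 (freq p)%:~R, mid (k - freq p) k) != 0.
      by move: hn; rewrite /cdiff e sub0r oppr_eq0.
    by apply: (le_trans (chi_supp hdelta0 hchi n1)); rewrite -/x; lra.
  exact: (chi2_supp_freq hdelta0 hchi2 n2).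
have [h1 _ h3 _] := freq_shift hf.
have big : (delta0 * x / 4 <= `|p.2.1%:~R : R|) || (delta0 * x / 4 <= `|p.2.2%:~R : R|).
  rewrite -[_ || _]negbK negb_or -!ltNge; apply/negP => /andP[l1 l2].
  have e2 : chi2 (vec2 p.2.1%:~R p.2.2%:~R, mid (k - freq p) k) = 1.
    case: hchi2 => _ _ _ h _; apply: h; rewrite -/x; apply: norm_vec2_le; nra.
  have e1 : chi (vec1 (freq p)%:~R, mid (k - freq p) k) = 1.
    case: hchi => _ _ _ h _; apply: h; rewrite -/x norm_vec1.
    by apply: (le_trans (freq_le (ltW l1) (ltW l2))); lra.
  by move: hn; rewrite /cdiff e1 e2 subrr eqxx.
have j1 := jap_ge1 (p.2.1%:~R : R); have j2 := jap_ge1 (p.2.2%:~R : R).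
have n1 := norm_le_jap (p.2.1%:~R : R); have n2 := norm_le_jap (p.2.2%:~R : R).
split=> //.
  rewrite mulrAC ler_pdivlMr // [x * _]mulrC.
  by case/orP: big => b; nra.
move=> /andP[/eqP t1 /eqP t2]; rewrite ler_pdivlMr // [x * _]mulrC.
have a (j : int) : `|j|%N = 1%N -> `|j%:~R : R| = 1 by move=> e; rewrite -intr_norm -abszE e.
by case/orP: big; rewrite a //; lra.
Qed.

Definition W1 (m : R) z p : R := jap p.2.1%:~R `^ m * normc (z p.2.1)
  * (jap p.2.2%:~R `^ m * normc (z p.2.2)).

(** Weight for pairs with at least one index outside [{1, -1}] ([W1_W2]): there the corresponding
    factor may be written with [perp z], which brings in the smallness of z^perp. *)
Definition W2 (m : R) z p : R :=
  jap p.2.1%:~R `^ m * normc (perp z p.2.1) * (jap p.2.2%:~R `^ m * normc (z p.2.2))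
  + jap p.2.1%:~R `^ m * normc (z p.2.1) * (jap p.2.2%:~R `^ m * normc (perp z p.2.2)).

Lemma W1_ge0 m z p : 0 <= W1 m z p.
Proof. by rewrite !mulr_ge0 ?powR_ge0 ?normc_ge0. Qed.

Lemma W2_ge0 m z p : 0 <= W2 m z p.
Proof. by rewrite addr_ge0 ?mulr_ge0 ?powR_ge0 ?normc_ge0. Qed.

Lemma W1_zz m z p : normc (zz z p) * (jap p.2.1%:~R * jap p.2.2%:~R) `^ m = W1 m z p.
Proof.
rewrite normc_zz powRM ?(ltW (jap_gt0 _)) // /W1.
by ring.
Qed.

Lemma W1_W2 m z p : ~~ tt p -> W1 m z p <= W2 m z p.
Proof.
rewrite /tt negb_and /W1 /W2 => /orP[] h.
  have -> : perp z p.2.1 = z p.2.1 by rewrite /perp (negbTE h).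
  by rewrite lerDl !mulr_ge0 ?powR_ge0 ?normc_ge0.
have -> : perp z p.2.2 = z p.2.2 by rewrite /perp (negbTE h).
by rewrite lerDr !mulr_ge0 ?powR_ge0 ?normc_ge0.
Qed.

Lemma W_sums (m s0 : R) : m + 1 <= s0 -> exists2 c : R, 0 < c & forall z Mz Mp,
  Hb s0 z Mz -> Hb s0 (perp z) Mp ->
  bsum (W1 m z) (c * (Mz * Mz)) /\ bsum (W2 m z) (c * (Mp * Mz)).
Proof.
move=> ms; have [c c0 hc] := @l1_bound R.
exists (8 * c ^+ 2); first by rewrite mulr_gt0 // exprn_gt0.
move=> z Mz Mp hz hp.
have hz1 := hc _ _ _ _ ms hz; have hp1 := hc _ _ _ _ ms hp.
have z0 := proj1 hz; have p0 := proj1 hp.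
have t0 u i : 0 <= jap (i%:~R : R) `^ m * normc ((u : fseq R) i).
  by rewrite mulr_ge0 ?powR_ge0 ?normc_ge0.
split.
  apply: (@bsum_leB _ _ _ (4 * (c * Mz * (c * Mz)))); first by nra.
  exact: (bsum_I4 (t0 z) (t0 z) hz1 hz1).
apply: (@bsum_leB _ _ _ (4 * (c * Mp * (c * Mz)) + 4 * (c * Mz * (c * Mp)))); first by nra.
exact: bsumD (bsum_I4 (t0 (perp z)) (t0 z) hp1 hz1) (bsum_I4 (t0 z) (t0 (perp z)) hz1 hp1).
Qed.

Lemma sum_ibox_W (W : @I4 -> R) (P : pred (@I4)) B N : (forall p, 0 <= W p) ->
  bsum W B -> \sum_(p <- [seq p <- ibox N | P p]) W p <= B.
Proof. by move=> W0; apply; rewrite filter_uniq // uniq_ibox. Qed.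

Lemma normc_real_ge0 (x : R) : 0 <= x -> normc (x%:C : C) = x.
Proof. by move=> x0; rewrite normc_real ger0_norm. Qed.

Lemma weight_sqr (s : R) k (w : C) : jap k%:~R `^ (2 * s) * normc w ^+ 2 =
  normc ((jap k%:~R `^ s)%:C * w) ^+ 2.
Proof.
by rewrite normcM normc_real_ge0 ?powR_ge0 // exprMn sqr_powR // ltW // jap_gt0.
Qed.

(** The two terms of the bound reflect the splitting by [tt]. Off [tt] one factor lies in z^perp,
    all [s] derivatives stay on [v], and the growth in [xi] is paid by the frequencies of [z],
    whence the weight [mu + 1]. On [tt] those frequencies are 1 in modulus, so [cdiff_supp] bounds
    [xi] and the output frequency by constants, and the L^2 norm of [v] suffices. *)
Lemma BW_remainder (s0 mu K0 s : R) : 0 <= mu -> 0 <= K0 -> mu + 2 <= s0 -> 0 <= s ->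
  exists2 K : R, 0 <= K & forall A z v a Mz Mp Ms M0,
    Abnd A mu K0 -> fapprox A z a ->
    Hb s0 z Mz -> Hb s0 (perp z) Mp -> Hb s v Ms -> Hb 0 v M0 ->
    Hb s (fun k => OpBW2 chi2 A z v k - OpBW chi a v k) (K * (Mp * Mz * Ms + Mz ^+ 2 * M0)).
Proof.
move=> mu0 K00 hs0 s_0.
have [d0 d1] := andP hdelta0.
have [K1 K1p hK1] := cutoff_bounded hchi; have [K2 K2p hK2] := cutoff_bounded hchi2.
have [|c c0 hW] := @W_sums (mu + 1) s0; first by lra.
(* The factor [4 / delta0] is the price of replacing [jap xi] by the product of the brackets of [j1]
   and [j2]. *)
pose L := (K1 + K2) * K0 * (4 / delta0).
have L0 : 0 <= L by rewrite !mulr_ge0 // ?addr_ge0 ?ltW // invr_gt0.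
(* On [tt] the output satisfies [jap k <= 2 * jap (k - freq p) <= 4 * jap mid <= 16 / delta0]. *)
pose T := (16 / delta0) `^ s.
have T0 : 0 <= T by rewrite powR_ge0.
have EL : L = (K1 + K2) * K0 * (4 / delta0) by [].
have ET : T = (16 / delta0) `^ s by [].
clearbody L T.
pose K := 2 * (L * c * (2 `^ s) + L * T * c).
have c_0 := ltW c0.
have K_0 : 0 <= K by rewrite mulr_ge0 // addr_ge0 // !mulr_ge0 // ?powR_ge0.
exists K => //.
move=> A z v a Mz Mp Ms M0 hA ha hz hp hv hv0.
have z0 := proj1 hz; have p0 := proj1 hp; have v0 := proj1 hv; have v00 := proj1 hv0.
have [hW1 hW2] := hW z Mz Mp hz hp.
have B0 : 0 <= K * (Mp * Mz * Ms + Mz ^+ 2 * M0).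
  by rewrite mulr_ge0 // addr_ge0 // !mulr_ge0 // sqr_ge0.
split=> //.
pose c' p k : C := (jap k%:~R `^ s)%:C * ((cdiff p k)%:C * At A p (mid (k - freq p) k) * zz z p).
pose b N k := \sum_(p <- ibox N) (term2 chi2 A z v k p - term1 chi A z v k p).
have bE N k : (jap k%:~R `^ s)%:C * b N k =
    \sum_(p <- [seq p <- ibox N | tt p]) c' p k * v (k - freq p)
  + \sum_(p <- [seq p <- ibox N | ~~ tt p]) c' p k * v (k - freq p).
  rewrite !big_filter /b mulr_sumr (bigID tt) /=.
  by congr (_ + _); apply: eq_bigr => p _; rewrite /c' /cdiff /term1 /term2 rmorphB /=; ring.
have key p k : normc (c' p k) <=
    L * W1 (mu + 1) z p * (2 `^ s * jap (k - freq p)%:~R `^ s) /\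
    (tt p -> normc (c' p k) <= L * T * W1 (mu + 1) z p * 1).
  have jj0 : 0 < jap (p.2.1%:~R : R) * jap p.2.2%:~R by rewrite mulr_gt0 ?jap_gt0.
  have [e|n] := eqVneq (cdiff p k) 0.
    rewrite /c' e !mul0r mulr0 normc0.
    have w0 := W1_ge0 (mu + 1) z p; split=> [|_].
      exact: mulr_ge0 (mulr_ge0 L0 w0) (mulr_ge0 (powR_ge0 _ _) (powR_ge0 _ _)).
    by rewrite mulr1; exact: mulr_ge0 (mulr_ge0 L0 T0) w0.
  have [h1 h2 h3 h4] := cdiff_supp n.
  have hc : `|cdiff p k| <= K1 + K2.
    by apply: (le_trans (ler_normB _ _)); rewrite addrC lerD.
  have base : normc ((cdiff p k)%:C * At A p (mid (k - freq p) k) * zz z p) <= L * W1 (mu + 1) z p.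
    rewrite !normcM normc_real -W1_zz EL.
    rewrite [_ `^ (mu + 1)](powR_pD _ _ jj0) powRr1 ?(ltW jj0) //.
    rewrite mulrC [X in _ <= X]mulrCA ler_wpM2l ?normc_ge0 //.
    have hAp := hA p (mid (k - freq p) k).
    have q0 : 0 <= (jap (p.2.1%:~R : R) * jap p.2.2%:~R) `^ mu by rewrite powR_ge0.
    apply: (le_trans (ler_pM _ _ hc hAp)); rewrite ?normr_ge0 ?normc_ge0 //.
    move: h3 q0 {hAp}; set q := _ `^ mu; set x := jap (mid _ _); set J := jap _ * jap _ => h3 q0.
    have k12 : 0 <= (K1 + K2) * K0 * q by rewrite !mulr_ge0 ?addr_ge0 // ltW.
    have -> : (K1 + K2) * (K0 * q * x) = (K1 + K2) * K0 * q * x by ring.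
    have -> : (K1 + K2) * K0 * (4 / delta0) * (q * J) = (K1 + K2) * K0 * q * (4 / delta0 * J) by ring.
    exact: ler_wpM2l.
  have japk0 := ltW (jap_gt0 (k%:~R : R)).
  rewrite /c' normcM normc_real_ge0 ?powR_ge0 //; split.
    rewrite mulrC ler_pM ?powR_ge0 ?normc_ge0 // -powRM ?(ltW (jap_gt0 _)) //.
    exact: powR_mono.
  move=> /h4 h5; have -> : L * T * W1 (mu + 1) z p * 1 = T * (L * W1 (mu + 1) z p) by ring.
  rewrite ler_pM ?powR_ge0 ?normc_ge0 //.
  rewrite ET; apply: powR_mono => //; rewrite (_ : 16 / delta0 = 4 * (4 / delta0)); last by field; lra.
  by lra.
apply: (@bsum_sqr_lim _ b) => [k e e0|N].
  have [N0 hN] := OpBW_lim hdelta0 hchi v k ha e0.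
  exists (maxn N0 `|k|.+1) => N; rewrite geq_max => /andP[n0 n1].
  rewrite (OpBW2_box hdelta0 hchi2 A z v n1) /b sumrB.
  set X := \sum_(_ <- _) term2 _ _ _ _ _ _.
  have -> (Y Z : C) : X - Y - (X - Z) = Z - Y by ring.
  by rewrite normcB; exact: hN.
have S1 := @schur R [seq p <- ibox N | tt p] c' (fun p => L * T * W1 (mu + 1) z p) (fun=> 1) v M0.
have S2 := @schur R [seq p <- ibox N | ~~ tt p] c' (fun p => L * W2 (mu + 1) z p)
  (fun j => 2 `^ s * jap j%:~R `^ s) v (2 `^ s * Ms).
have {}S1 := S1 (fun p => mulr_ge0 (mulr_ge0 L0 T0) (W1_ge0 _ _ _)) (fun=> ler01).
have {}S2 := S2 (fun p => mulr_ge0 L0 (W2_ge0 _ _ _)) (fun j => mulr_ge0 (powR_ge0 _ _) (powR_ge0 _ _)).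
have {}S1 : bsum (fun k => normc (\sum_(p <- [seq p <- ibox N | tt p]) c' p k * v (k - freq p)) ^+ 2)
    ((L * T * (c * (Mz * Mz)) * M0) ^+ 2).
  apply: bsum_leB (S1 _ _).
  - have h : \sum_(p <- [seq p <- ibox N | tt p]) L * T * W1 (mu + 1) z p <= L * T * (c * (Mz * Mz)).
      by rewrite -mulr_sumr ler_wpM2l ?mulr_ge0 // sum_ibox_W // => p; exact: W1_ge0.
    apply: lerXn2r; rewrite ?nnegrE; last exact: ler_wpM2r.
      rewrite mulr_ge0 // sumr_ge0 // => p _.
      exact: mulr_ge0 (mulr_ge0 L0 T0) (W1_ge0 _ _ _).
    by rewrite mulr_ge0 // !mulr_ge0.
  - by move=> p k; rewrite mem_filter => /andP[h _]; exact: (proj2 (key p k) h).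
  - by apply: bsum_le (proj2 hv0) => j; rewrite mul1r mulr0 powRr0 mul1r.
have {}S2 : bsum (fun k => normc (\sum_(p <- [seq p <- ibox N | ~~ tt p]) c' p k * v (k - freq p)) ^+ 2)
    ((L * (c * (Mp * Mz)) * (2 `^ s * Ms)) ^+ 2).
  apply: bsum_leB (S2 _ _).
  - have h : \sum_(p <- [seq p <- ibox N | ~~ tt p]) L * W2 (mu + 1) z p <= L * (c * (Mp * Mz)).
      by rewrite -mulr_sumr ler_wpM2l // sum_ibox_W // => p; exact: W2_ge0.
    have q0 : 0 <= 2 `^ s * Ms by exact: mulr_ge0 (powR_ge0 _ _) v0.
    apply: lerXn2r; rewrite ?nnegrE; last exact: ler_wpM2r.
      rewrite mulr_ge0 // sumr_ge0 // => p _; exact: mulr_ge0 L0 (W2_ge0 _ _ _).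
    by rewrite mulr_ge0 // !mulr_ge0.
  - move=> p k; rewrite mem_filter => /andP[ntt _].
    apply: (le_trans (proj1 (key p k))); apply: ler_wpM2r.
      exact: mulr_ge0 (powR_ge0 _ _) (powR_ge0 _ _).
    by apply: ler_wpM2l => //; exact: W1_W2.
  - rewrite exprMn; apply: bsum_le (bsumZ (sqr_ge0 _) (proj2 hv)) => j.
    by rewrite weight_sqr normcM normc_real_ge0 ?powR_ge0 // -mulrA exprMn.
apply: (@bsum_leB _ _ _ (2 * (L * T * (c * (Mz * Mz)) * M0) ^+ 2
   + 2 * (L * (c * (Mp * Mz)) * (2 `^ s * Ms)) ^+ 2)).
  have -> : K * (Mp * Mz * Ms + Mz ^+ 2 * M0) =
     2 * (L * T * (c * (Mz * Mz)) * M0) + 2 * (L * (c * (Mp * Mz)) * (2 `^ s * Ms))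
     + 2 * (L * c * 2 `^ s * (Mz ^+ 2 * M0) + L * T * c * (Mp * Mz * Ms)).
    by rewrite /K; ring.
  set X := L * T * _ * M0; set Y := L * _ * (_ * Ms); set Z := 2 * (_ + _).
  have X0 : 0 <= X by rewrite !mulr_ge0 // ltW.
  have Y0 : 0 <= Y by rewrite !mulr_ge0 ?powR_ge0 // ltW.
  have Z0 : 0 <= Z by rewrite mulr_ge0 ?addr_ge0 ?mulr_ge0 ?powR_ge0 // ltW.
  nra.
apply: bsum_le (bsumD (bsumZ _ S1) (bsumZ _ S2)) => // k.
rewrite weight_sqr bE; set X := \sum_(_ <- _) _; set Y := \sum_(_ <- _) _.
have := le_normcD X Y; have := normc_ge0 X; have := normc_ge0 Y; have := normc_ge0 (X + Y).
have := sqr_ge0 (normc X - normc Y); nra.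
Qed.

Definition ttsum A z v k : C := \sum_(p <- ibox 1 | tt p) term2 chi2 A z v k p.

Lemma tt_box A z v k N : (0 < N)%N ->
  \sum_(p <- ibox N | tt p) term2 chi2 A z v k p = ttsum A z v k.
Proof.
move=> N0; rewrite /ttsum -[LHS]big_filter -[RHS]big_filter.
apply: perm_big; apply: uniq_perm; rewrite ?filter_uniq ?uniq_ibox // => p.
rewrite !mem_filter !mem_ibox /tt; case: eqP => //= ->; case: eqP => //= ->.
by rewrite N0.
Qed.

(** Once the pairs of [tt] are removed, every pair has a factor in z^perp, hence [Mp]; the symbol
    has order one, hence the H^1 norm of [v]. *)
Lemma OpBW2_rest (s0 mu K0 : R) : 0 <= mu -> 0 <= K0 -> mu + 2 <= s0 ->
  exists2 K : R, 0 <= K & forall A z v Mz Mp M1,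
    Abnd A mu K0 -> Hb s0 z Mz -> Hb s0 (perp z) Mp -> Hb 1 v M1 ->
    Hb 0 (fun k => OpBW2 chi2 A z v k - ttsum A z v k) (K * (Mp * Mz * M1)).
Proof.
move=> mu0 K00 hs0.
have [K2 K2p hK2] := cutoff_bounded hchi2.
have [|c c0 hW] := @W_sums mu s0; first by lra.
exists (K2 * K0 * c * 2); first by rewrite !mulr_ge0 // ltW.
move=> A z v Mz Mp M1 hA hz hp hv.
have z0 := proj1 hz; have p0 := proj1 hp; have v0 := proj1 hv.
have [hW1 hW2] := hW z Mz Mp hz hp.
split; first by rewrite !mulr_ge0 // ltW.
pose c' p k : C := (chi2 (vec2 p.2.1%:~R p.2.2%:~R, mid (k - freq p) k))%:C
    * At A p (mid (k - freq p) k) * zz z p.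
pose b N k := \sum_(p <- [seq p <- ibox N | ~~ tt p]) c' p k * v (k - freq p).
apply: (@bsum_sqr_lim _ b) => [k e e0|N].
  exists `|k|.+1 => N n1; rewrite (OpBW2_box hdelta0 hchi2 A z v n1) (bigID tt) /=.
  rewrite tt_box ?(leq_trans _ n1) // [X in X - _ - _]addrC addrK /b big_filter.
  by rewrite subrr normc0 ltW.
have S := @schur R [seq p <- ibox N | ~~ tt p] c' (fun p => K2 * K0 * W2 mu z p)
  (fun j => 2 * jap j%:~R) v (2 * M1).
apply: (@bsum_le _ _ _ (fun k => normc (b N k) ^+ 2)).
  by move=> k; rewrite mulr0 powRr0 mul1r.
apply: bsum_leB (S _ _ _ _).
- rewrite ler_sqr ?nnegrE ?mulr_ge0 ?sumr_ge0 ?(ltW c0) ?(ltW K2p) // => [|p _]; last first.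
    by rewrite mulr_ge0 ?W2_ge0 // mulr_ge0 // ltW.
  have h : \sum_(p <- [seq p <- ibox N | ~~ tt p]) K2 * K0 * W2 mu z p <= K2 * K0 * (c * (Mp * Mz)).
    rewrite -mulr_sumr ler_wpM2l ?mulr_ge0 // ?(ltW K2p) // sum_ibox_W // => p; exact: W2_ge0.
  apply: (le_trans (ler_wpM2r _ h)); first by rewrite mulr_ge0.
  by apply: le_of_eq; ring.
- by move=> p; rewrite mulr_ge0 ?W2_ge0 // mulr_ge0 // ltW.
- by move=> j; rewrite mulr_ge0 // ltW // jap_gt0.
- move=> p k; rewrite mem_filter => /andP[ntt _].
  have [e|n] := eqVneq (chi2 (vec2 p.2.1%:~R p.2.2%:~R, mid (k - freq p) k)) 0.
    rewrite /c' e !mul0r normc0 !mulr_ge0 ?W2_ge0 //; [exact: ltW | exact: ltW (jap_gt0 _)].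
  have [_ h2 _ _] := freq_shift (chi2_supp_freq hdelta0 hchi2 n).
  rewrite /c' !normcM normc_real.
  apply: (@le_trans _ _ (K2 * (K0 * (jap p.2.1%:~R * jap p.2.2%:~R) `^ mu * (2 * jap (k - freq p)%:~R))
     * normc (zz z p))).
    rewrite ler_wpM2r ?normc_ge0 // ler_pM ?normr_ge0 ?normc_ge0 //.
    by apply: (le_trans (hA p _)); rewrite ler_wpM2l // mulr_ge0 ?powR_ge0.
  apply: (@le_trans _ _ (K2 * K0 * W1 mu z p * (2 * jap (k - freq p)%:~R))).
    by rewrite -W1_zz le_eqVlt; apply/orP; left; apply/eqP; ring.
  rewrite ler_wpM2r ?mulr_ge0 ?(ltW (jap_gt0 _)) // ler_wpM2l ?W1_W2 // mulr_ge0 // ltW //.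
- rewrite exprMn; apply: bsum_le (bsumZ (sqr_ge0 _) (proj2 hv)) => j.
  rewrite weight_sqr normcM normc_real_ge0 ?powR_ge0 // powRr1 ?(ltW (jap_gt0 _)) //.
  by rewrite -mulrA exprMn.
Qed.

(** No decay of the coefficients in [n] is assumed. Of the three derivatives on [v], one pays for
    the order of the symbol, one for the factor [jap k] that makes the output square summable, and
    one for the absolute convergence of the sum over [j]. *)
Lemma OpBW_crude : exists2 K : R, 0 <= K & forall a v B M,
  (forall xi n, normc (fcoef (fun x => a x xi) n) <= B * jap xi) -> Hb 3 v M ->
  Hb 0 (OpBW chi a v) (K * (B * M)).
Proof.
have [K1 K1p hK1] := cutoff_bounded hchi.
have [c c0 hc] := @l1_bound R; have [D D0 hD] := @bsum_jap2 R.
exists (4 * K1 * c * (D + 1)); first by rewrite !mulr_ge0 ?addr_ge0 // ltW.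
move=> a v B M ha hv; have M0 := proj1 hv.
have B0 : 0 <= B.
  have := ha 0 0; have := normc_ge0 (fcoef (fun x => a x 0) 0); have := jap_gt0 (0 : R); nra.
split; first by rewrite !mulr_ge0 ?addr_ge0 // ltW.
have h2 : (2 : R) + 1 <= 3 by lra.
have hl := hc 2 3 v M h2 hv.
have key k : jap (k%:~R : R) * normc (OpBW chi a v k) <= 4 * K1 * B * (c * M).
  rewrite (OpBW_box hdelta0 hchi).
  apply: (@le_trans _ _ (\sum_(j <- zbox (2 * `|k|.+1)) 4 * K1 * B * (jap j%:~R `^ 2 * normc (v j)))).
    apply: (le_trans (ler_wpM2l (ltW (jap_gt0 _)) (normc_sum _ _))).
    rewrite mulr_sumr; apply: ler_sum => j _; rewrite 2!normcM normc_real.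
    have [->|n] := eqVneq (chi (vec1 (k - j)%:~R, mid j k)) 0.
      rewrite normr0 !mul0r mulr0 !mulr_ge0 ?powR_ge0 ?normc_ge0 //; exact: ltW.
    have x0 := jap_gt0 (mid j k : R).
    have hs := chi_supp hdelta0 hchi n.
    have emid : mid j k = (j%:~R + k%:~R) / 2 :> R by rewrite /mid intrD.
    have [|h3 h4 _] := @localized R j%:~R k%:~R.
      by rewrite -emid -intrB; apply: (le_trans hs); lra.
    rewrite -emid in h4.
    have hf := ha (mid j k) (k - j).
    rewrite powR_natr ?(ltW (jap_gt0 _)) // !mulrA ler_wpM2r ?normc_ge0 //.
    have p1 : `|chi (vec1 (k - j)%:~R, mid j k)| * normc (fcoef (fun x => a x (mid j k)) (k - j))
       <= K1 * (B * (2 * jap j%:~R)).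
      rewrite ler_pM ?normr_ge0 ?normc_ge0 //; apply: (le_trans hf); exact: ler_wpM2l.
    have jk := jap_gt0 (k%:~R : R).
    have p2 : jap (k%:~R : R) * (`|chi (vec1 (k - j)%:~R, mid j k)| * normc (fcoef (fun x => a x (mid j k)) (k - j))) <= (2 * jap j%:~R) * (K1 * (B * (2 * jap j%:~R))).
      by rewrite ler_pM ?(ltW jk) // mulr_ge0 ?normr_ge0 ?normc_ge0.
    rewrite -mulrA; apply: (le_trans p2).
    by apply: le_of_eq; ring.
  rewrite -mulr_sumr ler_wpM2l ?mulr_ge0 // ?(ltW K1p) //; exact: (hl _ (uniq_zbox _)).
apply: (@bsum_leB _ _ _ ((4 * K1 * B * (c * M)) ^+ 2 * D)).
  have -> : 4 * K1 * c * (D + 1) * (B * M) = 4 * K1 * B * (c * M) * (D + 1) by ring.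
  rewrite [X in _ <= X]exprMn ler_wpM2l ?sqr_ge0 //; nra.
apply: bsum_le (bsumZ (sqr_ge0 _) hD) => k; rewrite mulr0 powRr0 mul1r.
have jk := jap_gt0 (k%:~R : R).
rewrite -exprVn -exprMn ler_sqr ?nnegrE ?normc_ge0 //.
  by rewrite ler_pdivlMr // mulrC.
by rewrite !mulr_ge0 ?invr_ge0 ?(ltW jk) // ltW.
Qed.

End Estimates.

(** * Trigonometric series with dominated coefficients *)

Section TrigSeries.
Context {R : realType}.
Local Notation C := R[i].

Lemma is_derive_trig (c : C) (n x : R) :
  is_derive x (1 : R) (fun y : R => complex.Re (c * cexp (n * y)))
    (complex.Re ('i%C * n%:C * c * cexp (n * x))).
Proof.
have dl : is_derive x (1 : R) (fun y : R => n * y) n.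
  by apply: (is_derive_eq (is_deriveZ n (is_derive_id x 1))); rewrite scaler1.
have d1 := @is_derive1_comp _ cos (fun y : R => n * y) x _ _ (is_derive_cos _) dl.
have d2 := @is_derive1_comp _ sin (fun y : R => n * y) x _ _ (is_derive_sin _) dl.
have d3 := is_deriveB (is_deriveZ (complex.Re c) d1) (is_deriveZ (complex.Im c) d2).
rewrite (_ : (fun y : R => _) = (fun y : R => complex.Re c *: cos (n * y)) \-
   (fun y : R => complex.Im c *: sin (n * y))); last first.
  by apply/funext => y; rewrite ReM.
apply: (is_derive_eq d3); rewrite !ReM !ImM /=.
by rewrite -![_ *: _]/(_ * _) /=; ring.
Qed.

Lemma normc_trig (c : C) (n x : R) : `|complex.Re (c * cexp (n * x))| <= normc c.
Proof. by apply: (le_trans (normc_Re _)); rewrite normcM normc_cexp mulr1. Qed.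

Lemma normc_in (c : C) (n : R) : normc ('i%C * n%:C * c) = `|n| * normc c.
Proof. by rewrite 2!normcM normc_i normc_real mul1r. Qed.

Lemma rsum_le (I : choiceType) (f w : I -> R) B : (forall i, `|f i| <= w i) -> bsum w B ->
  `|rsum f| <= B.
Proof.
move=> fw h; have := @rsum_tail _ _ f w [::] B fw isT (fun G u _ => h G u).
by rewrite big_nil subr0.
Qed.

Variables (I : choiceType) (c : I -> C) (n : I -> R) (w : I -> R) (B : R).
(** Three derivatives are dominated although W^(2,infinity) involves two: differentiating the first
    derivative termwise uses a majorant two orders above it. *)
Hypotheses (hw : bsum w B)
  (hc : forall i, normc (c i) * (1 + `|n i|) ^+ 3 <= w i).

Let der (k : nat) (i : I) : C := iter k (fun d => 'i%C * (n i)%:C * d) (c i).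

Lemma normc_der k i : (k <= 3)%N -> normc (der k i) <= w i.
Proof.
move=> k3; apply: le_trans (hc i).
have e : normc (der k i) = normc (c i) * `|n i| ^+ k.
  elim: k {k3} => [|k IH]; first by rewrite mulr1.
  by rewrite [der _ _]/= normc_in IH exprS mulrCA.
rewrite e ler_wpM2l ?normc_ge0 //.
have p : 1 <= 1 + `|n i| by rewrite lerDl.
apply: (@le_trans _ _ ((1 + `|n i|) ^+ k)); last by rewrite ler_weXn2l.
by apply: lerXn2r; rewrite ?nnegrE ?lerDr // (le_trans _ p).
Qed.

Definition trigsum (k : nat) (x : R) : R := rsum (fun i => complex.Re (der k i * cexp (n i * x))).

Lemma trigsum_derive k (x : R) : (k <= 1)%N -> is_derive x (1 : R) (trigsum k) (trigsum k.+1 x).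
Proof.
move=> k1.
apply: (@is_derive_rsum _ _ (fun i x => complex.Re (der k i * cexp (n i * x)))
  (fun i x => complex.Re (der k.+1 i * cexp (n i * x)))
  (fun i x => complex.Re (der k.+2 i * cexp (n i * x))) w B (x - 1) (x + 1) hw).
- by move=> i y _; exact: is_derive_trig.
- by move=> i y _; exact: is_derive_trig.
- move=> i y _; split; apply: (le_trans (normc_trig _ _ _)); apply: normc_der; lia.
- by apply/andP; split; lra.
Qed.

Lemma trigsum_le k (x : R) : (k <= 3)%N -> `|trigsum k x| <= B.
Proof.
move=> k3; apply: (rsum_le _ hw) => i.
by apply: (le_trans (normc_trig _ _ _)); exact: normc_der.
Qed.

(** At order two no derivative is at hand, so continuity comes from uniform approximation by finite
    sums. *)
Lemma trigsum_cont2 : continuous (trigsum 2).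
Proof.
move=> x; apply/cvgrPdist_le => e e0.
have e3 : 0 < e / 3 by lra.
have [F [uF tl]] := bsum_tail e3 hw.
have h y : `|trigsum 2 y - \sum_(i <- F) complex.Re (der 2 i * cexp (n i * y))| <= e / 3.
  apply: (rsum_tail _ uF tl) => i.
  by apply: (le_trans (normc_trig _ _ _)); exact: normc_der.
have c0 : continuous (fun y => \sum_(i <- F) complex.Re (der 2 i * cexp (n i * y))).
  elim: {uF tl h} F => [|a F IH] y.
    rewrite (_ : (fun y => _) = (fun=> 0)); first exact: cvg_cst.
    by apply/funext => u; rewrite big_nil.
  rewrite (_ : (fun y => _) = (fun y => complex.Re (der 2 a * cexp (n a * y)) +
     \sum_(i <- F) complex.Re (der 2 i * cexp (n i * y)))); last first.
    by apply/funext => u; rewrite big_cons.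
  apply: continuousD; last exact: IH.
  by apply: cont_der => u; have [] := is_derive_trig (der 2 a) (n a) u.
near=> y.
have hy : `|\sum_(i <- F) complex.Re (der 2 i * cexp (n i * x)) -
  \sum_(i <- F) complex.Re (der 2 i * cexp (n i * y))| <= e / 3.
  by near: y; have /cvgrPdist_le := c0 x; apply.
have h1 := h x; have h2 := h y; move: hy h1 h2; rewrite !ler_norml.
move=> /andP[a1 a2] /andP[b1 b2] /andP[d1 d2]; apply/andP; split; lra.
Unshelve. all: by end_near. Qed.

Lemma trigsum_continuous : continuous (trigsum 0).
Proof. by apply: cont_der => x; have [] := @trigsum_derive 0 x isT. Qed.

Lemma winf_trigsum : (forall i, exists m : int, n i = m%:~R) ->
  winf 2 (fun x => (trigsum 0 x)%:C) B.
Proof.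
move=> hn; apply: (@winf_C2 _ _ (trigsum 1) (trigsum 2)).
- by move=> x; exact: trigsum_derive.
- by move=> x; exact: trigsum_derive.
- exact: trigsum_cont2.
- move=> x; congr rsum; apply/funext => i; have [m ->] := hn i.
  by rewrite cexp_2pi.
- by move=> x; split; exact: trigsum_le.
Qed.

End TrigSeries.

(** * Quadratic symbols as uniform limits over boxes of frequencies *)

Section Quadratic.
Context {R : realType}.
Local Notation C := R[i].
Implicit Types (A : qcoef R) (z v : fseq R) (k : int) (p : @I4) (a : symbol R).

Lemma sum_supp (I : eqType) (f : I -> C) (F G : seq I) : uniq F -> uniq G ->
  {subset F <= G} -> (forall i, i \in G -> i \notin F -> f i = 0) ->
  \sum_(i <- G) f i = \sum_(i <- F) f i.
Proof.
move=> uF uG s h; rewrite (bigID (mem F)) /= [X in _ + X]big1_seq ?addr0; last first.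
  by move=> i /andP[iF iG]; exact: h.
rewrite -big_filter; apply: perm_big; apply: uniq_perm; rewrite ?filter_uniq // => i.
by rewrite mem_filter; case: (boolP (i \in F)) => // /s ->.
Qed.

(** Uniformity in [x] is what survives integration against an exponential, and it yields
    [fapprox]. *)
Definition uapprox A z a : Prop := forall xi : R,
  (exists M, cbm (fun x => a x xi) M) /\
  forall e : R, 0 < e -> exists N0, forall N, (N0 <= N)%N -> forall x,
    normc (a x xi - \sum_(p <- ibox N) At A p xi * zz z p * cexp ((freq p)%:~R * x)) <= e.

Lemma uapprox_fapprox A z a : uapprox A z a -> fapprox A z a.
Proof.
move=> h xi n e e0; have [[M bM] ha] := h xi.
have e2 : 0 < e / 2 by lra.
have [N0 hN] := ha _ e2; exists N0 => N /hN h1.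
have := @fcoef_approx _ _ (ibox N) (fun p => At A p xi * zz z p) (@freq) n _ M (e / 2) bM h1.
by rewrite mulrCA divff // mulr1.
Qed.

Lemma uapproxD A A' z a a' : uapprox A z a -> uapprox A' z a' ->
  uapprox (fun s1 s2 j1 j2 xi => A s1 s2 j1 j2 xi + A' s1 s2 j1 j2 xi) z
    (fun x xi => a x xi + a' x xi).
Proof.
move=> h h' xi; have [[M bM] ha] := h xi; have [[M' bM'] ha'] := h' xi.
split; first by exists (M + M'); exact: cbmD.
move=> e e0; have e2 : 0 < e / 2 by lra.
have [N0 hN] := ha _ e2; have [N1 hN1] := ha' _ e2.
exists (maxn N0 N1) => N; rewrite geq_max => /andP[/hN h1 /hN1 h2] x.
rewrite (eq_bigr (fun p => At A p xi * zz z p * cexp ((freq p)%:~R * x) +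
   At A' p xi * zz z p * cexp ((freq p)%:~R * x))); last first.
  by move=> -[[s1 s2] [j1 j2]] _; rewrite /= !mulrDl.
rewrite big_split /= opprD addrACA; apply: (le_trans (le_normcD _ _)).
by have := h1 x; have := h2 x; lra.
Qed.

Lemma uapproxZ (c : C) A z a : uapprox A z a ->
  uapprox (fun s1 s2 j1 j2 xi => c * A s1 s2 j1 j2 xi) z (fun x xi => c * a x xi).
Proof.
move=> h xi; have [[M bM] ha] := h xi.
split; first by exists (normc c * M); exact: cbmZ.
move=> e e0; have c1 : 0 < normc c + 1 by rewrite ltr_wpDl ?normc_ge0.
have e2 : 0 < e / (normc c + 1) by rewrite divr_gt0.
have [N0 hN] := ha _ e2; exists N0 => N /hN h1 x.
rewrite (eq_bigr (fun p => c * (At A p xi * zz z p * cexp ((freq p)%:~R * x)))); last first.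
  by move=> -[[s1 s2] [j1 j2]] _; rewrite /= !mulrA.
rewrite -mulr_sumr -mulrBr normcM.
apply: (le_trans (ler_wpM2l (normc_ge0 _) (h1 x))).
rewrite mulrCA ler_piMr ?(ltW e0) // ler_pdivrMr // mul1r lerDl //.
Qed.

(** Allows the results on real parts of trigonometric series to be applied to imaginary parts. *)
Lemma Im_Re (w : C) : complex.Im w = complex.Re (- 'i%C * w).
Proof. by case: w => a b /=; ring. Qed.

Lemma qevalE A z x xi : qeval A z x xi =
  csum (fun p : @I4 => At A p xi * zz z p * cexp ((freq p)%:~R * x)).
Proof. by apply: csum_ext => -[[s1 s2] [j1 j2]] /=; rewrite !mulrA. Qed.

Lemma At_zz_le A mu K0 z p xi : Abnd A mu K0 ->
  normc (At A p xi * zz z p) <= K0 * jap xi * W1 mu z p.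
Proof.
move=> hA; rewrite normcM -W1_zz.
apply: (le_trans (ler_wpM2r (normc_ge0 _) (hA p xi))).
by apply: le_of_eq; ring.
Qed.

Lemma freq_jap p : 1 + `|(freq p)%:~R : R| <= 4 * (jap p.2.1%:~R * jap p.2.2%:~R).
Proof.
have j1 := jap_ge1 (p.2.1%:~R : R); have j2 := jap_ge1 (p.2.2%:~R : R).
have n1 := norm_le_jap (p.2.1%:~R : R); have n2 := norm_le_jap (p.2.2%:~R : R).
have h1 : `|p.2.1%:~R : R| <= jap p.2.1%:~R * jap p.2.2%:~R by nra.
have h2 : `|p.2.2%:~R : R| <= jap p.2.1%:~R * jap p.2.2%:~R by nra.
have := freq_le h1 h2; nra.
Qed.

Lemma ibox_eventually (F : seq (@I4)) : exists N0, forall N, (N0 <= N)%N -> {subset F <= ibox N}.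
Proof.
have [|N0 h] := @eventually_seq _ F (fun p N => p \in ibox N).
  move=> p; exists (maxn `|p.2.1|%N `|p.2.2|%N) => N; rewrite geq_max => /andP[a b].
  by rewrite mem_ibox a b.
by exists N0 => N /h.
Qed.

(** A term is at most a multiple of [W1 mu], and the weight [(1 + |freq p|) ^+ 3] costs three more
    powers of the brackets. One further power makes everything summable, which explains
    [mu + 4 <= s0]. *)
Lemma uapprox_qeval A mu K0 s0 z M : 0 <= mu -> 0 <= K0 -> mu + 4 <= s0 ->
  Abnd A mu K0 -> Hb s0 z M -> uapprox A z (qeval A z).
Proof.
move=> mu0 K00 hs hA hz xi.
have [|c c0 hW] := @W_sums R (mu + 3) s0; first by lra.
have [hW1 _] := hW z M M hz (Hb_perp hz).
pose w p := K0 * jap xi * 4 ^+ 3 * W1 (mu + 3) z p.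
have q0 : 0 <= K0 * jap xi by rewrite mulr_ge0 // ltW // jap_gt0.
have hw := bsumZ (mulr_ge0 q0 (exprn_ge0 3 (ler0n R 4))) hW1.
have hc p : normc (At A p xi * zz z p) * (1 + `|(freq p)%:~R|) ^+ 3 <= w p.
  rewrite /w -!mulrA; apply: (@le_trans _ _ (K0 * jap xi * W1 mu z p * (4 * (jap p.2.1%:~R * jap p.2.2%:~R)) ^+ 3)).
    apply: ler_pM; rewrite ?normc_ge0 ?exprn_ge0 ?addr_ge0 //; first exact: At_zz_le.
    apply: lerXn2r; rewrite ?nnegrE ?addr_ge0 // ?freq_jap //.
    by rewrite !mulr_ge0 // ltW // jap_gt0.
  have jj0 : 0 < jap (p.2.1%:~R : R) * jap p.2.2%:~R by rewrite mulr_gt0 ?jap_gt0.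
  rewrite -!W1_zz (powR_pD _ _ jj0) (powR_natr 3 (ltW jj0)) le_eqVlt.
  by apply/orP; left; apply/eqP; rewrite exprMn; ring.
have hc1 (d : C) p : normc d = 1 ->
    normc (d * (At A p xi * zz z p)) * (1 + `|(freq p)%:~R|) ^+ 3 <= w p.
  by move=> e; rewrite normcM e mul1r.
have hle p : normc (At A p xi * zz z p) <= w p.
  apply: le_trans (hc p); rewrite ler_peMr ?normc_ge0 // exprn_ege1 // lerDl //.
split.
  exists (\big[+%R/0]_(i <- [:: K0 * jap xi * 4 ^+ 3 * (c * (M * M))]) i); apply: cbm_cont => [||x].
  - have := @trigsum_continuous R _ (fun p => At A p xi * zz z p) (fun p => (freq p)%:~R) w _ hw hc.
    by rewrite /trigsum; under [X in _ -> continuous X]eq_fun do rewrite qevalE.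
  - have h1 p : normc (- 'i%C * (At A p xi * zz z p)) * (1 + `|(freq p)%:~R|) ^+ 3 <= w p.
      by apply: hc1; rewrite normcN normc_i.
    have := @trigsum_continuous R _ (fun p => - 'i%C * (At A p xi * zz z p)) (fun p => (freq p)%:~R) w _ hw h1.
    rewrite /trigsum (_ : (fun x => complex.Im (qeval A z x xi)) = (fun x => rsum (fun p : @I4 =>
       complex.Re (- 'i%C * (At A p xi * zz z p) * cexp ((freq p)%:~R * x))))) //.
    apply/funext => x; rewrite qevalE /=; congr rsum; apply/funext => p.
    by rewrite Im_Re mulrA.
  - rewrite big_seq1 qevalE; apply: normc_csum_le; apply: bsum_le hw => p.
    by rewrite normcM normc_cexp mulr1; exact: hle.
move=> e e0; have [F0 [uF0 h]] := csum_dom e0 hw.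
have [N0 hN] := ibox_eventually F0; exists N0 => N /hN sN x; rewrite qevalE.
apply: h => //; last exact: uniq_ibox.
by move=> p; rewrite normcM normc_cexp mulr1; exact: hle.
Qed.

(** The coefficient of frequency [2 * (n + 1)] in <V>. The index shift makes [vc z 0] the product of
    [z 1] with the conjugate of [z (-1)], the only coefficient built from z^top. *)
Definition vc z (n : nat) : C := z n.+1%:Z * (z (- n.+1%:Z))^*%C.

Lemma VavgE z x : Vavg z x = 2 * rsum (fun n => complex.Re (vc z n * cexp ((2 * n.+1)%:R * x))).
Proof. by []. Qed.

(** One factor is bounded uniformly and the other is summed with three powers of its frequency; 27
    is [3 ^ 3], from [1 + 2 * (n + 1) <= 3 * (n + 1)]. *)
Lemma vc_bsum s0 : 4 <= s0 -> exists2 K : R, 0 < K & forall z M, Hb s0 z M ->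
  bsum (fun n => normc (vc z n) * (1 + `|(2 * n.+1)%:R|) ^+ 3) (K * M ^+ 2).
Proof.
move=> hs; have [c c0 hc] := @l1_bound R; exists (27 * c); first by rewrite mulr_gt0.
move=> z M hz; have h4 : 3 + 1 <= s0 by lra.
have hl := hc _ _ _ _ h4 hz; have M0 := proj1 hz.
have inj : injective (fun n : nat => n.+1%:Z) by move=> a b [].
have M27 : 0 <= 27 * M by rewrite mulr_ge0.
have := bsumZ M27 (bsum_inj inj hl).
rewrite (_ : 27 * M * (c * M) = 27 * c * M ^+ 2); last by ring.
apply: bsum_le => n; rewrite /vc normcM normc_conj.
have zM : normc (z (- n.+1%:Z)) <= M by apply: Hb_coef0 hz; lra.
have e : jap (n.+1%:Z%:~R : R) = n.+1%:R.
  by rewrite /jap -pmulrn ger0_norm // maxEle ler1n.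
rewrite e (powR_natr 3 (ler0n _ _)) natrM ger0_norm ?mulr_ge0 //.
have n1 : 1 <= n.+1%:R :> R by rewrite ler1n.
set x := n.+1%:R in n1 *; set a := normc (z _); set b := normc (z _).
have a0 : 0 <= a := normc_ge0 _. have b0 : 0 <= b := normc_ge0 _.
have h3 : (1 + 2 * x) ^+ 3 <= 27 * x ^+ 3.
  have -> : 27 * x ^+ 3 = (3 * x) ^+ 3 by rewrite exprMn; ring.
  by apply: lerXn2r; rewrite ?nnegrE; lra.
have -> : 27 * M * (x ^+ 3 * a) = a * M * (27 * x ^+ 3) by ring.
apply: ler_pM h3; [exact: mulr_ge0 | by rewrite exprn_ge0 //; lra | exact: ler_wpM2l].
Qed.

(** The nonzero coefficients sit at the frequencies [(n + 1, - (n + 1))] with opposite signs; the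
    two sign patterns give complex conjugate terms, hence twice a real part. *)
Lemma Vavg_box z x xi N :
  \sum_(p <- ibox N) At (@Vavg_coef R) p xi * zz z p * cexp ((freq p)%:~R * x) =
  ((2 * \sum_(n <- iota 0 N) complex.Re (vc z n * cexp ((2 * n.+1)%:R * x))) * xi)%:C.
Proof.
pose P b n : @I4 := ((b, ~~ b), (n.+1%:Z, - n.+1%:Z)).
have injP b : injective (P b) by move=> m n [].
pose L := [seq P true n | n <- iota 0 N] ++ [seq P false n | n <- iota 0 N].
have uL : uniq L.
  rewrite /L cat_uniq !map_inj_uniq ?iota_uniq // /= andbT.
  by apply/hasPn => p /mapP[n _ ->]; apply/negP => /mapP[m _].
have sL : {subset L <= ibox N}.
  move=> p; rewrite mem_cat mem_ibox => /orP[] /mapP[n]; rewrite mem_iota /= => h ->;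
  rewrite /=; lia.
rewrite (sum_supp uL (uniq_ibox N) sL); last first.
  move=> -[[s1 s2] [j1 j2]]; rewrite mem_ibox /= => hN hL; rewrite /Vavg_coef.
  case: ifP => [/and3P[h1 /eqP h2 h3]|_]; last by rewrite !mul0r.
  case/negP: hL; rewrite /L mem_cat.
  case: j1 h1 h2 hN => [[|n]|n] // h1 h2 hN.
  have nN : n \in iota 0 N by rewrite mem_iota /= add0n; move: hN => /=; lia.
  have -> : (s1, s2, (n.+1%:Z, j2)) = P s1 n by rewrite /P h2; case: s1 s2 h3 => -[].
  by case: s1 {h3}; rewrite (map_f (P _) nN) ?orbT.
rewrite /L big_cat !big_map /= -big_split /= mulr_sumr mulr_suml.
rewrite (_ : (\sum_(i <- iota 0 N) _)%:C = \sum_(i <- iota 0 N)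
   (2 * complex.Re (vc z i * cexp ((2 * i.+1)%:R * x)) * xi)%:C); last first.
  by apply: complex_eqP; rewrite ?Re_sum ?Im_sum //= big1.
apply: eq_bigr => n _; rewrite /Vavg_coef /vc /= !eqxx /=.
have -> : (1 * n.+1%:Z + -1 * - n.+1%:Z)%:~R * x = (2 * n.+1)%:R * x.
  by congr (_ * x); rewrite mul1r mulN1r opprK -mulr2n rmorphMn /= -pmulrn -mulr_natl natrM.
have -> : (-1 * n.+1%:Z + 1 * - n.+1%:Z)%:~R * x = - ((2 * n.+1)%:R * x).
  rewrite -mulNr; congr (_ * x).
  by rewrite mul1r mulN1r -opprD rmorphN -mulr2n rmorphMn /= -pmulrn -mulr_natl natrM.
move: (z n.+1) (z (- n.+1%:Z)) ((2 * n.+1)%:R * x) => [a b] [u v] y.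
by apply: complex_eqP; rewrite /cexp /= cosN sinN; ring.
Qed.

Lemma uapprox_Vavg s0 z M : 4 <= s0 -> Hb s0 z M ->
  uapprox (@Vavg_coef R) z (fun x xi => (Vavg z x * xi)%:C).
Proof.
move=> hs hz xi; have [K K0 hK] := vc_bsum hs; have hw := hK _ _ hz.
set w := fun n => _ in hw.
have hc i : normc (vc z i) * (1 + `|(2 * i.+1)%:R|) ^+ 3 <= w i by [].
have vw i : normc (vc z i) <= w i.
  by rewrite /w ler_peMr ?normc_ge0 // exprn_ege1 // lerDl.
have cV : continuous (Vavg z).
  have := @trigsum_continuous R _ (vc z) (fun n => (2 * n.+1)%:R) w _ hw hc.
  have -> : Vavg z = (fun x => 2 * trigsum (vc z) (fun n => (2 * n.+1)%:R) 0 x) by [].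
  by move=> h x; apply: cvgM; [exact: cvg_cst | exact: h].
split.
  have cx : continuous (fun x => Vavg z x * xi).
    by move=> x; apply: continuousM; [exact: cV | exact: cvg_cst].
  exact: cbm_contR cx.
move=> e e0; have p : 0 < 2 * `|xi| + 1 by have := normr_ge0 xi; lra.
have e2 : 0 < e / (2 * `|xi| + 1) by rewrite divr_gt0.
have [F0 [u tl]] := bsum_tail e2 hw.
exists (\max_(n <- F0) n).+1 => N hN x; rewrite Vavg_box.
have : `|rsum (fun n => complex.Re (vc z n * cexp ((2 * n.+1)%:R * x))) -
   \sum_(n <- iota 0 N) complex.Re (vc z n * cexp ((2 * n.+1)%:R * x))| <= e / (2 * `|xi| + 1).
  apply: (@rsum_tail _ _ _ w) => [i||G uG hG]; rewrite ?iota_uniq //.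
    by apply: (le_trans (normc_trig _ _ _)); exact: vw.
  apply: tl => // i /hG; apply: contra => iF; rewrite mem_iota /= add0n.
  by apply: leq_trans hN; rewrite ltnS; exact: (@leq_bigmax_seq _ F0 xpredT id i iF isT).
rewrite VavgE; set X := rsum _; set Y := \sum_(_ <- _) _ => h.
rewrite -rmorphB normc_real -mulrBl -mulrBr !normrM.
rewrite (ger0_norm (ler0n R 2)) mulrAC mulrC.
apply: (@le_trans _ _ (e / (2 * `|xi| + 1) * (2 * `|xi| + 1))); last by rewrite divfK // gt_eqF.
by apply: ler_pM => //; lra.
Qed.

End Quadratic.

(** * Symbol seminorms, smoothness in xi and coefficient bounds *)

Section Symbols.
Context {R : realType}.
Local Notation C := R[i].
Implicit Types (A : qcoef R) (z v : fseq R) (k : int) (p : @I4) (a : symbol R).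

Lemma cjD (x y : C) : (x + y)^*%C = x^*%C + y^*%C.
Proof. exact: (rmorphD (@conjc R)). Qed.

Lemma cjM (x y : C) : (x * y)^*%C = x^*%C * y^*%C.
Proof. exact: (rmorphM (@conjc R)). Qed.

Lemma cjR (x : R) : (x%:C)^*%C = x%:C :> C.
Proof. by rewrite /= oppr0. Qed.

Lemma derive1n_lin (f g : R -> R) (a b : R) : smooth f -> smooth g ->
  forall n, derive1n n (fun x => a * f x + b * g x) =
    (fun x => a * derive1n n f x + b * derive1n n g x).
Proof.
move=> sf sg; elim=> [//|n IH]; rewrite derive1nS IH; apply/funext => x.
have d1 : is_derive x (1 : R) (derive1n n f) (derive1n n.+1 f x).
  by rewrite derive1nS derive1E; apply: DeriveDef => //; exact: sf.
have d2 : is_derive x (1 : R) (derive1n n g) (derive1n n.+1 g x).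
  by rewrite derive1nS derive1E; apply: DeriveDef => //; exact: sg.
have := is_deriveD (is_deriveZ a d1) (is_deriveZ b d2).
by rewrite derive1E => -[_ <-].
Qed.

Lemma smooth_lin (f g : R -> R) (a b : R) : smooth f -> smooth g ->
  smooth (fun x => a * f x + b * g x).
Proof.
move=> sf sg n x; rewrite derive1n_lin //.
by apply: derivableD; apply: derivableZ; [exact: sf | exact: sg].
Qed.

Lemma derive1n_cst0 n : derive1n n (fun=> 0 : R) = (fun=> 0) :> (R -> R).
Proof.
elim: n => [//|n IH]; rewrite derive1nS IH; apply/funext => x.
by rewrite derive1E derive_cst.
Qed.

Lemma smooth_cst0 : smooth (fun=> 0 : R).
Proof. by move=> n x; rewrite derive1n_cst0; exact: derivable_cst. Qed.

Lemma symnorm_Winf m N n a (B : R) b xi : (symnorm m N n a <= B%:E)%E -> (b <= n)%N ->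
  (Winf N (fun x => ((jap xi `^ (- m + b%:R))%:C * cderive1n b (a x) xi)%R) <= B%:E)%E.
Proof.
move=> h bn; apply: le_trans h; apply: ereal_sup_ubound; exists b, xi; split=> //.
Qed.

(** Smoothness splits the [xi]-derivatives of the sum, and the weights in [symnorm] are real, so
    they pass through the real part; [Winf_ReD] does the rest. *)
Lemma symnorm_ReD m N n a a' (B B' : R) :
  (forall x, smooth (fun xi => complex.Re (a x xi))) ->
  (forall x, smooth (fun xi => complex.Re (a' x xi))) ->
  (symnorm m N n a <= B%:E)%E -> (symnorm m N n a' <= B'%:E)%E ->
  (symnorm m N n (fun x xi => (complex.Re (a x xi + a' x xi)%R)%:C) <= (B + B')%:E)%E.
Proof.
move=> sa sa' h h'; apply: ge_ereal_sup => _ [b [xi [bn ->]]].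
have := Winf_ReD (symnorm_Winf xi h bn) (symnorm_Winf xi h' bn).
congr (_ <= _)%E; congr Winf; apply/funext => x.
apply: complex_eqP.
  rewrite !ReD !ReM /= !mul0r !subr0 -mulrDr; congr (_ * _).
  rewrite (_ : (fun y => complex.Re (a x y + a' x y)) =
    (fun y => 1 * complex.Re (a x y) + 1 * complex.Re (a' x y))); last first.
    by apply/funext => y; rewrite ReD !mul1r.
  by rewrite derive1n_lin // !mul1r.
rewrite ImM /= mul0r addr0.
by rewrite derive1n_cst0 mulr0.
Qed.

Lemma jap_powR_le (r x e : R) : 0 <= r -> - r < x < r -> jap x `^ e <= (1 + r) `^ `|e|.
Proof.
move=> r0 /andP[x1 x2].
have hx : jap x <= 1 + r by apply: jap_le; rewrite ?ler_norml; lra.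
apply: (@le_trans _ _ (jap x `^ `|e|)); first by rewrite ler_powR ?jap_ge1 ?ler_norm.
by apply: powR_mono => //; rewrite ltW // jap_gt0.
Qed.

Lemma max_pow_le (x y mu : R) : 0 <= mu -> Num.max (jap x) (jap y) `^ mu <= (jap x * jap y) `^ mu.
Proof.
move=> mu0; have x1 := jap_ge1 x; have y1 := jap_ge1 y.
apply: powR_mono => //; first by rewrite le_max (le_trans ler01 x1).
by rewrite ge_max; apply/andP; split; nra.
Qed.

(** Termwise differentiation in [xi]: on a bounded interval each derivative of the coefficients is
    at most a constant times [(jap j1 * jap j2) ^ mu], which is summable against [zz z p]. *)
Lemma smooth_qeval A z m mu s0 M x : 0 <= mu -> mu + 4 <= s0 -> Gamma2 m mu A -> Hb s0 z M ->
  smooth (fun xi => complex.Re (qeval A z x xi)).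
Proof.
move=> mu0 hs [sA hA] hz.
have [|c c0 hW] := @W_sums R mu s0; first by lra.
have [hW1 _] := hW z M M hz (Hb_perp hz).
pose d p : C := zz z p * cexp ((freq p)%:~R * x).
have sp p : smooth (fun xi => complex.Re (At A p xi)) /\ smooth (fun xi => complex.Im (At A p xi)).
  by case: p => -[s1 s2] [j1 j2]; have := sA s1 s2 j1 j2.
have e : (fun xi => complex.Re (qeval A z x xi)) = (fun xi => rsum (fun p : @I4 =>
   complex.Re (d p) * complex.Re (At A p xi) + (- complex.Im (d p)) * complex.Im (At A p xi))).
  apply/funext => xi; rewrite qevalE /=; congr rsum; apply/funext => p.
  by rewrite -mulrA -/(d p) ReM mulNr [complex.Re _ * _]mulrC [complex.Im _ * _]mulrC.
rewrite e; have [||//] := @smooth_rsum R _ (fun (p : @I4) (xi : R) =>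
   complex.Re (d p) * complex.Re (At A p xi) + (- complex.Im (d p)) * complex.Im (At A p xi)).
  by move=> p; apply: smooth_lin; case: (sp p).
move=> n r; have [K hK] := hA n.
pose r' := `|r| + 1; have r0 : 0 <= r' by rewrite addr_ge0.
pose L := 2 * `|K| * (1 + r') `^ `|m - n%:R|.
have L0 : 0 <= L by rewrite !mulr_ge0 ?powR_ge0.
exists (fun p => L * W1 mu z p), (L * (c * (M * M))); split; first exact: bsumZ.
move=> p xi hxi.
have hxi' : - r' < xi < r'.
  by move: hxi; rewrite /r'; have := ler_norm r; lra.
have [s1 s2] := sp p; rewrite derive1n_lin //.
have hp : normc (cderive1n n (At A p) xi) <= `|K| * (jap p.2.1%:~R * jap p.2.2%:~R) `^ mu
     * (1 + r') `^ `|m - n%:R|.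
  case: p {hxi s1 s2} => -[t1 t2] [j1 j2]; apply: (le_trans (hK _ _ _ _ _)).
  apply: ler_pM; rewrite ?powR_ge0 //.
  - have k0 : 0 <= K.
      have := le_trans (normc_ge0 _) (hK t1 t2 0 0 0).
      rewrite -mulrA => h; rewrite leNgt; apply/negP => k1; move: h; apply/negP; rewrite -ltNge.
      rewrite nmulr_rlt0 // mulr_gt0 // powR_gt0 ?jap_gt0 // lt_max jap_gt0 //.
    by rewrite mulr_ge0 ?powR_ge0.
  - apply: ler_pM; rewrite ?powR_ge0 //; last exact: max_pow_le.
      have := le_trans (normc_ge0 _) (hK t1 t2 0 0 0).
      rewrite -mulrA => h; rewrite leNgt; apply/negP => k1; move: h; apply/negP; rewrite -ltNge.
      rewrite nmulr_rlt0 // mulr_gt0 // powR_gt0 ?jap_gt0 // lt_max jap_gt0 //.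
    exact: ler_norm.
  - exact: jap_powR_le.
have dz : normc (d p) = normc (zz z p) by rewrite /d normcM normc_cexp mulr1.
have h1 := normc_Re (cderive1n n (At A p) xi); have h2 := normc_Im (cderive1n n (At A p) xi).
have h3 := normc_Re (d p); have h4 := normc_Im (d p).
rewrite dz in h3 h4.
have h5 : `|complex.Re (cderive1n n (At A p) xi)| <= `|K| * (jap p.2.1%:~R * jap p.2.2%:~R) `^ mu
     * (1 + r') `^ `|m - n%:R| := le_trans h1 hp.
have h6 : `|complex.Im (cderive1n n (At A p) xi)| <= `|K| * (jap p.2.1%:~R * jap p.2.2%:~R) `^ mu
     * (1 + r') `^ `|m - n%:R| := le_trans h2 hp.
apply: (le_trans (ler_normD _ _)); rewrite !normrM normrN.
have -> : L * W1 mu z p = normc (zz z p) * (`|K| * (jap p.2.1%:~R * jap p.2.2%:~R) `^ mu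
     * (1 + r') `^ `|m - n%:R|) + normc (zz z p) * (`|K| * (jap p.2.1%:~R * jap p.2.2%:~R) `^ mu
     * (1 + r') `^ `|m - n%:R|) by rewrite -W1_zz /L; ring.
by apply: lerD; apply: ler_pM.
Qed.

Lemma Abnd_Gamma2 A m mu : m <= 1 -> 0 <= mu -> Gamma2 m mu A -> exists2 K, 0 <= K & Abnd A mu K.
Proof.
move=> m1 mu0 [sA /(_ 0%N) [K hK]]; exists `|K| => // -[[s1 s2] [j1 j2]] xi /=.
have e : cderive1n 0 (A s1 s2 j1 j2) xi = A s1 s2 j1 j2 xi by apply: complex_eqP.
have := hK s1 s2 j1 j2 xi; rewrite e subr0 => /le_trans; apply.
have q0 := powR_ge0 (Num.max (jap (j1%:~R : R)) (jap j2%:~R)) mu.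
have x0 := powR_ge0 (jap xi) m.
apply: (@le_trans _ _ (`|K| * Num.max (jap (j1%:~R : R)) (jap j2%:~R) `^ mu * jap xi `^ m)).
  by rewrite ler_wpM2r // ler_wpM2r // ler_norm.
apply: ler_pM => //; first by rewrite mulr_ge0.
  by rewrite ler_wpM2l // max_pow_le.
by rewrite -[X in _ <= X]powRr1 ?(ltW (jap_gt0 _)) // ler_powR ?jap_ge1.
Qed.

Lemma Abnd_Vavg mu : 0 <= mu -> Abnd (@Vavg_coef R) mu 1.
Proof.
move=> mu0 -[[s1 s2] [j1 j2]] xi /=; rewrite /Vavg_coef mul1r.
have J : 1 <= (jap (j1%:~R : R) * jap j2%:~R) `^ mu.
  by apply: powR_ge1 => //; have := jap_ge1 (j1%:~R : R); have := jap_ge1 (j2%:~R : R); nra.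
case: ifP => _; last by rewrite normc0 mulr_ge0 ?powR_ge0 // ltW // jap_gt0.
rewrite normc_real; apply: (le_trans (norm_le_jap xi)).
by rewrite ler_peMl // ltW // jap_gt0.
Qed.

Lemma AbndD A A' mu K K' : Abnd A mu K -> Abnd A' mu K' ->
  Abnd (fun s1 s2 j1 j2 xi => A s1 s2 j1 j2 xi + A' s1 s2 j1 j2 xi) mu (K + K').
Proof.
move=> h h' p xi.
have -> : At (fun s1 s2 j1 j2 xi => A s1 s2 j1 j2 xi + A' s1 s2 j1 j2 xi) p xi = At A p xi + At A' p xi.
  by case: p => -[s1 s2] [j1 j2].
by rewrite !mulrDl; apply: (le_trans (le_normcD _ _)); exact: lerD.
Qed.

Lemma Abnd_i A mu K : Abnd A mu K -> Abnd (fun s1 s2 j1 j2 xi => 'i%C * A s1 s2 j1 j2 xi) mu K.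
Proof.
move=> h p xi; have := h p xi; case: p => -[s1 s2] [j1 j2] /=.
by rewrite normcM normc_i mul1r.
Qed.

End Symbols.

(** * Linearity of the quantization in the symbol *)

Section OpBWlin.
Context {R : realType}.
Local Notation C := R[i].
Variables (delta0 : R) (chi : 'rV[R]_1 * R -> R).
Hypotheses (hdelta0 : 0 < delta0 <= 10^-1) (hchi : cutoff delta0 chi).
Implicit Types (a : symbol R) (v : fseq R).

Lemma OpBWD a a' v k : (forall xi, exists M, cbm (fun x => a x xi) M) ->
  (forall xi, exists M, cbm (fun x => a' x xi) M) ->
  OpBW chi (fun x xi => a x xi + a' x xi) v k = OpBW chi a v k + OpBW chi a' v k.
Proof.
move=> h h'; rewrite !(OpBW_box hdelta0 hchi) -big_split /=; apply: eq_bigr => j _.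
have [M hM] := h (mid j k); have [M' hM'] := h' (mid j k).
by rewrite (fcoefD _ hM hM') mulrDr mulrDl.
Qed.

Lemma OpBWZ (c : C) a v k : (forall xi, exists M, cbm (fun x => a x xi) M) ->
  OpBW chi (fun x xi => c * a x xi) v k = c * OpBW chi a v k.
Proof.
move=> h; rewrite !(OpBW_box hdelta0 hchi) mulr_sumr; apply: eq_bigr => j _.
have [M hM] := h (mid j k).
by rewrite (fcoefZ c _ hM); ring.
Qed.

End OpBWlin.

(** * Quadratic and quartic parts of the symbol of the system *)

Section System.
Context {R : realType}.
Local Notation C := R[i].
Variables (alpha s0 r mu : R) (S : system R).
Hypotheses (halpha : 0 < alpha < 1) (hmu : 0 <= mu) (hs0 : mu + 10 <= s0) (hr : 0 < r).
Hypothesis (hS : admissible alpha s0 r mu S).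
Implicit Types (z v : fseq R).

Lemma alpha_le1 : alpha <= 1.
Proof. by case/andP: halpha => _ /ltW. Qed.

Lemma inball_Hb z : inball s0 r z -> Hb s0 z (sob s0 z) /\ sob s0 z < r.
Proof.
move=> h; have h1 : inH s0 z by apply: lt_trans h (ltry _).
split; first exact: Hb_sob.
by rewrite -lte_fin -sobE_fin.
Qed.

Lemma Hb_inball z M : Hb s0 z M -> M < r -> inball s0 r z.
Proof. by move=> /Hb_le h Mr; apply: (le_lt_trans h); rewrite lte_fin. Qed.

Definition AS : qcoef R := fun s1 s2 j1 j2 xi => Vavg_coef s1 s2 j1 j2 xi + a2 S s1 s2 j1 j2 xi.

Definition aS z : symbol R := fun x xi => (Vavg z x * xi)%:C + qeval (a2 S) z x xi.

Definition rS z : symbol R := fun x xi => V4 S z x * xi%:C + a4 S z x xi.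

Lemma msymE z x xi : msym S z x xi = aS z x xi + rS z x xi.
Proof. by rewrite /msym /aS /rS !addrA. Qed.

Lemma AS_bnd : exists2 K, 0 <= K & Abnd AS mu K.
Proof.
case: hS => _ _ _ [g2 _ _ _] _; have [K K0 hK] := Abnd_Gamma2 alpha_le1 hmu g2.
by exists (1 + K); [rewrite addr_ge0 | exact: AbndD (Abnd_Vavg hmu) hK].
Qed.

Lemma aS_uapprox z M : Hb s0 z M -> uapprox AS z (aS z).
Proof.
move=> hz; case: hS => _ _ _ [g2 _ _ _] _.
have [K K0 hK] := Abnd_Gamma2 alpha_le1 hmu g2.
apply: uapproxD; first by apply: uapprox_Vavg hz; move: hmu hs0; lra.
by apply: (uapprox_qeval hmu K0 _ hK hz); move: hs0; lra.
Qed.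

(** [V4 * xi] has order one and [a4] has order [alpha <= 1]; the normalizing weight of [symnorm] is
    undone by multiplying back with [jap xi ^ alpha]. *)
Lemma rS_fcoef : exists2 K, 0 <= K & forall z, inball s0 r z ->
  (forall xi, exists M, cbm (fun x => rS z x xi) M) /\
  forall xi n, normc (fcoef (fun x => rS z x xi) n) <= K * sob s0 z ^+ 4 * jap xi.
Proof.
case: hS => _ _ _ _ [_ [K1 h1] _ /(_ 0%N) [K2 h2]].
exists (2 * (`|K1| + `|K2|)); first by rewrite mulr_ge0 ?addr_ge0.
move=> z hz; have {}h1 := h1 z hz; have {}h2 := h2 z hz.
have s4 : 0 <= sob s0 z ^+ 4 by rewrite exprn_ge0 // sob_ge0.
have bV := winf_cbm (Winf_ex h1 ltr01).
have e4 xi x : a4 S z x xi = (jap xi `^ alpha)%:C * ((jap xi `^ (- alpha + 0%:R))%:C * cderive1n 0 (a4 S z x) xi).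
  have -> : cderive1n 0 (a4 S z x) xi = a4 S z x xi by apply: complex_eqP.
  rewrite mulrA -rmorphM addr0 powRN divff ?mul1r //.
  by rewrite gt_eqF // powR_gt0 // jap_gt0.
have b4 xi := winf_cbm (Winf_ex (symnorm_Winf xi h2 (leqnn 0)) ltr01).
have bVx xi : cbm (fun x => V4 S z x * xi%:C) (normc (xi%:C : C) * (K1 * sob s0 z ^+ 4 + 1)).
  by apply: (cbm_ext _ (cbmZ xi%:C bV)) => x; rewrite mulrC.
have b4x xi : cbm (fun x => a4 S z x xi) (normc ((jap xi `^ alpha)%:C : C) * (K2 * sob s0 z ^+ 4 + 1)).
  by apply: (cbm_ext _ (cbmZ (jap xi `^ alpha)%:C (b4 xi))) => x; rewrite -e4.
split; first by move=> xi; eexists; exact: cbmD (bVx xi) (b4x xi).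
move=> xi n; rewrite (fcoefD n (bVx xi) (b4x xi)).
have f1 : normc (fcoef (fun x => V4 S z x * xi%:C) n) <= jap xi * (2 * (`|K1| * sob s0 z ^+ 4)).
  rewrite (_ : (fun x => _) = (fun x => xi%:C * V4 S z x)); last by apply/funext => x; rewrite mulrC.
  rewrite (fcoefZ _ n bV) normcM normc_real; apply: ler_pM; rewrite ?normc_ge0 ?norm_le_jap //.
  apply: (le_trans (fcoef_Winf n h1)); rewrite ler_pM2l // ler_wpM2r // ler_norm //.
have f2 : normc (fcoef (fun x => a4 S z x xi) n) <= jap xi * (2 * (`|K2| * sob s0 z ^+ 4)).
  rewrite (_ : (fun x => _) = (fun x => (jap xi `^ alpha)%:C * ((jap xi `^ (- alpha + 0%:R))%:C * cderive1n 0 (a4 S z x) xi))); last first.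
    by apply/funext => x; rewrite -e4.
  rewrite (fcoefZ _ n (b4 xi)) normcM normc_real_ge0 ?powR_ge0 //.
  apply: ler_pM; rewrite ?normc_ge0 ?powR_ge0 //.
    by have := ler_powR (jap_ge1 xi) alpha_le1; rewrite powRr1 // ltW // jap_gt0.
  apply: (le_trans (fcoef_Winf n (symnorm_Winf xi h2 (leqnn 0)))).
  by rewrite ler_pM2l // ler_wpM2r // ler_norm.
apply: (le_trans (le_normcD _ _)); apply: (le_trans (lerD f1 f2)).
by apply: le_of_eq; ring.
Qed.

(** This is the [n]-th Fourier coefficient of the quadratic symbol at z^top ([fcoef_top]). The
    frequencies involved are 1 in modulus, so the box of size 1 contains every term. *)
Definition ttq z (n : int) (xi : R) : C := \sum_(p <- ibox 1 | tt p && (freq p == n)) At AS p xi * zz z p.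

Lemma zz_top z p : zz (top z) p = if tt p then zz z p else 0.
Proof.
case: p => -[s1 s2] [j1 j2]; rewrite /tt /= /top.
have z0 b : zsgn b (0 : C) = 0 by case: b => //=; rewrite oppr0.
by case: (_ == _); case: (_ == _); rewrite ?z0 ?mul0r ?mulr0.
Qed.

Lemma fcoef_top z M n xi : Hb s0 z M -> fcoef (fun x => aS (top z) x xi) n = ttq z n xi.
Proof.
move=> hz; apply/eqP; rewrite -subr_eq0; apply/eqP/normc_eq0_le.
apply/ler_addgt0Pr => e e0; rewrite add0r.
have [N0 h] := uapprox_fapprox (aS_uapprox (Hb_top hz)) xi n e0.
apply: le_trans (h (maxn N0 1) (leq_maxl _ _)).
apply: le_of_eq; congr (normc (_ - _)).
rewrite /ttq (eq_bigr (fun p => At AS p xi * zz (top z) p)); last first.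
  by move=> p /andP[tp _]; rewrite zz_top tp.
rewrite -[LHS]big_filter -[RHS]big_filter; apply/esym.
apply: sum_supp; rewrite ?filter_uniq ?uniq_ibox // => p.
  rewrite !mem_filter !mem_ibox => /andP[/andP[_ ->] /andP[a b]] /=.
  by rewrite !(leq_trans _ (leq_maxr _ _)).
rewrite !mem_filter !mem_ibox zz_top => /andP[-> _]; rewrite andbT.
case: (boolP (tt p)) => [/andP[/eqP -> /eqP ->] //|_ _]; by rewrite mulr0.
Qed.

Lemma ttq_scale z (la : R) n xi : ttq (fun k => la%:C * z k) n xi = (la ^+ 2)%:C * ttq z n xi.
Proof.
rewrite /ttq mulr_sumr; apply: eq_bigr => -[[s1 s2] [j1 j2]] _.
have e b (w : C) : zsgn b (la%:C * w) = la%:C * zsgn b w.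
  by case: b => //=; rewrite rmorphM /= oppr0.
by rewrite /zz !e expr2 rmorphM /=; ring.
Qed.

(* The symbol is real only up to the quartic terms, but scaling z by la -> 0
   isolates the quadratic part. *)
Lemma ttq_conj z n xi : inball s0 r z -> ttq z (- n) xi = (ttq z n xi)^*%C.
Proof.
move=> hz; have [hM Mr] := inball_Hb hz; set M := sob s0 z in hM Mr.
have M0 := proj1 hM.
have [K K0 hK] := rS_fcoef.
pose Dl := normc (ttq z (- n) xi - (ttq z n xi)^*%C).
pose Cs := 2 * (K * M ^+ 4 * jap xi).
have Cs0 : 0 <= Cs by rewrite !mulr_ge0 ?exprn_ge0 // ltW // jap_gt0.
have key la : 0 < la -> la <= 1 -> Dl <= Cs * la ^+ 2.
  move=> l0 l1; pose zl : fseq R := fun k => la%:C * z k.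
  have hzl : Hb s0 zl (la * M) by have := HbZ la%:C hM; rewrite normc_real gtr0_norm.
  have lM : la * M < r by apply: le_lt_trans Mr; rewrite ler_piMl.
  have htl := Hb_top hzl; have bl := Hb_inball htl lM.
  have [cR hR] := hK _ bl.
  have [[Ma bA] _] := aS_uapprox htl xi.
  have [Mr' bR] := cR xi.
  have sl : sob s0 (top zl) <= la * M by exact: sob_le.
  have hrho m : normc (fcoef (fun x => rS (top zl) x xi) m) <= K * M ^+ 4 * jap xi * la ^+ 4.
    apply: (le_trans (hR xi m)).
    have : sob s0 (top zl) ^+ 4 <= (la * M) ^+ 4.
      by apply: lerXn2r; rewrite ?nnegrE ?sob_ge0 // mulr_ge0 // ltW.
    have j0 := jap_gt0 xi; rewrite exprMn => h.
    have -> : K * M ^+ 4 * jap xi * la ^+ 4 = K * jap xi * (la ^+ 4 * M ^+ 4) by ring.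
    have -> : K * sob s0 (top zl) ^+ 4 * jap xi = K * jap xi * sob s0 (top zl) ^+ 4 by ring.
    by apply: ler_wpM2l => //; rewrite mulr_ge0 // ltW.
  have hm m : fcoef (fun x => msym S (top zl) x xi) m =
      (la ^+ 2)%:C * ttq z m xi + fcoef (fun x => rS (top zl) x xi) m.
    have -> : (fun x => msym S (top zl) x xi) = (fun x => aS (top zl) x xi + rS (top zl) x xi).
      by apply/funext => x; rewrite msymE.
    by rewrite (fcoefD m bA bR) (fcoef_top m xi hzl) (ttq_scale z la m xi).
  have bm : cbm (fun x => msym S (top zl) x xi) (Ma + Mr').
    by apply: (cbm_ext _ (cbmD bA bR)) => x; rewrite msymE.
  have him x : complex.Im (msym S (top zl) x xi) = 0.
    by case: hS => _ _ _ _ [h _ _ _]; exact: h.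
  have := fcoef_conj n bm him; rewrite !hm cjD cjM cjR => e.
  have e2 : (la ^+ 2)%:C * (ttq z (- n) xi - (ttq z n xi)^*%C) =
     (fcoef (fun x => rS (top zl) x xi) n)^*%C - fcoef (fun x => rS (top zl) x xi) (- n).
    rewrite mulrBr; move: e; set X := _ * ttq z (- n) xi; set Y := _ * _^*%C.
    set U := fcoef _ _; set W := _^*%C => e; have -> : X = Y + W - U by rewrite -e addrK.
    ring.
  have l2 : 0 < la ^+ 2 by rewrite exprn_gt0.
  have := congr1 (@normc R) e2; rewrite normcM normc_real_ge0 ?(ltW l2) // -/Dl => e3.
  have := le_normcB ((fcoef (fun x => rS (top zl) x xi) n)^*%C) (fcoef (fun x => rS (top zl) x xi) (- n)).
  rewrite -e3 normc_conj => h; have := hrho n; have := hrho (- n) => h1 h2.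
  rewrite -(ler_pM2l l2); apply: (le_trans h); rewrite /Cs.
  have -> : la ^+ 2 * (2 * (K * M ^+ 4 * jap xi) * la ^+ 2) = 2 * (K * M ^+ 4 * jap xi * la ^+ 4) by ring.
  lra.
apply/eqP; rewrite -subr_eq0; apply/eqP/normc_eq0_le; rewrite -/Dl leNgt; apply/negP => D0.
(* With this value [Cs * la ^+ 2 <= Cs * la < Dl], which contradicts [key]. *)
pose la := Num.min 1 (Dl / (2 * (Cs + 1))).
have c1 : 0 < 2 * (Cs + 1) by lra.
have l0 : 0 < la by rewrite lt_min ltr01 divr_gt0.
have l1 : la <= 1 by rewrite ge_min lexx.
have l2 : la * (2 * (Cs + 1)) <= Dl by rewrite -ler_pdivlMr // ge_min lexx orbT.
have := key la l0 l1; nra.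
Qed.

Lemma ttq_out z n xi : (2 < `|n|)%N -> ttq z n xi = 0.
Proof.
move=> hn; rewrite /ttq big1 // => -[[s1 s2] [j1 j2]] /andP[/andP[/= /eqP h1 /eqP h2] /eqP e].
by move: hn e h1 h2; case: s1; case: s2 => /=; lia.
Qed.

Lemma ttq_le : exists2 K, 0 <= K & forall z, inball s0 r z -> forall n xi,
  normc (ttq z n xi) <= K * jap xi.
Proof.
have [K K0 hK] := AS_bnd; have [|c c0 hW] := @W_sums R mu s0; first by move: hs0; lra.
exists (K * (c * (r * r))); first by rewrite !mulr_ge0 // ltW.
move=> z hz n xi; have [hM Mr] := inball_Hb hz.
have [hW1 _] := hW z r r (Hb_mono (ltW Mr) hM) (Hb_perp (Hb_mono (ltW Mr) hM)).
rewrite /ttq -big_filter; apply: (le_trans (normc_sum _ _)).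
apply: (@le_trans _ _ (\sum_(p <- [seq p <- ibox 1 | tt p && (freq p == n)]) K * jap xi * W1 mu z p)).
  by apply: ler_sum => p _; exact: At_zz_le.
rewrite -mulr_sumr mulrAC; apply: ler_wpM2r; first exact: ltW (jap_gt0 _).
by apply: ler_wpM2l => //; apply: sum_ibox_W hW1 => p; exact: W1_ge0.
Qed.

End System.

(** * Hermitian structure of the interactions with z^top *)

Section TopTopEnergy.
Context {R : realType}.
Local Notation C := R[i].
Variables (delta0 : R) (chi2 : 'rV[R]_2 * R -> R).
Hypotheses (hdelta0 : 0 < delta0 <= 10^-1) (hchi2 : cutoff delta0 chi2).
Variables (alpha s0 r mu : R) (S : system R).
Hypotheses (halpha : 0 < alpha < 1) (hmu : 0 <= mu) (hs0 : mu + 10 <= s0) (hr : 0 < r).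
Hypothesis (hS : admissible alpha s0 r mu S).
Implicit Types (z v : fseq R) (k j : int).

(** Evenness in each argument makes the cut-off a function of [xi] alone when both frequencies are 1
    in modulus; it then factors out of the sum and leaves the Hermitian symmetry intact. *)
Lemma chi2_tt p xi : tt p ->
  chi2 (vec2 p.2.1%:~R p.2.2%:~R, xi) = chi2 (vec2 1 1, xi).
Proof.
case: hchi2 => _ [ev _] _ _ _ /andP[/eqP h1 /eqP h2].
have e1 (x y : R) : chi2 (vec2 (- x) y, xi) = chi2 (vec2 x y, xi) by rewrite -flip_vec2_0 ev.
have e2 (x y : R) : chi2 (vec2 x (- y), xi) = chi2 (vec2 x y, xi) by rewrite -flip_vec2_1 ev.
have a (i : int) : `|i|%N = 1%N -> i = 1 \/ i = -1 by lia.
by case: (a _ h1) => ->; case: (a _ h2) => ->; rewrite ?rmorphN1 ?e1 ?e2.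
Qed.

(** Matrix of the operator with the factor [i] taken out. The Weyl midpoint is symmetric in [j] and
    [k], so the conjugate symmetry of Fourier coefficients becomes Hermitian symmetry of the
    matrix. *)
Definition Qtt z k j : C := (chi2 (vec2 1 1, mid j k))%:C * ttq S z (k - j) (mid j k).

Lemma ttsum_Qtt z v k :
  ttsum chi2 (fun s1 s2 j1 j2 xi => 'i%C * AS S s1 s2 j1 j2 xi) z v k =
  \sum_(n <- zbox 2) 'i%C * Qtt z k (k - n) * v (k - n).
Proof.
pose G (p : @I4) n : C := 'i%C * (chi2 (vec2 1 1, mid (k - n) k))%:C
  * (At (AS S) p (mid (k - n) k) * zz z p) * v (k - n).
rewrite (eq_bigr (fun n => \sum_(p <- ibox 1 | tt p) if freq p == n then G p n else 0)); last first.
  move=> n _; rewrite /Qtt subKr /ttq mulrA mulr_sumr mulr_suml big_mkcondr /=.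
  by apply: eq_bigr => p _; case: ifP.
rewrite exchange_big /= /ttsum; apply: eq_bigr => p tp.
rewrite (bigD1_seq (freq p)) ?uniq_zbox //=; last first.
  rewrite mem_zbox; case: p tp => -[s1 s2] [j1 j2] /andP[/= /eqP h1 /eqP h2].
  by case: s1; case: s2 => /=; lia.
rewrite eqxx big1 ?addr0; last by move=> n /negbTE; rewrite eq_sym => ->.
rewrite /G /term2 chi2_tt //.
have -> : At (fun s1 s2 j1 j2 xi => 'i%C * AS S s1 s2 j1 j2 xi) p (mid (k - freq p) k) =
   'i%C * At (AS S) p (mid (k - freq p) k) by case: p {tp} => -[s1 s2] [j1 j2].
by ring.
Qed.

Lemma Qtt_conj z k j : inball s0 r z -> Qtt z j k = (Qtt z k j)^*%C.
Proof.
move=> hz; rewrite /Qtt cjM cjR.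
have -> : mid k j = mid j k :> R by rewrite /mid addrC.
by rewrite -(ttq_conj halpha hmu hs0 hS _ _ hz) opprB.
Qed.

Lemma Qtt_out z k j : (2 < `|k - j|)%N -> Qtt z k j = 0.
Proof. by move=> h; rewrite /Qtt (ttq_out S halpha hmu hs0 hr) // mulr0. Qed.

(* Hermitian symmetry cancels the sum over the box; only the interactions
   across its boundary survive, and they vanish as the box grows. *)
Lemma tt_energy : exists2 K, 0 <= K & forall z v M, inball s0 r z -> Hb 2 v M -> forall N,
  `|\sum_(k <- zbox N) complex.Re ((v k)^*%C *
      ttsum chi2 (fun s1 s2 j1 j2 xi => 'i%C * AS S s1 s2 j1 j2 xi) z v k)|
  <= K * M ^+ 2 / N.+1%:R.
Proof.
have [K2 K2p hK2] := cutoff_bounded hchi2.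
have [Kq Kq0 hKq] := ttq_le halpha hmu hs0 hr hS.
have [c c0 hc] := @l1_bound R.
pose L := K2 * Kq * 2; have L0 : 0 <= L by rewrite !mulr_ge0 // ltW.
exists (5 * L * c); first by rewrite !mulr_ge0 // ltW.
move=> z v M hz hv N; have M0 := proj1 hv.
pose a k j := complex.Re ((v k)^*%C * ('i%C * Qtt z k j * v j)).
have E1 k : complex.Re ((v k)^*%C * ttsum chi2 (fun s1 s2 j1 j2 xi => 'i%C * AS S s1 s2 j1 j2 xi) z v k)
   = \sum_(j <- zbox N) a k j + \sum_(n <- zbox 2 | k - n \notin zbox N) a k (k - n).
  rewrite ttsum_Qtt mulr_sumr Re_sum (bigID (fun n => k - n \in zbox N)) /=; congr (_ + _).
  rewrite -[LHS]big_filter -(big_map (fun n => k - n) xpredT (a k)).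
  have -> : a k = (fun j => complex.Re ((v k)^*%C * ('i%C * Qtt z k j * v j))) by [].
  rewrite -!Re_sum; congr complex.Re; apply/esym; apply: sum_supp.
  - by rewrite map_inj_uniq ?filter_uniq ?uniq_zbox // => x y /addrI /oppr_inj.
  - exact: uniq_zbox.
  - by move=> j /mapP[n]; rewrite mem_filter => /andP[h _] ->.
  - move=> j jN jn; rewrite Qtt_out ?mulr0 ?mul0r ?mulr0 // ltnNge -mem_zbox; apply/negP => h.
    case/negP: jn; apply/mapP; exists (k - j); last by rewrite subKr.
    by rewrite mem_filter subKr jN h.
rewrite (eq_bigr _ (fun k _ => E1 k)) big_split /=.
have anti k j : a j k = - a k j.
  rewrite /a (Qtt_conj k j hz); move: (v k) (v j) (Qtt z k j) => [x y] [u w] [q t] /=; ring.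
have T0 : \sum_(k <- zbox N) \sum_(j <- zbox N) a k j = 0.
  set T := \sum_(k <- _) _; have e : T = - T.
    rewrite {1}/T exchange_big /= -sumrN; apply: eq_bigr => k _.
    by rewrite -sumrN; apply: eq_bigr => j _; rewrite anti.
  lra.
rewrite T0 add0r; apply: (le_trans (ler_norm_sum _ _ _)).
have N0 : 0 < N.+1%:R :> R by rewrite ltr0n.
(* The second index lies outside the box, so its bracket is at least [N + 1]. The matrix entry grows
   linearly in the frequency, and the H^2 bound on [v] leaves a gain of [1 / (N + 1)]. *)
have key k n : n \in zbox 2 -> k - n \notin zbox N -> `|a k (k - n)| <= normc (v k) * (L * M / N.+1%:R).
  rewrite !mem_zbox => hn hk; apply: (le_trans (normc_Re _)).
  rewrite normcM normc_conj ler_wpM2l ?normc_ge0 // !normcM normc_i mul1r normc_real.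
  move: hn hk; rewrite (absz_jap (R := R)) -ltnNge => hn hk.
  have hk1 : N.+1%:R <= `|(k - n)%:~R : R|.
    by rewrite -intr_norm -abszE -pmulrn ler_nat.
  have j1 := norm_le_jap ((k - n)%:~R : R); have j2 := jap_ge1 ((k - n)%:~R : R).
  have hm : jap (mid (k - n) k : R) <= 2 * jap (k - n)%:~R.
    have -> : mid (k - n) k = (k - n)%:~R + n%:~R / 2 :> R.
      by rewrite /mid !intrD intrN; field.
    apply: (le_trans (japD _ _)); rewrite mulr2n mulrDl mul1r lerD2l.
    apply: jap_le => //; rewrite normrM (ger0_norm (_ : 0 <= 2^-1)) ?invr_ge0 //.
    move: hn j2; rewrite -[2%N%:R]/(2 : R); lra.
  have hv2 : jap (k - n)%:~R * (jap (k - n)%:~R * normc (v (k - n))) <= M.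
    by have := Hb_coef (k - n) hv; rewrite powR_natr ?(ltW (jap_gt0 _)) // expr2 mulrA.
  have nv := normc_ge0 (v (k - n)).
  have h1 : jap (k - n)%:~R * normc (v (k - n)) <= M / N.+1%:R.
    rewrite ler_pdivlMr // mulrC; apply: le_trans hv2; apply: ler_wpM2r.
      by rewrite mulr_ge0 // ltW // jap_gt0.
    exact: le_trans hk1 j1.
  have h2 := hKq z hz n (mid (k - n) k).
  rewrite subKr; apply: (@le_trans _ _ (K2 * (Kq * (2 * jap (k - n)%:~R)) * normc (v (k - n)))).
    apply: ler_wpM2r => //; apply: ler_pM; rewrite ?normc_ge0 //.
    by apply: (le_trans h2); exact: ler_wpM2l.
  have -> : K2 * (Kq * (2 * jap (k - n)%:~R)) * normc (v (k - n)) = L * (jap (k - n)%:~R * normc (v (k - n))).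
    by rewrite /L; ring.
  by rewrite -mulrA; exact: ler_wpM2l.
have x0 k : 0 <= normc (v k) * (L * M / N.+1%:R).
  by rewrite mulr_ge0 ?normc_ge0 // divr_ge0 // ?mulr_ge0 // ltW.
(* The box [zbox 2] has five elements, one for each diagonal of the band. *)
apply: (@le_trans _ _ (\sum_(k <- zbox N) 5 * (normc (v k) * (L * M / N.+1%:R)))).
  apply: ler_sum => k _; apply: (le_trans (ler_norm_sum _ _ _)).
  rewrite big_seq_cond big_mkcond /=.
  apply: (@le_trans _ _ (\sum_(n <- zbox 2) normc (v k) * (L * M / N.+1%:R))).
    by apply: ler_sum => n _; case: ifP => // /andP[h1 h2]; exact: key.
  move: (normc (v k) * _) => x; rewrite big_const_seq count_predT /= !addr0; lra.
rewrite -mulr_sumr -mulr_suml.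
have h0 : (0 : R) + 1 <= 2 by lra.
have hl := hc 0 2 v M h0 hv (zbox N) (uniq_zbox N).
have {}hl : \sum_(k <- zbox N) normc (v k) <= c * M.
  by apply: le_trans hl; apply: ler_sum => k _; rewrite powRr0 mul1r.
have -> : 5 * L * c * M ^+ 2 / N.+1%:R = 5 * (c * M * (L * M / N.+1%:R)) by ring.
apply: ler_wpM2l => //; apply: ler_wpM2r hl.
by rewrite divr_ge0 // ?mulr_ge0 // ltW.
Qed.

End TopTopEnergy.

(** * Derivatives of curves on a closed interval and mean value inequalities *)

Section Evolution.
Context {R : realType}.
Local Notation C := R[i].

(** Continuous induction: the supremum of the times up to which [P] holds is reached by the first
    half of the step, and the second half pushes beyond it unless it is [T]. *)
Lemma real_induction (T : R) (P : R -> Prop) :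
  (forall t, 0 <= t <= T -> (forall u, 0 <= u < t -> P u) ->
     P t /\ (t < T -> exists2 d, 0 < d & forall u, t < u < t + d -> u <= T -> P u)) ->
  forall t, 0 <= t <= T -> P t.
Proof.
move=> step t1 /andP[t10 t1T].
pose A := [set t : R | 0 <= t <= T /\ forall u, 0 <= u <= t -> P u].
have T0 : 0 <= T := le_trans t10 t1T.
have A0 : A 0.
  split; first by rewrite lexx.
  move=> u hu; have -> : u = 0 by move: hu; lra.
  have e0 : 0 <= (0 : R) <= T by rewrite lexx.
  have [|P0 _] := step 0 e0; last exact: P0.
  by move=> w hw; exfalso; move: hw; lra.
have hs : has_sup A by split; [exists 0 | exists T => x [/andP[]]].
pose s := sup A.
have s0 : 0 <= s by apply: sup_upper_bound.
have sT : s <= T by apply: ge_sup; [exists 0 | move=> x [/andP[]]].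
have below u : 0 <= u < s -> P u.
  move=> /andP[u0 us].
  have d0 : 0 < s - u by rewrite subr_gt0.
  have [x [hx hP] xs] := sup_adherent d0 hs.
  by apply: hP; rewrite u0 /= ltW //; move: xs; rewrite -/s; lra.
have [|Ps ext] := step s _ below; first by rewrite s0.
have [sT'|Ts] := ltP s T.
  have [d d0 hd] := ext sT'.
  have : A (Num.min T (s + d / 2)).
    have m1 : Num.min T (s + d / 2) <= T by rewrite ge_min lexx.
    have m2 : Num.min T (s + d / 2) <= s + d / 2 by rewrite ge_min lexx orbT.
    split; first by rewrite m1 le_min T0 /=; lra.
    move=> u /andP[u0 uv]; have [us|su|->] := ltgtP u s => //.
      by apply: below; rewrite u0.
    apply: hd; last exact: le_trans uv m1.
    by rewrite su /=; lra.
  move=> /(sup_upper_bound hs); rewrite -/s ge_min leNgt sT' /= => h; exfalso; move: h; lra.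
have [ts|st|->] := ltgtP t1 s => //; first by apply: below; rewrite t10.
by exfalso; lra.
Qed.

(** Form of [is_cdt] with the division removed; at the end points only times in [[0, T]] are
    compared. Product and conjugation rules are direct estimates in this form. *)
Definition cdt (T : R) (f g : R -> C) : Prop := forall t, 0 <= t <= T ->
  forall e, 0 < e -> exists2 d, 0 < d & forall u, 0 <= u <= T -> `|u - t| < d ->
    normc (f u - f t - (u - t)%:C * g t) <= e * `|u - t|.

Lemma is_cdt_cdt T f g : is_cdt T f g -> cdt T f g.
Proof.
move=> h t tT e e0; have /cvgrPdist_le /(_ e e0) := h t tT.
rewrite near_withinE near_withinE => /nbhs_ballP [d /= d0 hd].
exists d => // u uT ut.
have [->|un] := eqVneq u t; first by rewrite !subrr mul0r subr0 normc0 normr0 mulr0.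
have := hd u; rewrite /ball /= distrC => /(_ ut un); rewrite in_itv /= => /(_ uT).
rewrite sub0r normrN ger0_norm ?normc_ge0 // => hq.
have n0 : u - t != 0 by rewrite subr_eq0.
have -> : f u - f t - (u - t)%:C * g t = (u - t)%:C * (((u - t)^-1)%:C * (f u - f t) - g t).
  by rewrite mulrBr mulrA -rmorphM divff // mul1r.
by rewrite normcM normc_real mulrC ler_wpM2r.
Qed.

Lemma cvg0_small (T : Type) (F : set_system T) {FF : Filter F} (f : T -> \bar R) :
  f @ F --> (0 : \bar R) -> forall e : R, 0 < e -> \forall x \near F, (f x <= e%:E)%E.
Proof.
move=> /fine_cvgP [hf /cvgrPdist_le h] e e0; have := h e e0 => h1.
near=> x.
have fx : f x \is a fin_num by near: x.
have : `|0 - fine (f x)| <= e by near: x.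
by rewrite sub0r normrN => /(le_trans (ler_norm _)); rewrite -lee_fin fineK.
Unshelve. all: by end_near. Qed.

Lemma sobE_coef s (u : fseq R) e k : 0 <= s -> 0 <= e -> (sobE s u <= e%:E)%E -> normc (u k) <= e.
Proof. by move=> s0 e0 /(sobE_leP _ _ e0) h; exact: Hb_coef0 h. Qed.

(** A single coefficient is bounded by any Sobolev norm of nonnegative order, so differentiability
    of the curve passes to each mode. *)
Lemma is_dt_cdt s T (z w : R -> fseq R) k : 0 <= s -> is_dt s T z w ->
  is_cdt T (fun t => z t k) (fun t => w t k).
Proof.
move=> s0 h t tT; apply/cvgrPdist_le => e e0.
have FF : Filter (within `[0, T] t^') by apply: within_filter.
have hx := @cvg0_small _ _ FF _ (h t tT) e e0.
apply: (@filterS _ _ FF _ _ _ hx) => u hu.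
rewrite sub0r normrN ger0_norm ?normc_ge0 //; exact: (sobE_coef k s0 (ltW e0) hu).
Qed.

Lemma cdt_lip T f g t : cdt T f g -> 0 <= t <= T -> exists2 d, 0 < d &
  forall u, 0 <= u <= T -> `|u - t| < d -> normc (f u - f t) <= (normc (g t) + 1) * `|u - t|.
Proof.
move=> h tT; have [d d0 hd] := h t tT 1 ltr01; exists d => // u uT ut.
have := hd u uT ut; rewrite mul1r => h1.
have := le_normcD (f u - f t - (u - t)%:C * g t) ((u - t)%:C * g t).
rewrite subrK normcM normc_real => h2; apply: (le_trans h2).
by rewrite mulrDl mul1r addrC [normc (g t) * _]mulrC lerD2l.
Qed.

Lemma cdt_cont T f g t e : cdt T f g -> 0 <= t <= T -> 0 < e -> exists2 d, 0 < d &
  forall u, 0 <= u <= T -> `|u - t| < d -> normc (f u - f t) <= e.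
Proof.
move=> h tT e0; have [d d0 hd] := cdt_lip h tT.
have L0 : 0 < normc (g t) + 1 by rewrite ltr_wpDl ?normc_ge0.
exists (Num.min d (e / (normc (g t) + 1))); first by rewrite lt_min d0 divr_gt0.
move=> u uT; rewrite lt_min => /andP[u1 u2]; apply: (le_trans (hd u uT u1)).
by rewrite -ler_pdivlMl // mulrC ltW.
Qed.

Lemma cdtM T f f1 g g1 : cdt T f f1 -> cdt T g g1 ->
  cdt T (fun t => f t * g t) (fun t => f1 t * g t + f t * g1 t).
Proof.
move=> hf hg t tT e e0.
pose L := normc (f t) + normc (g t) + normc (f1 t) + 2.
have [fn gn f1n] : [/\ 0 <= normc (f t), 0 <= normc (g t) & 0 <= normc (f1 t)].
  by split; exact: normc_ge0.
have L0 : 0 < L by rewrite /L; lra.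
have e3 : 0 < e / (3 * L) by rewrite divr_gt0 // mulr_gt0.
have [d1 d10 h1] := hf t tT _ e3; have [d2 d20 h2] := hg t tT _ e3.
have [d3 d30 h3] := cdt_lip hf tT; have [d4 d40 h4] := cdt_cont hg tT e3.
exists (Num.min (Num.min d1 d2) (Num.min d3 d4)); first by rewrite !lt_min d10 d20 d30.
move=> u uT; rewrite !lt_min => /andP[/andP[u1 u2] /andP[u3 u4]].
have {}h1 := h1 u uT u1; have {}h2 := h2 u uT u2; have {}h3 := h3 u uT u3; have {}h4 := h4 u uT u4.
have -> : f u * g u - f t * g t - (u - t)%:C * (f1 t * g t + f t * g1 t) =
  (f u - f t - (u - t)%:C * f1 t) * g t + f t * (g u - g t - (u - t)%:C * g1 t)
  + (f u - f t) * (g u - g t) by ring.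
apply: (le_trans (le_normcD _ _)); rewrite normcM.
have := le_normcD ((f u - f t - (u - t)%:C * f1 t) * g t) (f t * (g u - g t - (u - t)%:C * g1 t)).
rewrite !normcM => h5.
set x := `|u - t| in h1 h2 h3 *; have x0 : 0 <= x := normr_ge0 _.
set q := e / (3 * L) in e3 h1 h2 h4.
have eq3 : e = q * (3 * L) by rewrite /q divfK // gt_eqF // mulr_gt0.
have p1 := ler_wpM2r gn h1; have p2 := ler_wpM2l fn h2.
have p3 := ler_pM (normc_ge0 _) (normc_ge0 _) h3 h4.
have qx : 0 <= q * x by rewrite mulr_ge0 // ltW.
apply: (le_trans (lerD h5 p3)); apply: (le_trans (lerD (lerD p1 p2) (lexx _))).
have -> : q * x * normc (g t) + normc (f t) * (q * x) + (normc (f1 t) + 1) * x * q =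
   q * x * (normc (g t) + normc (f t) + normc (f1 t) + 1) by ring.
have -> : e * x = q * x * (3 * L) by rewrite eq3; ring.
by apply: ler_wpM2l => //; rewrite /L; lra.
Qed.

Lemma cdtZ T (c : C) f f1 : cdt T f f1 -> cdt T (fun t => c * f t) (fun t => c * f1 t).
Proof.
move=> hf t tT e e0; have L0 : 0 < normc c + 1 by rewrite ltr_wpDl ?normc_ge0.
have e1 : 0 < e / (normc c + 1) by rewrite divr_gt0.
have [d d0 h] := hf t tT _ e1; exists d => // u uT ut.
have -> : c * f u - c * f t - (u - t)%:C * (c * f1 t) = c * (f u - f t - (u - t)%:C * f1 t) by ring.
rewrite normcM; apply: (le_trans (ler_wpM2l (normc_ge0 _) (h u uT ut))).
rewrite mulrA ler_wpM2r // mulrCA ler_piMr ?(ltW e0) // ler_pdivrMr // mul1r lerDl //.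
Qed.

Lemma cdt_conj T f f1 : cdt T f f1 -> cdt T (fun t => (f t)^*%C) (fun t => (f1 t)^*%C).
Proof.
move=> hf t tT e e0; have [d d0 h] := hf t tT _ e0; exists d => // u uT ut.
have -> : (f u)^*%C - (f t)^*%C - (u - t)%:C * (f1 t)^*%C = (f u - f t - (u - t)%:C * f1 t)^*%C.
  by case: (f u) => a b; case: (f t) => c d'; case: (f1 t) => p q; apply: complex_eqP; rewrite /=; ring.
by rewrite normc_conj; exact: h.
Qed.

Lemma cdt_sum T (I : Type) (F : seq I) (f f1 : I -> R -> C) : (forall i, cdt T (f i) (f1 i)) ->
  cdt T (fun t => \sum_(i <- F) f i t) (fun t => \sum_(i <- F) f1 i t).
Proof.
move=> h; elim: F => [|a F IH] t tT e e0.
  by exists 1 => // u _ _; rewrite !big_nil mulr0 !subr0 normc0 mulr_ge0 // ltW.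
have e2 : 0 < e / 2 by lra.
have [d1 d10 h1] := h a t tT _ e2; have [d2 d20 h2] := IH t tT _ e2.
exists (Num.min d1 d2); first by rewrite lt_min d10.
move=> u uT; rewrite lt_min => /andP[u1 u2]; rewrite !big_cons.
set X := \sum_(_ <- _) _; set Y := \sum_(_ <- _) _; set Z := \sum_(_ <- _) _.
have -> : f a u + X - (f a t + Y) - (u - t)%:C * (f1 a t + Z) =
  (f a u - f a t - (u - t)%:C * f1 a t) + (X - Y - (u - t)%:C * Z) by ring.
apply: (le_trans (le_normcD _ _)); have := h1 u uT u1; have := h2 u uT u2; lra.
Qed.

(** Continuous induction with the slope [B + e], whose slack absorbs the error term of the
    derivative. This way of arguing asks for neither continuity nor integrability of [g]. *)
Lemma mvi_Re T f g (B : R) : cdt T f g -> (forall t, 0 <= t <= T -> complex.Re (g t) <= B) ->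
  forall t, 0 <= t <= T -> complex.Re (f t) - complex.Re (f 0) <= B * t.
Proof.
move=> h hB t tT; apply/ler_addgt0Pr => e' e'0.
pose e := e' / (t + 1); have t0 : 0 <= t by case/andP: tT.
have e0 : 0 < e by rewrite divr_gt0 // ltr_wpDl.
suff H : complex.Re (f t) - complex.Re (f 0) <= (B + e) * t.
  apply: (le_trans H); rewrite mulrDl lerD2l /e mulrAC ler_pdivrMr ?ltr_wpDl //.
  by rewrite ler_wpM2l ?(ltW e'0) // lerDl.
clearbody e; clear t0 e'0; move: t tT.
pose P u := complex.Re (f u) - complex.Re (f 0) <= (B + e) * u.
apply: (@real_induction T P) => t tT before.
have [d d0 hd] := h t tT e e0.
have step u : 0 <= u <= T -> `|u - t| < d ->
    complex.Re (f u) - complex.Re (f t) <= (u - t) * complex.Re (g t) + e * `|u - t| /\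
    (u - t) * complex.Re (g t) - e * `|u - t| <= complex.Re (f u) - complex.Re (f t).
  move=> uT ut; have := le_trans (normc_Re _) (hd u uT ut).
  rewrite !ReD !ReN ReM /= mul0r subr0 ler_norml => /andP[a b]; split; lra.
have gB := hB t tT.
split.
  have [t00|tn] := eqVneq t 0; first by rewrite /P t00 subrr mulr0.
  have tp : 0 < t by rewrite lt_def tn; case/andP: tT.
  pose u := Num.max 0 (t - d / 2).
  have ut : u < t by rewrite gt_max tp /=; lra.
  have u0 : 0 <= u by rewrite le_max lexx.
  have ud : t - d / 2 <= u by rewrite le_max lexx orbT.
  have uT : 0 <= u <= T by rewrite u0 /=; case/andP: tT => _; lra.
  have Pu : P u by apply: before; rewrite u0.
  have ab : `|u - t| = t - u by rewrite ltr0_norm ?opprB // subr_lt0.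
  have [|_ s2] := step u uT; first by rewrite ab; lra.
  rewrite ab in s2; rewrite /P in Pu *.
  have : (t - u) * complex.Re (g t) <= (t - u) * B by rewrite ler_wpM2l // subr_ge0 ltW.
  nra.
move=> tT'; exists d => // u /andP[u1 u2] uT.
have t0 : 0 <= t by case/andP: tT.
have uT2 : 0 <= u <= T by rewrite uT andbT; lra.
have ab : `|u - t| = u - t by rewrite gtr0_norm // subr_gt0.
have [|s1 _] := step u uT2; first by rewrite ab; lra.
have Pt : P t.
  have [t00|tn] := eqVneq t 0; first by rewrite /P t00 subrr mulr0.
  have tp : 0 < t by rewrite lt_def tn.
  pose w := Num.max 0 (t - d / 2).
  have wt : w < t by rewrite gt_max tp /=; lra.
  have w0 : 0 <= w by rewrite le_max lexx.
  have wd : t - d / 2 <= w by rewrite le_max lexx orbT.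
  have wT : 0 <= w <= T by rewrite w0 /=; lra.
  have Pw : P w by apply: before; rewrite w0.
  have abw : `|w - t| = t - w by rewrite ltr0_norm ?opprB // subr_lt0.
  have [|_ s2] := step w wT; first by rewrite abw; lra.
  rewrite abw in s2; rewrite /P in Pw *.
  have : (t - w) * complex.Re (g t) <= (t - w) * B by rewrite ler_wpM2l // subr_ge0 ltW.
  nra.
rewrite ab in s1; rewrite /P in Pt *.
have : (u - t) * complex.Re (g t) <= (u - t) * B by rewrite ler_wpM2l // subr_ge0 ltW.
nra.
Qed.

(** [mvi_Re] in the directions [1], [-1], [i], [-i] bounds real and imaginary parts; adding the two
    bounds gives the factor 2. *)
Lemma mvi_normc T f g (B : R) : cdt T f g -> (forall t, 0 <= t <= T -> normc (g t) <= B) ->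
  forall t, 0 <= t <= T -> normc (f t - f 0) <= 2 * (B * t).
Proof.
move=> h hB t tT; apply: (le_trans (normc_le_ReIm _)).
have aux (c : C) : normc c = 1 -> complex.Re (c * f t) - complex.Re (c * f 0) <= B * t.
  move=> c1; apply: (mvi_Re (cdtZ c h)) tT => u uT.
  by apply: le_trans (hB u uT); apply: (le_trans (ler_norm _)); apply: (le_trans (normc_Re _));
    rewrite normcM c1 mul1r.
have a1 := aux 1 (@normc1 R); have a2 := aux (-1).
have a3 := aux 'i%C (@normc_i R); have a4 := aux (- 'i%C).
rewrite !normcN normc1 normc_i in a2 a4.
have {}a2 := a2 erefl; have {}a4 := a4 erefl.
move: a1 a2 a3 a4; case: (f t) => a b; case: (f 0) => c d /=.
rewrite !(mul0r, mul1r, oppr0, mulNr, sub0r, subr0, opprK) => a1 a2 a3 a4.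
by rewrite mulr2n mulrDl mul1r lerD // ler_norml; apply/andP; split; lra.
Qed.

Lemma cdt_cexp T (a : R) : cdt T (fun t => cexp (a * t)) (fun t => 'i%C * a%:C * cexp (a * t)).
Proof.
move=> t tT e e0.
have dRe := is_derive_trig 1 a t; have dIm := is_derive_trig (- 'i%C) a t.
have lip (F : R -> R) G : is_derive t (1 : R) F G -> exists2 d, 0 < d &
    forall u, `|u - t| < d -> `|F u - F t - (u - t) * G| <= e / 2 * `|u - t|.
  move=> dF; have ex : derivable F t 1 by case: dF.
  have lim : (fun h => h^-1 *: ((F \o shift t) (h *: (1 : R)) - F t)) @ 0^' --> G.
    by have [_ <-] := dF; exact: ex.
  have e2 : 0 < e / 2 by lra.
  have /cvgrPdist_le /(_ _ e2) := lim.
  rewrite near_withinE => /nbhs_ballP [d /= d0 hd]; exists d => // u ut.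
  have [->|un] := eqVneq u t; first by rewrite !subrr mul0r subr0 normr0 mulr0.
  have n0 : u - t != 0 by rewrite subr_eq0.
  have := hd (u - t); rewrite /ball /= sub0r normrN => /(_ ut n0).
  rewrite -[(u - t) *: 1]/((u - t) * 1) mulr1 subrK -[_ *: _]/(_ * _) distrC => hq.
  have -> : F u - F t - (u - t) * G = (u - t) * ((u - t)^-1 * (F u - F t) - G).
    by rewrite mulrBr mulVKf.
  by rewrite normrM mulrC ler_wpM2r.
have [d1 d10 h1] := lip _ _ dRe; have [d2 d20 h2] := lip _ _ dIm.
exists (Num.min d1 d2); first by rewrite lt_min d10.
move=> u uT; rewrite lt_min => /andP[/h1 u1 /h2 u2].
apply: (le_trans (normc_le_ReIm _)).
have -> : e * `|u - t| = e / 2 * `|u - t| + e / 2 * `|u - t| by field.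
pose rules := (@ReD R, @ImD R, @ReN R, @ImN R, @ReM R, @ImM R).
apply: lerD.
  move: u1; rewrite !rules /=; apply: le_trans; rewrite le_eqVlt; apply/orP; left.
  by apply/eqP; congr `|_|; ring.
move: u2; rewrite !rules /=; apply: le_trans; rewrite le_eqVlt; apply/orP; left.
by apply/eqP; congr `|_|; ring.
Qed.

End Evolution.

Lemma absz_eq1 (k : int) : `|k|%N = 1%N -> k = 1 \/ k = -1.
Proof. lia. Qed.

Lemma sub_cancel5 (V : comNzRingType) (a b c d e : V) : a - b + c + d = a + e + c + d - (b + e).
Proof. by ring. Qed.

(** * Bounds at a fixed time inside the bootstrap set *)

Section StaticEstimates.
Context {R : realType}.
Local Notation C := R[i].
Variables (delta0 : R) (chi : 'rV[R]_1 * R -> R) (chi2 : 'rV[R]_2 * R -> R).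
Hypotheses (hdelta0 : 0 < delta0 <= 10^-1).
Hypotheses (hchi : cutoff delta0 chi) (hchi2 : cutoff delta0 chi2).
Variables (alpha s0 r mu : R) (S : system R).
Hypotheses (halpha : 0 < alpha < 1) (hmu : 0 <= mu) (hs0 : mu + 10 <= s0) (hr : 0 < r).
Hypothesis (hS : admissible alpha s0 r mu S).
Variables (s theta : R).
Hypotheses (hs : 3 * s0 < s) (hth : 0 < theta) (hth1 : theta < 5^-1) (hth2 : theta * s <= s - 3 * s0).
Implicit Types (z v : fseq R) (k : int) (eps : R).

(* The set in which the bootstrap argument confines z(t). *)
Definition Qb eps z : Prop := [/\ normc (z 1) <= 2 * eps, normc (z (-1)) <= 2 * eps,
  Hb 0 (perp z) (eps `^ (3 - theta)), Hb s z (eps `^ (- theta)) & inball s0 r z].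

Lemma s0_ge10 : 10 <= s0. Proof. by move: hmu hs0; lra. Qed.

Lemma powR_eps_le eps (a b : R) : 0 < eps -> eps <= 1 -> b <= a -> eps `^ a <= eps `^ b.
Proof.
move=> e0 e1 ba; rewrite -[a](subrK b) powR_pD // ler_piMl ?powR_ge0 //.
have h0 : 0 <= a - b by rewrite subr_ge0.
by have := powR_mono h0 (ltW e0) e1; rewrite powR1.
Qed.

Lemma powR_eps_pow eps (a : R) n : 0 < eps -> eps <= 1 -> a <= n%:R -> eps ^+ n <= eps `^ a.
Proof. by move=> e0 e1 an; rewrite -powR_natr ?(ltW e0) //; exact: powR_eps_le. Qed.

(** Interpolation at the threshold [L = eps ^ (- (3 / s))], which balances the two terms: both get
    the exponent [3 - theta - 3 * s0 / s]. It is at least 2 exactly when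
    [theta * s <= s - 3 * s0]. *)
Lemma Qb_perp eps z : 0 < eps -> eps <= 1 -> Qb eps z -> Hb s0 (perp z) (2 * eps ^+ 2).
Proof.
move=> e0 e1 [_ _ h0 hz _]; have s10 := s0_ge10.
have sp : 0 < s by move: hs s10; lra.
have qs : 3 / s * s = 3 by rewrite divfK // gt_eqF.
pose L := eps `^ (- (3 / s)).
have L1 : 1 <= L.
  rewrite -(powRr0 eps); apply: powR_eps_le => //; rewrite oppr_le0 divr_ge0 // ltW //.
have := @Hb_interp _ s0 s L (perp z) _ _ _ _ L1 h0 (Hb_perp hz).
move=> H; have {}H := H _ _; apply: Hb_mono (H _ _); [|by lra|by move: hs s10; lra].
rewrite /L -!powRrM -!powR_pD //.
have e2 : eps ^+ 2 = eps `^ 2 by rewrite powR_natr // ltW.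
have f1 : eps `^ (- (3 / s) * s0 + (3 - theta)) <= eps ^+ 2.
  rewrite e2; apply: powR_eps_le => //.
  rewrite -(ler_pM2r sp).
  have -> : (- (3 / s) * s0 + (3 - theta)) * s = - (3 / s * s) * s0 + (3 - theta) * s by ring.
  by rewrite qs; move: hth2; lra.
have f2 : eps `^ (- (3 / s) * (s0 - s) + - theta) <= eps ^+ 2.
  rewrite e2; apply: powR_eps_le => //.
  rewrite -(ler_pM2r sp).
  have -> : (- (3 / s) * (s0 - s) + - theta) * s = - (3 / s * s) * (s0 - s) - theta * s by ring.
  by rewrite qs; move: hth2; lra.
by have := lerD f1 f2; lra.
Qed.

(** The two modes have bracket 1, so the Sobolev norm of z^top is at most [sqrt 8 * eps] whatever
    its order. *)
Lemma Qb_top eps z : 0 < eps -> Qb eps z -> Hb s0 (top z) (3 * eps).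
Proof.
move=> e0 [h1 h2 _ _ _]; split; first by rewrite mulr_ge0 // ltW.
pose F : seq int := [:: 1; -1].
apply: (@bsum_leB _ _ _ (\sum_(k <- F) jap k%:~R `^ (2 * s0) * normc (top z k) ^+ 2)).
  rewrite /F !big_cons big_nil /top /= addr0.
  have j1 : jap (1%:~R : R) = 1 by rewrite /jap normr1 maxEle lexx.
  have j2 : jap ((-1)%:~R : R) = 1 by rewrite rmorphN japN.
  rewrite j1 j2 powR1 !mul1r.
  have n1 := normc_ge0 (z 1); have n2 := normc_ge0 (z (-1)); nra.
apply: bsum_fin => // k; first exact: Hb_term_ge0.
rewrite !inE negb_or => /andP[k1 k2]; rewrite /top.
case: eqP => h; last by rewrite normc0 expr0n mulr0.
by exfalso; move: k1 k2; have [->|->] := absz_eq1 h.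
Qed.

(** The factor 10 is [2 * (3 + 2)], from [HbD], [Qb_top] and [Qb_perp] with [eps <= 1]. *)
Lemma Qb_s0 eps z : 0 < eps -> eps <= 1 -> Qb eps z -> Hb s0 z (10 * eps).
Proof.
move=> e0 e1 q; have ht := Qb_top e0 q; have hp := Qb_perp e0 e1 q.
apply: (Hb_ext (top_perp z)); apply: Hb_mono (HbD ht hp); nra.
Qed.

Lemma Qb_sob eps z : 0 < eps -> eps <= 1 -> Qb eps z ->
  [/\ 0 <= sob s0 z <= 10 * eps, 0 <= sob s0 (top z) <= 3 * eps,
      0 <= sob s0 (perp z) <= 2 * eps ^+ 2 & inH s z].
Proof.
move=> e0 e1 q; split; rewrite ?sob_ge0 /=.
- exact: sob_le (Qb_s0 e0 e1 q).
- exact: sob_le (Qb_top e0 q).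
- exact: sob_le (Qb_perp e0 e1 q).
- by case: q => _ _ _ h _; exact: Hb_inH h.
Qed.

Lemma s0_le_s : s0 <= s. Proof. by move: hs s0_ge10; lra. Qed.

Lemma sobE_add_le (x y : \bar R) (B : R) : (0 <= x)%E -> (0 <= y)%E -> (x + y <= B%:E)%E ->
  (x <= B%:E)%E /\ (y <= B%:E)%E.
Proof.
move=> x0 y0 h; split; apply: le_trans h; [exact: leeDl | exact: leeDr].
Qed.

Lemma Y5_bound s' : s0 <= s' -> s' <= s -> exists K e1 : R, [/\ 0 <= K, 0 < e1 &
  forall eps z M, 0 < eps < e1 -> Qb eps z -> Hb s' z M ->
    Hb s' (Y5top S z) (K * eps ^+ 4 * M) /\ Hb s' (Y5perp S z) (K * eps ^+ 4 * M)].
Proof.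
move=> s1 s2; case: hS => _ _ /(_ s' s1) [K [rs [K0 [/andP[rs0 _] hK]]]] _ _.
(* As [z] has norm at most [10 * eps], the threshold [rs / 10] places it in the ball where the
   quintic estimate holds. *)
exists (K * 10 ^+ 4), (Num.min 1 (rs / 10)).
split; [by rewrite mulr_ge0 ?exprn_ge0 // ltW | by rewrite lt_min ltr01 divr_gt0 |].
move=> eps z M /andP[e0]; rewrite lt_min => /andP[e1 e2] q hM.
have [/andP[b1 b2] _ _ _] := Qb_sob e0 (ltW e1) q.
have hz := Qb_s0 e0 (ltW e1) q.
have hzrs : (sobE s0 z <= rs%:E)%E.
  by apply: (le_trans (Hb_le hz)); rewrite lee_fin; move: e2; rewrite ltr_pdivlMr //; lra.
have h := hK z hzrs (Hb_inH hM).
have [h1 h2] := sobE_add_le (sobE_ge0 _ _) (sobE_ge0 _ _) h.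
have M0 := proj1 hM.
have B0 : 0 <= K * 10 ^+ 4 * eps ^+ 4 * M by rewrite !mulr_ge0 ?exprn_ge0 // ltW.
have bb : K * sob s0 z ^+ 4 * sob s' z <= K * 10 ^+ 4 * eps ^+ 4 * M.
  apply: ler_pM; rewrite ?sob_ge0 //; [by rewrite mulr_ge0 ?exprn_ge0 // ltW| |exact: sob_le hM].
  rewrite -mulrA; apply: ler_wpM2l; first exact: ltW.
  by rewrite -exprMn; apply: lerXn2r; rewrite ?nnegrE // (le_trans b1).
by split; apply/sobE_leP => //; [apply: (le_trans h1)|apply: (le_trans h2)]; rewrite lee_fin.
Qed.

(** [Y3top] is cubic in z^perp alone, hence [eps ^+ 6]. [Y3perp] has one factor of size [eps], one
    of size [eps ^+ 2], and one measured in the strong norm. *)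
Lemma Y3_bound s' : s0 <= s' -> s' <= s -> exists2 K : R, 0 <= K &
  forall eps z M, 0 < eps <= 1 -> Qb eps z -> Hb s' (perp z) M ->
    Hb s' (Y3top S z) (K * eps ^+ 6) /\ Hb s' (Y3perp S z) (K * eps ^+ 3 * M).
Proof.
move=> s1 s2; case: hS => _ /(_ s' s1) [K hK] _ _ _.
exists (`|K| * 10); first by rewrite mulr_ge0.
move=> eps z M /andP[e0 e1] q hM.
have [_ /andP[t1 t2] /andP[p1 p2] hz] := Qb_sob e0 e1 q.
have ib : inball s0 r z by case: q.
have hzs' : inH s' z by apply: Hb_inH (Hb_weak s2 (Hb_sob hz)).
have [h1 h2] := hK z ib hzs'.
have M0 := proj1 hM.
have e6 : (2 * eps ^+ 2) ^+ 3 = 8 * eps ^+ 6 by ring.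
split; apply/sobE_leP.
- by rewrite !mulr_ge0 ?exprn_ge0 // ltW.
- apply: (le_trans h1); rewrite lee_fin.
  apply: (@le_trans _ _ (`|K| * (2 * eps ^+ 2) ^+ 3)); last first.
    rewrite e6 -mulrA ler_wpM2l // ler_wpM2r ?exprn_ge0 // ?(ltW e0) //; lra.
  apply: (@le_trans _ _ (`|K| * sob s0 (perp z) ^+ 3)).
    by rewrite ler_wpM2r ?exprn_ge0 // ler_norm.
  by rewrite ler_wpM2l //; apply: lerXn2r; rewrite ?nnegrE // (le_trans p1).
- by rewrite !mulr_ge0 ?exprn_ge0 // ltW.
have w : (sobE s' (Y3perp S z) <= sobE (s' + 4) (Y3perp S z))%E.
  have [h|h] := ltP (sobE (s' + 4) (Y3perp S z)) +oo%E.
    rewrite (sobE_fin h); apply: Hb_le; apply: (Hb_weak _ (Hb_sob h)); lra.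
  by apply: le_trans h; exact: leey.
apply: (le_trans w); apply: (le_trans h2); rewrite lee_fin.
have q1 : 0 <= sob s0 (top z) + sob s0 (perp z) <= 5 * eps.
  by rewrite addr_ge0 //=; nra.
move/andP: q1 => [q1 q2].
have st : K * (sob s0 (top z) + sob s0 (perp z)) * sob s0 (perp z) * sob s' (perp z)
    <= `|K| * (sob s0 (top z) + sob s0 (perp z)) * sob s0 (perp z) * sob s' (perp z).
  rewrite -!mulrA; apply: ler_wpM2r; last exact: ler_norm.
  by rewrite !mulr_ge0 ?sob_ge0.
apply: (le_trans st).
apply: (@le_trans _ _ (`|K| * (5 * eps) * (2 * eps ^+ 2) * M)); last first.
  by apply: le_of_eq; ring.
apply: ler_pM; rewrite ?sob_ge0 //; last exact: sob_le hM.
  by rewrite !mulr_ge0 ?sob_ge0.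
apply: ler_pM; rewrite ?sob_ge0 //; first by rewrite !mulr_ge0.
by rewrite ler_wpM2l.
Qed.

(** The quintic term dominates, with size [eps ^+ 4 * eps] against [eps ^+ 6] for the cubic one. *)
Lemma top_forcing : exists K e1 : R, [/\ 0 <= K, 0 < e1 & forall eps z k, 0 < eps < e1 ->
  Qb eps z -> normc (Y3top S z k + Y5top S z k) <= K * eps ^+ 5].
Proof.
have s00 : s0 <= s0 by [].
have [K3 K30 h3] := Y3_bound s00 s0_le_s; have [K5 [e5 [K50 e50 h5]]] := Y5_bound s00 s0_le_s.
exists (K3 + K5 * 10), (Num.min 1 e5); split.
- by rewrite addr_ge0 ?mulr_ge0.
- by rewrite lt_min ltr01.
move=> eps z k /andP[e0]; rewrite lt_min => /andP[e1 e2] q.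
have [|a3 _] := h3 eps z _ _ q (Qb_perp e0 (ltW e1) q); first by rewrite e0 ltW.
have [|a5 _] := h5 eps z _ _ q (Qb_s0 e0 (ltW e1) q); first by rewrite e0.
have s_0 : 0 <= s0 by have := s0_ge10; lra.
have c3 := Hb_coef0 k s_0 a3; have c5 := Hb_coef0 k s_0 a5.
apply: (le_trans (le_normcD _ _)); apply: (le_trans (lerD c3 c5)).
have e65 : eps ^+ 6 <= eps ^+ 5 by rewrite exprS ler_piMl ?exprn_ge0 // ltW.
rewrite [X in _ <= X]mulrDl; apply: lerD; first exact: ler_wpM2l.
by apply: le_of_eq; ring.
Qed.

Definition iAS : qcoef R := fun s1 s2 j1 j2 xi => 'i%C * AS S s1 s2 j1 j2 xi.

Lemma OpBW_imE z v k : OpBW_im chi chi2 S z v k =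
  OpBW2 chi2 iAS z v k + OpBW chi (fun x xi => 'i%C * rS S z x xi) v k.
Proof. by []. Qed.

(* What drives z^perp in L^2 once the term quadratic in z^top, which conserves the norm, is removed. *)
Definition Gperp z k : C := OpBW_im chi chi2 S z (perp z) k - ttsum chi2 iAS z (perp z) k
  + Y3perp S z k + Y5perp S z k.

(** Count of powers, with [z] of size [eps] and z^perp of size [eps ^+ 2] in H^s0: [2 + 1 + 2] for
    the remaining quadratic interactions, [4 + 2] for the quartic symbol, [3 + 2] for [Y3perp] and
    [4 + 1] for [Y5perp]. *)
Lemma perp_forcing : exists K e1 : R, [/\ 0 <= K, 0 < e1 & forall eps z, 0 < eps < e1 ->
  Qb eps z -> Hb 0 (Gperp z) (K * eps ^+ 5)].
Proof.
have s00 : s0 <= s0 by []. have s10 := s0_ge10.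
have [K3 K30 h3] := Y3_bound s00 s0_le_s; have [K5 [e5 [K50 e50 h5]]] := Y5_bound s00 s0_le_s.
have [KA KA0 hA] := AS_bnd halpha hmu hS.
have hA' := Abnd_i hA.
have [|K1 K10 h1] := OpBW2_rest hdelta0 hchi2 hmu KA0 (s0 := s0); first by move: hs0; lra.
have [K2 K20 h2] := OpBW_crude hdelta0 hchi.
have [Kr Kr0 hr'] := rS_fcoef halpha hS.
exists (2 * (2 * (2 * (K1 * 40 + K2 * (Kr * 10 ^+ 4 * 2)) + K3 * 2) + K5 * 10)), (Num.min 1 e5).
have c1 : 0 <= 10 ^+ 4 :> R by rewrite exprn_ge0.
split.
- by rewrite !(mulr_ge0, addr_ge0).
- by rewrite lt_min ltr01.
move=> eps z /andP[e0]; rewrite lt_min => /andP[e1 e2] q; have e1' := ltW e1.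
have hp := Qb_perp e0 e1' q; have hz := Qb_s0 e0 e1' q.
have ib : inball s0 r z by case: q.
have [|_ a3] := h3 eps z _ _ q hp; first by rewrite e0 ltW.
have [|_ a5] := h5 eps z _ _ q hz; first by rewrite e0.
have [/andP[b1 b2] _ _ _] := Qb_sob e0 e1' q.
have s_0 : 0 <= s0 by lra.
have w1 : 1 <= s0 by lra. have w3 : 3 <= s0 by lra.
have a1 := h1 _ _ (perp z) _ _ _ hA' hz hp (Hb_weak w1 hp).
have [cR hR] := hr' z ib.
have a2 : Hb 0 (OpBW chi (fun x xi => 'i%C * rS S z x xi) (perp z)) (K2 * (Kr * (10 * eps) ^+ 4 * (2 * eps ^+ 2))).
  apply: h2 (Hb_weak w3 hp) => xi n; have [M hM] := cR xi.
  rewrite (fcoefZ 'i%C n hM) normcM normc_i mul1r; apply: (le_trans (hR xi n)).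
  rewrite ler_wpM2r // ?(ltW (jap_gt0 _)) // ler_wpM2l //.
  by apply: lerXn2r; rewrite ?nnegrE // (le_trans b1).
have b := HbD (HbD (HbD a1 a2) (Hb_weak s_0 a3)) (Hb_weak s_0 a5).
apply: (Hb_ext (u := fun k => OpBW2 chi2 iAS z (perp z) k - ttsum chi2 iAS z (perp z) k
  + OpBW chi (fun x xi => 'i%C * rS S z x xi) (perp z) k + Y3perp S z k + Y5perp S z k)).
  by move=> k; rewrite /Gperp OpBW_imE; ring.
apply: Hb_mono b.
have e65 : eps ^+ 6 <= eps ^+ 5 by rewrite exprS ler_piMl ?exprn_ge0 // ltW.
have -> : K1 * (2 * eps ^+ 2 * (10 * eps) * (2 * eps ^+ 2)) = K1 * 40 * eps ^+ 5 by ring.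
have -> : K2 * (Kr * (10 * eps) ^+ 4 * (2 * eps ^+ 2)) = K2 * (Kr * 10 ^+ 4 * 2) * eps ^+ 6 by ring.
have -> : K3 * eps ^+ 3 * (2 * eps ^+ 2) = K3 * 2 * eps ^+ 5 by ring.
have -> : K5 * eps ^+ 4 * (10 * eps) = K5 * 10 * eps ^+ 5 by ring.
have L0 : 0 <= K2 * (Kr * 10 ^+ 4 * 2) by rewrite !mulr_ge0.
have := ler_wpM2l L0 e65; lra.
Qed.

(** In H^s the solution only has size [eps ^ (- theta)], so it must come with three powers of [eps].
    In the change of cut-off the interactions with z^top alone carry just two, but they multiply the
    L^2 norm of z^perp, which is [eps ^ (3 - theta)]. *)
Lemma perp_remainder : exists K e1 : R, [/\ 0 <= K, 0 < e1 & forall eps z, 0 < eps < e1 ->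
  Qb eps z -> Hb s (fun k => OpBW_im chi chi2 S z (perp z) k + Y3perp S z k + Y5perp S z k
    - 'i%C * OpBW chi (msym S z) (perp z) k) (K * eps `^ (3 - theta))].
Proof.
have ss : s <= s by []. have s10 := s0_ge10.
have [K3 K30 h3] := Y3_bound s0_le_s ss; have [K5 [e5 [K50 e50 h5]]] := Y5_bound s0_le_s ss.
have [KA KA0 hA] := AS_bnd halpha hmu hS.
have hA' := Abnd_i hA.
have s_0 : 0 <= s by move: hs; lra.
have [|K1 K10 h1] := BW_remainder hdelta0 hchi hchi2 (s0 := s0) hmu KA0 _ s_0; first by move: hs0; lra.
have [Kr Kr0 hr'] := rS_fcoef halpha hS.
exists (2 * (2 * (K1 * 120 + K3) + K5)), (Num.min 1 e5); split.
- by rewrite !(mulr_ge0, addr_ge0).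
- by rewrite lt_min ltr01.
move=> eps z /andP[e0]; rewrite lt_min => /andP[e1 e2] q; have e1' := ltW e1.
have hp := Qb_perp e0 e1' q; have hz := Qb_s0 e0 e1' q.
case: (q) => _ _ hp0 hzs ib; have hps := Hb_perp hzs.
have [|_ a3] := h3 eps z _ _ q hps; first by rewrite e0 ltW.
have [|_ a5] := h5 eps z _ _ q hzs; first by rewrite e0.
have ua := aS_uapprox halpha hmu hs0 hS hz.
have a1 := h1 _ _ (perp z) _ _ _ _ _ hA' (uapprox_fapprox (uapproxZ 'i%C ua)) hz hp hps hp0.
have [cR _] := hr' z ib.
have cA xi : exists M, cbm (fun x => aS S z x xi) M by have [] := ua xi.
have cI (a : symbol R) : (forall xi, exists M, cbm (fun x => a x xi) M) ->
    forall xi, exists M, cbm (fun x => 'i%C * a x xi) M.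
  by move=> h xi; have [M hM] := h xi; exists (normc ('i%C : C) * M); exact: cbmZ.
have eM k : 'i%C * OpBW chi (msym S z) (perp z) k = OpBW chi (fun x xi => 'i%C * aS S z x xi) (perp z) k
     + OpBW chi (fun x xi => 'i%C * rS S z x xi) (perp z) k.
  have -> : msym S z = (fun x xi => aS S z x xi + rS S z x xi).
    by apply/funext => x; apply/funext => xi; rewrite msymE.
  rewrite (OpBWZ hdelta0 hchi 'i%C (perp z) k cA) (OpBWZ hdelta0 hchi 'i%C (perp z) k cR) -mulrDr.
  by rewrite (OpBWD hdelta0 hchi (perp z) k cA cR).
have b := HbD (HbD a1 a3) a5.
apply: (Hb_ext (u := fun k => OpBW2 chi2 iAS z (perp z) k
  - OpBW chi (fun x xi => 'i%C * aS S z x xi) (perp z) k + Y3perp S z k + Y5perp S z k)).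
  by move=> k; rewrite OpBW_imE eM; exact: sub_cancel5.
apply: Hb_mono b.
have ee n : eps ^+ n.+3 * eps `^ (- theta) <= eps `^ (3 - theta).
  rewrite -powR_natr ?(ltW e0) // -powR_pD //; apply: powR_eps_le => //.
  by rewrite lerD2r ler_nat.
have e2m : eps ^+ 2 * eps `^ (3 - theta) <= eps `^ (3 - theta).
  by rewrite ler_piMl ?powR_ge0 // exprn_ile1 // ltW.
have := ee 0%N; have := ee 1%N; move: e2m; set X := eps `^ (3 - theta); set Y := eps `^ (- theta).
have X0 : 0 <= X := powR_ge0 _ _.
move=> g1 g2 g3.
have -> : K1 * (2 * eps ^+ 2 * (10 * eps) * Y + (10 * eps) ^+ 2 * X) =
   K1 * (20 * (eps ^+ 3 * Y) + 100 * (eps ^+ 2 * X)) by ring.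
have q1 : K1 * (20 * (eps ^+ 3 * Y) + 100 * (eps ^+ 2 * X)) <= K1 * (120 * X) by apply: ler_wpM2l => //; lra.
have q2 : K3 * eps ^+ 3 * Y <= K3 * X by rewrite -mulrA; exact: ler_wpM2l.
have q3 : K5 * eps ^+ 4 * Y <= K5 * X by rewrite -mulrA; exact: ler_wpM2l.
lra.
Qed.

(** Taking the real part is harmless: m is real, so the imaginary part discarded here cancels the
    one discarded from [V4 * xi] ([msym_real]). *)
Definition bsym z : symbol R := fun x xi => (complex.Re (qeval (a2 S) z x xi + a4 S z x xi))%:C.

Lemma bsym_bound n : exists2 K : R, 0 < K & forall eps z, 0 < eps <= 1 -> Qb eps z ->
  (symnorm alpha 2 n (bsym z) <= (K * eps ^+ 2)%:E)%E.
Proof.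
case: hS => _ _ _ [g2 _ _ /(_ n) [K1 h1]] [_ _ g4 /(_ n) [K2 h2]].
exists (`|K1| * 100 + `|K2| * 10 ^+ 4 + 1).
  by rewrite ltr_wpDl // addr_ge0 ?mulr_ge0 ?exprn_ge0.
move=> eps z /andP[e0 e1] q; have ib : inball s0 r z by case: q.
have [/andP[b1 b2] _ _ _] := Qb_sob e0 e1 q.
have hz := Qb_s0 e0 e1 q.
have sq x : smooth (fun xi => complex.Re (qeval (a2 S) z x xi)).
  by apply: (@smooth_qeval _ (a2 S) z alpha mu s0 (10 * eps) x) => //; move: hs0; lra.
have s4 x : smooth (fun xi => complex.Re (a4 S z x xi)) by case: (g4 z ib) => h _; case: (h x).
apply: (le_trans (symnorm_ReD sq s4 (h1 z ib) (h2 z ib))); rewrite lee_fin.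
have p1 : sob s0 z ^+ 2 <= 100 * eps ^+ 2.
  have -> : 100 * eps ^+ 2 = (10 * eps) ^+ 2 by ring.
  by apply: lerXn2r; rewrite ?nnegrE // (le_trans b1).
have p2 : sob s0 z ^+ 4 <= 10 ^+ 4 * eps ^+ 2.
  apply: (@le_trans _ _ ((10 * eps) ^+ 4)).
    by apply: lerXn2r; rewrite ?nnegrE // (le_trans b1).
  rewrite exprMn ler_wpM2l ?exprn_ge0 // (exprD eps 2 2) ler_piMl ?exprn_ge0 ?exprn_ile1 // ltW //.
have q1 : K1 * sob s0 z ^+ 2 <= `|K1| * (100 * eps ^+ 2).
  apply: (@le_trans _ _ (`|K1| * sob s0 z ^+ 2)); last exact: ler_wpM2l.
  by rewrite ler_wpM2r ?sqr_ge0 // ler_norm.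
have q2 : K2 * sob s0 z ^+ 4 <= `|K2| * (10 ^+ 4 * eps ^+ 2).
  apply: (@le_trans _ _ (`|K2| * sob s0 z ^+ 4)); last exact: ler_wpM2l.
  by rewrite ler_wpM2r ?exprn_ge0 // ler_norm.
have := sqr_ge0 eps; lra.
Qed.

Lemma bsym_Gamma eps z : 0 < eps <= 1 -> Qb eps z -> Gamma alpha 2 (bsym z).
Proof.
move=> he q; have [e0 e1] := andP he; split=> [x|n]; last first.
  by have [K _ h] := bsym_bound n; apply: (le_lt_trans (h eps z he q)); rewrite ltry.
case: hS => _ _ _ [g2 _ _ _] [_ _ g4 _].
have ib : inball s0 r z by case: q.
have hz := Qb_s0 e0 e1 q.
have sq : smooth (fun xi => complex.Re (qeval (a2 S) z x xi)).
  by apply: (@smooth_qeval _ (a2 S) z alpha mu s0 (10 * eps) x) => //; move: hs0; lra.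
have s4 : smooth (fun xi => complex.Re (a4 S z x xi)) by case: (g4 z ib) => h _; case: (h x).
split; last exact: smooth_cst0.
rewrite (_ : (fun xi => _) = (fun xi => 1 * complex.Re (qeval (a2 S) z x xi) + 1 * complex.Re (a4 S z x xi))).
  exact: smooth_lin.
by apply/funext => xi; rewrite /bsym [LHS]/= ReD !mul1r.
Qed.

(** Additivity of [rsum] is reached through its characterization as an unordered limit; the two
    series differ by a family supported at 0. *)
Lemma rsum_modify0 (f f' : nat -> R) (w w' : nat -> R) B B' (a : R) : bsum w B -> bsum w' B' ->
  (forall n, `|f n| <= w n) -> (forall n, `|f' n| <= w' n) ->
  (forall n, f n = f' n + (if n == 0%N then a else 0)) -> rsum f = rsum f' + a.
Proof.
move=> hw hw' fw fw' e.
have h1 : has_csum (fun n => (f n)%:C : C) (csum (fun n => (f n)%:C)).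
  by apply: (has_csum_csum (B := B)); apply: bsum_le hw => n; rewrite normc_real.
have h2 : has_csum (fun n => (f' n)%:C : C) (csum (fun n => (f' n)%:C)).
  by apply: (has_csum_csum (B := B')); apply: bsum_le hw' => n; rewrite normc_real.
have h3 := @has_csum_fin R _ (fun n : nat => (if n == 0%N then a else 0)%:C : C) [:: 0%N] isT.
have {}h3 := h3 _; have h4 := has_csumD h2 (h3 _).
have -> : rsum f = complex.Re (csum (fun n => (f n)%:C : C)) by [].
rewrite (has_csum_unique h1 (S' := csum (fun n => (f' n)%:C : C) + a%:C)) ?ReD //.
have := h4; rewrite big_seq1 /=; move=> /(_ _)/= H.
rewrite (_ : (fun n => (f n)%:C) = (fun n => (f' n)%:C + (if n == 0%N then a else 0)%:C)); last first.
  by apply/funext => n; rewrite e rmorphD.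
by apply: H => i; rewrite inE => /negbTE ->.
Qed.

(** Only the mode [n = 0] involves z^top; there [w] stands for the predicted product and [D] for the
    error. All other modes are products of two coefficients of z^perp, of total size [eps ^+ 4]. *)
Lemma V_bound : exists2 K : R, 0 < K & forall eps z (w : C) (D : R), 0 < eps <= 1 -> Qb eps z ->
  normc (z 1 * (z (-1))^*%C - w) <= D ->
  (Winf 2 (fun x => (Vavg z x - 2 * complex.Re (w * cexp (2 * x)) + complex.Re (V4 S z x))%R%:C)
    <= (K * (D + eps ^+ 4))%:E)%E.
Proof.
have s10 := s0_ge10.
have [|Kv Kv0 hKv] := @vc_bsum R s0; first by lra.
case: hS => _ _ _ _ [_ [K4 h4] _ _].
exists (54 + 8 * Kv + `|K4| * 10 ^+ 4).
  by rewrite ltr_wpDr ?mulr_ge0 ?exprn_ge0 // addr_gt0 // mulr_gt0.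
move=> eps z w D /andP[e0 e1] q hD.
have hp := Qb_perp e0 e1 q; have hz := Qb_s0 e0 e1 q; have ib : inball s0 r z by case: q.
have D0 : 0 <= D := le_trans (normc_ge0 _) hD.
pose c' (n : nat) : C := if n == 0%N then vc z 0 - w else vc z n.
pose nn (n : nat) : R := (2 * n.+1)%:R.
(* Here 27 is [(1 + 2) ^ 3], the derivative weight at frequency 2. *)
pose W (n : nat) : R := (if n == 0%N then 27 * D else 0) + normc (vc (perp z) n) * (1 + `|nn n|) ^+ 3.
have hW : bsum W (27 * D + Kv * (2 * eps ^+ 2) ^+ 2).
  apply: bsumD (hKv _ _ hp).
  have := @bsum_fin R _ (fun n : nat => if n == 0%N then 27 * D else 0) [:: 0%N].
  rewrite big_seq1; apply=> //.
    by move=> i; case: ifP => // _; rewrite mulr_ge0.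
  by move=> i; rewrite inE => /negbTE ->.
have hc' n : normc (c' n) * (1 + `|nn n|) ^+ 3 <= W n.
  rewrite /c' /W; case: eqP => [->|/eqP n0].
    rewrite -[X in X <= _]addr0; apply: lerD; last by rewrite mulr_ge0 ?normc_ge0 ?exprn_ge0 ?addr_ge0.
    rewrite mulrC; apply: ler_pM; rewrite ?normc_ge0 ?exprn_ge0 ?addr_ge0 //.
    by rewrite /nn muln1 ger0_norm //; lra.
  rewrite add0r (_ : vc (perp z) n = vc z n) //.
  by rewrite /vc /perp /= !eqSS (negbTE n0).
pose T x := trigsum c' nn 0 x.
have wT : winf 2 (fun x => (T x)%:C) (27 * D + Kv * (2 * eps ^+ 2) ^+ 2).
  by apply: (winf_trigsum hW hc') => n; exists (2 * n.+1)%:Z; rewrite -pmulrn.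
have eT x : Vavg z x - 2 * complex.Re (w * cexp (2 * x)) = T x + T x.
  have := @rsum_modify0 (fun n => complex.Re (vc z n * cexp (nn n * x)))
     (fun n => complex.Re (c' n * cexp (nn n * x)))
     (fun n => normc (vc z n) * (1 + `|nn n|) ^+ 3) W _ _ (complex.Re (w * cexp (2 * x)))
     (hKv _ _ hz) hW.
  move=> H; rewrite VavgE H.
  - by rewrite /T /trigsum; ring.
  - move=> n; apply: (le_trans (normc_trig _ _ _)).
    by rewrite ler_peMr ?normc_ge0 // exprn_ege1 // lerDl.
  - move=> n; apply: (le_trans (normc_trig _ _ _)); apply: le_trans (hc' n).
    by rewrite ler_peMr ?normc_ge0 // exprn_ege1 // lerDl.
  - move=> n; rewrite /c'; case: eqP => [->|_]; last by rewrite addr0.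
    by rewrite /nn muln1 mulrBl ReD ReN subrK.
have w4 := h4 z ib.
(* The factor 2 in [Vavg] is written as [T + T], so that the sum rule applies. *)
have wTT := Winf_le (winf_ReD wT wT).
have := Winf_ReD wTT w4; rewrite (_ : (fun x => _) =
   (fun x => (Vavg z x - 2 * complex.Re (w * cexp (2 * x)) + complex.Re (V4 S z x))%:C)); last first.
  by apply/funext => x; rewrite eT !ReD.
move=> h; apply: (le_trans h); rewrite lee_fin.
have [/andP[b1 b2] _ _ _] := Qb_sob e0 e1 q.
have q2 : K4 * sob s0 z ^+ 4 <= `|K4| * 10 ^+ 4 * eps ^+ 4.
  rewrite -mulrA -exprMn; apply: (@le_trans _ _ (`|K4| * sob s0 z ^+ 4)).
    by rewrite ler_wpM2r ?exprn_ge0 // ler_norm.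
  by rewrite ler_wpM2l //; apply: lerXn2r; rewrite ?nnegrE // (le_trans b1).
have -> : (2 * eps ^+ 2) ^+ 2 = 4 * eps ^+ 4 by ring.
have e4 : 0 <= eps ^+ 4 by rewrite exprn_ge0 // ltW.
have t1 : 0 <= Kv * D by rewrite mulr_ge0 // ltW.
have t2 : 0 <= `|K4| * 10 ^+ 4 * D by rewrite !mulr_ge0 // exprn_ge0.
lra.
Qed.

End StaticEstimates.

(** * Energy identities along a trajectory and limits of boxes *)

Section TrajectoryTools.
Context {R : realType}.
Local Notation C := R[i].
Implicit Types (u : fseq R) (f g y : R -> C).

Lemma Hb0_box u M N : Hb 0 u M -> \sum_(k <- zbox N) normc (u k) ^+ 2 <= M ^+ 2.
Proof.
move=> [_ h]; have := h _ (uniq_zbox N); rewrite (eq_bigr (fun k => normc (u k) ^+ 2)) // => k _.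
by rewrite mulr0 powRr0 mul1r.
Qed.

Lemma box_Hb0 u M : 0 <= M -> (forall N, \sum_(k <- zbox N) normc (u k) ^+ 2 <= M ^+ 2) -> Hb 0 u M.
Proof.
move=> M0 h; split=> // F uF.
rewrite (eq_bigr (fun k => normc (u k) ^+ 2)); last by move=> k _; rewrite mulr0 powRr0 mul1r.
apply: le_trans (h (\max_(k <- F) `|k|%N)).
apply: ler_sum_subset => //; [by move=> k; exact: sqr_ge0|exact: uniq_zbox|].
by move=> k kF; rewrite mem_zbox; exact: leq_bigmax_seq.
Qed.

Lemma imagE : 'i%R = 'i%C :> C. Proof. by []. Qed.

Lemma Re_conjM (x : C) : complex.Re (x^*%C * x) = normc x ^+ 2.
Proof. by rewrite sqr_normc_ReIm; case: x => a b /=; ring. Qed.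

Lemma cdt_eq T f f' g g' : f =1 f' -> g =1 g' -> cdt T f g -> cdt T f' g'.
Proof. by move=> /funext -> /funext ->. Qed.

Lemma cdt_restr T t f g : t <= T -> cdt T f g -> cdt t f g.
Proof.
move=> tT h u /andP[u0 ut] e e0.
have uT : 0 <= u <= T by rewrite u0 (le_trans ut).
have [d d0 hd] := h u uT e e0.
by exists d => // w /andP[w0 wt]; apply: hd; rewrite w0 (le_trans wt).
Qed.

(** Passage to the limit from the left; it supplies the closedness half of the bootstrap. *)
Lemma cdt_closed T f g t B : cdt T f g -> 0 <= t <= T -> 0 < t ->
  (forall w : R, 0 <= w < t -> complex.Re (f w) <= B) -> complex.Re (f t) <= B.
Proof.
move=> h tT t0 hB; apply/ler_addgt0Pr => e e0; have [d d0 hd] := cdt_cont h tT e0.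
pose u := Num.max 0 (t - d / 2).
have ut : u < t by rewrite gt_max t0 /=; lra.
have u0 : 0 <= u by rewrite le_max lexx.
have ud : t - d / 2 <= u by rewrite le_max lexx orbT.
have uT : 0 <= u <= T by rewrite u0 /=; case/andP: tT => _; lra.
have ab : `|u - t| < d by rewrite ltr0_norm ?subr_lt0 //; lra.
have := le_trans (normc_Re _) (hd u uT ab); rewrite ReD ReN ler_norml => /andP[a _].
have Bu : complex.Re (f u) <= B by apply: hB; rewrite u0.
lra.
Qed.

(** The term [- i a f] with real [a] only rotates [f], so it drops out of the derivative of the
    squared modulus. *)
Lemma cdt_sqnorm T f (a : R -> R) y : cdt T f (fun t => - 'i%C * (a t)%:C * f t + y t) ->
  cdt T (fun t => (f t)^*%C * f t) (fun t => (y t)^*%C * f t + (f t)^*%C * y t).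
Proof.
move=> h; apply: cdt_eq (cdtM (cdt_conj h) h) => // t.
by case: (f t) => b c; case: (y t) => d e; apply: complex_eqP; rewrite /=; ring.
Qed.

Lemma cdt_sqnorm_drift T f (a : R -> R) y M B : cdt T f (fun t => - 'i%C * (a t)%:C * f t + y t) ->
  (forall t, 0 <= t <= T -> normc (f t) <= M) -> (forall t, 0 <= t <= T -> normc (y t) <= B) ->
  forall t, 0 <= t <= T -> `|normc (f t) ^+ 2 - normc (f 0) ^+ 2| <= 4 * M * B * t.
Proof.
move=> h hM hB t tT; have := mvi_normc (B := 2 * M * B) (cdt_sqnorm h) _ tT.
move=> H; apply: le_trans (_ : _ <= 2 * (2 * M * B * t)) _; last by apply: le_of_eq; ring.
rewrite -!Re_conjM -ReN -ReD; apply: (le_trans (normc_Re _)); apply: H => u uT.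
apply: (le_trans (le_normcD _ _)); rewrite !normcM !normc_conj.
have := ler_pM (normc_ge0 _) (normc_ge0 _) (hM u uT) (hB u uT); lra.
Qed.

(** Young's inequality is applied to [g] only; the contribution of [x] is kept exact because its sum
    over the modes cancels up to a boundary term ([tt_energy]). *)
Lemma young_forcing (a : R) (v x g : C) : 0 < a ->
  complex.Re ((x + g)^*%C * v + v^*%C * (x + g))
  <= 2 * complex.Re (v^*%C * x) + (a * normc v ^+ 2 + a^-1 * normc g ^+ 2).
Proof.
move=> a0.
have -> : complex.Re ((x + g)^*%C * v + v^*%C * (x + g)) =
    2 * complex.Re (v^*%C * x) + 2 * complex.Re (v^*%C * g).
  by case: v => v1 v2; case: x => x1 x2; case: g => g1 g2 /=; ring.
apply: lerD => //.
have h1 : complex.Re (v^*%C * g) <= normc v * normc g.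
  by rewrite -(normc_conj v) -normcM; apply: le_trans (normc_Re _); exact: ler_norm.
have h2 : 0 <= a^-1 * (a * normc v - normc g) ^+ 2 by rewrite mulr_ge0 ?sqr_ge0 // invr_ge0 ltW.
have h3 : a^-1 * (a * normc v - normc g) ^+ 2 =
    a * normc v ^+ 2 + a^-1 * normc g ^+ 2 - 2 * (normc v * normc g).
  by field; rewrite gt_eqF.
lra.
Qed.

(** Enlarging the box can only increase the sum, so for a fixed [N] the error [c / (N + 1)] may be
    replaced by an arbitrarily small one. *)
Lemma box_limit u B c : 0 <= c -> (forall N, \sum_(k <- zbox N) normc (u k) ^+ 2 <= B + c / N.+1%:R) ->
  forall N, \sum_(k <- zbox N) normc (u k) ^+ 2 <= B.
Proof.
move=> c0 h N; apply/ler_addgt0Pr => e e0.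
pose N' := maxn N (Num.bound (c / e)).
apply: (@le_trans _ _ (\sum_(k <- zbox N') normc (u k) ^+ 2)).
  apply: ler_sum_subset; [by move=> k; exact: sqr_ge0 | exact: uniq_zbox | exact: uniq_zbox |].
  by move=> k; rewrite !mem_zbox => /leq_trans; apply; rewrite leq_maxl.
apply: (le_trans (h N')); rewrite lerD2l ler_pdivrMr ?ltr0Sn //.
rewrite mulrC -ler_pdivrMr //; apply: le_trans (ltW (archi_boundP _)) _; first by rewrite divr_ge0 // ltW.
by rewrite ler_nat; apply: leq_trans (leq_maxr N _) _; exact: leqnSn.
Qed.

Lemma perp_diff u v k : perp (fun k => u k - v k) k = perp u k - perp v k :> C.
Proof. by rewrite /perp; case: ifP; rewrite ?subrr. Qed.

End TrajectoryTools.

(** * Bootstrap argument, amplitudes and relative phase of the modes 1 and -1 *)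

Section Bootstrap.
Context {R : realType}.
Local Notation C := R[i].
Variables (chi : 'rV[R]_1 * R -> R) (chi2 : 'rV[R]_2 * R -> R).
Variables (alpha s0 r : R) (S : system R) (s theta : R).
Hypotheses (hs10 : 10 <= s0) (hs : 3 * s0 < s).
(* p will be eps^(-theta/4), which absorbs the logarithm in the life span. *)
Variables (Ct Kg Ke eps T L p : R) (z : R -> fseq R).
Local Notation q := (eps `^ (- theta)).
Local Notation Q := (Qb s0 r s theta eps).
Hypotheses (e0 : 0 < eps) (e1 : eps <= 1) (Ct0 : 0 <= Ct) (Kg0 : 0 <= Kg) (Ke0 : 0 <= Ke) (L0 : 0 <= L).
Hypothesis (htop : forall w k, Q w -> normc (Y3top S w k + Y5top S w k) <= Ct * eps ^+ 5).
Hypothesis (hperp : forall w, Q w -> Hb 0 (Gperp chi chi2 S w) (Kg * eps ^+ 5)).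
Hypothesis (hen : forall w v M, inball s0 r w -> Hb 2 v M -> forall N,
  `|\sum_(k <- zbox N) complex.Re ((v k)^*%C * ttsum chi2 (iAS S) w v k)| <= Ke * M ^+ 2 / N.+1%:R).
Hypothesis (hz : long_time_controlled alpha s0 r chi chi2 S s theta T eps z).
(** Role of the smallness conditions: [c1] controls the amplitudes of the modes 1 and -1, [c2] and
    [c3] the L^2 norm of z^perp, [c4] gives the bound without constant in [amplitude_defect], and
    [c5] absorbs the two factors [p] met in [phase_locking]. *)
Hypotheses (p1 : 1 <= p) (hT : T * eps ^+ 2 <= L * p) (c1 : 8 * Ct * L * p * eps <= 1).
Hypotheses (c2 : 32 * L * (1 + Kg ^+ 2) * p <= q) (c3 : 32 <= q).
Hypotheses (c4 : (16 * L + 1) * Ct * p <= q) (c5 : p ^+ 2 <= q).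

Let y k t : C := Y3top S (z t) k + Y5top S (z t) k.

Lemma T_gt0 : 0 < T. Proof. by case: hz. Qed.

Lemma powR_3theta : eps `^ (3 - theta) = eps ^+ 3 * q.
Proof. by rewrite powR_pD // powR_natr // ltW. Qed.

Lemma s1_ge0 : 0 <= s - 1. Proof. by move: hs hs10; lra. Qed.

Lemma cdt_z1 : cdt T (fun t => z t 1) (fun t => - 'i%C * (1 + normc (z t 1) ^+ 2)%:C * z t 1 + y 1 t).
Proof.
case: hz => _ _ [_ _ h _] _ _.
apply: cdt_eq (is_cdt_cdt (is_dt_cdt 1 s1_ge0 h)) => // t.
rewrite /absD /Y3Lambda /top /= normr1 powR1 rmorphD /y -!imagE; ring.
Qed.

Lemma cdt_zm1 : cdt T (fun t => z t (-1)) (fun t => - 'i%C * (1 - normc (z t (-1)) ^+ 2)%:C * z t (-1) + y (-1) t).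
Proof.
case: hz => _ _ [_ _ h _] _ _.
apply: cdt_eq (is_cdt_cdt (is_dt_cdt (-1) s1_ge0 h)) => // t.
rewrite /absD /Y3Lambda /top /= normrN1 powR1 rmorphB /y -!imagE; ring.
Qed.

Lemma cdt_perp k : cdt T (fun t => perp (z t) k) (fun t => - 'i%C * (`|k%:~R| `^ alpha)%:C * perp (z t) k
  + (ttsum chi2 (iAS S) (z t) (perp (z t)) k + Gperp chi chi2 S (z t) k)).
Proof.
case: hz => _ _ [_ _ _ h] _ _.
apply: cdt_eq (is_cdt_cdt (is_dt_cdt k s1_ge0 h)) => // t.
rewrite /absD /Gperp -!imagE; ring.
Qed.

(** The squared moduli change at a rate of size [eps * eps ^+ 5], and a time of at most
    [L * p / eps ^+ 2] turns this into [p * eps ^+ 4]. *)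
Lemma drift t : 0 <= t <= T -> (forall u, 0 <= u <= t -> Q (z u)) ->
  `|normc (z t 1) ^+ 2 - normc (z 0 1) ^+ 2| <= 8 * Ct * L * p * eps ^+ 4 /\
  `|normc (z t (-1)) ^+ 2 - normc (z 0 (-1)) ^+ 2| <= 8 * Ct * L * p * eps ^+ 4.
Proof.
move=> /andP[t0 tT] hQ; have tt : 0 <= t <= t by rewrite t0 lexx.
have bd : 4 * (2 * eps) * (Ct * eps ^+ 5) * t <= 8 * Ct * L * p * eps ^+ 4.
  have h0 : 0 <= 8 * Ct * eps ^+ 4 by rewrite !mulr_ge0 ?exprn_ge0 // ltW.
  have tT2 : t * eps ^+ 2 <= L * p by apply: le_trans hT; rewrite ler_wpM2r // sqr_ge0.
  have := ler_wpM2l h0 tT2.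
  rewrite (_ : 8 * Ct * eps ^+ 4 * (t * eps ^+ 2) = 4 * (2 * eps) * (Ct * eps ^+ 5) * t); last by ring.
  by rewrite (_ : 8 * Ct * eps ^+ 4 * (L * p) = 8 * Ct * L * p * eps ^+ 4) //; ring.
split; apply: le_trans bd.
- apply: (cdt_sqnorm_drift (cdt_restr tT cdt_z1)) tt => u /hQ q; first by case: q.
  exact: htop.
- apply: (cdt_sqnorm_drift (cdt_restr tT cdt_zm1)) tt => u /hQ q; first by case: q.
  exact: htop.
Qed.

Let E N t : C := \sum_(k <- zbox N) (perp (z t) k)^*%C * perp (z t) k.

Lemma Re_E N t : complex.Re (E N t) = \sum_(k <- zbox N) normc (perp (z t) k) ^+ 2.
Proof. by rewrite Re_sum; apply: eq_bigr => k _; exact: Re_conjM. Qed.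

Let F k t : C := ttsum chi2 (iAS S) (z t) (perp (z t)) k + Gperp chi chi2 S (z t) k.

Lemma cdt_E N : cdt T (E N) (fun t => \sum_(k <- zbox N)
  ((F k t)^*%C * perp (z t) k + (perp (z t) k)^*%C * F k t)).
Proof. by apply: cdt_sum => k; apply: cdt_sqnorm (cdt_perp k). Qed.

(* The weight eps^2 / q in Young's inequality balances the two contributions at eps^8 q. *)
Lemma energy_rate N t : Q (z t) -> complex.Re (\sum_(k <- zbox N)
  ((F k t)^*%C * perp (z t) k + (perp (z t) k)^*%C * F k t))
  <= (1 + Kg ^+ 2) * eps ^+ 8 * q + 2 * Ke * q ^+ 2 / N.+1%:R.
Proof.
move=> Qt; have q0 : 0 < q by rewrite powR_gt0.
have hG := hperp Qt; case: Qt => _ _ h0 hsz ib; have hps := Hb_perp hsz.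
have w2 : 2 <= s by move: hs hs10; lra.
have := hen ib (Hb_weak w2 hps) N; have b1 := Hb0_box N h0; have b2 := Hb0_box N hG.
rewrite powR_3theta in b1.
set v := perp (z t) in b1 *; set G := Gperp chi chi2 S (z t) in b2.
set X := \sum_(k <- zbox N) complex.Re _ => hX.
have a0 : 0 < eps ^+ 2 / q by rewrite divr_gt0 // exprn_gt0.
rewrite Re_sum.
apply: (@le_trans _ _ (2 * X + (eps ^+ 2 / q * \sum_(k <- zbox N) normc (v k) ^+ 2
     + (eps ^+ 2 / q)^-1 * \sum_(k <- zbox N) normc (G k) ^+ 2))).
  rewrite /X !mulr_sumr -!big_split /=; apply: ler_sum => k _; exact: young_forcing.
have h1 := ler_wpM2l (ltW a0) b1.
have h2 := ler_wpM2l (_ : 0 <= (eps ^+ 2 / q)^-1) b2.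
have {}h2 := h2 _; rewrite invr_ge0 (ltW a0) in h2; have {}h2 := h2 isT.
have E1 : eps ^+ 2 / q * (eps ^+ 3 * q) ^+ 2 = eps ^+ 8 * q by field; rewrite gt_eqF.
have E2 : (eps ^+ 2 / q)^-1 * (Kg * eps ^+ 5) ^+ 2 = Kg ^+ 2 * eps ^+ 8 * q.
  by field; rewrite !gt_eqF.
rewrite E1 in h1; rewrite E2 in h2.
have hX2 : 2 * X <= 2 * Ke * q ^+ 2 / N.+1%:R.
  have := le_trans (ler_norm X) hX; rewrite -!mulrA; move=> ?; exact: ler_wpM2l.
have -> : (1 + Kg ^+ 2) * eps ^+ 8 * q = eps ^+ 8 * q + Kg ^+ 2 * eps ^+ 8 * q by ring.
by rewrite addrC lerD // lerD.
Qed.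

Lemma init_top : normc (z 0 1) ^+ 2 <= eps ^+ 2 /\ normc (z 0 (-1)) ^+ 2 <= eps ^+ 2.
Proof.
case: hz => _ _ _ [h _] _.
have a1 := sobE_coef 1 (lexx 0) (ltW e0) h; have a2 := sobE_coef (-1) (lexx 0) (ltW e0) h.
by split; apply: lerXn2r; rewrite ?nnegrE ?normc_ge0 // ltW.
Qed.

Lemma init_perp : Hb 0 (perp (z 0)) (eps ^+ 3).
Proof. by case: hz => _ _ _ [_ h] _; apply/sobE_leP => //; rewrite exprn_ge0 // ltW. Qed.

(** The square of the target, [eps ^+ 6 * q ^+ 2 / 16], is shared equally: [c2] gives one half to
    the accumulated forcing and [c3] the other half to the initial datum. The denominator 4 leaves
    room for one use of [HbD] in [bootstrap]. *)
Lemma improve_perp t : 0 <= t <= T -> (forall u, 0 <= u <= t -> Q (z u)) ->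
  Hb 0 (perp (z t)) (eps `^ (3 - theta) / 4).
Proof.
move=> /andP[t0 tT] hQ; have q0 : 0 < q by rewrite powR_gt0.
have e30 : 0 <= eps ^+ 3 by rewrite exprn_ge0 // ltW.
apply: box_Hb0; first by rewrite divr_ge0 ?powR_ge0.
have cc : 0 <= 2 * Ke * q ^+ 2 * T 
  by apply: mulr_ge0 (ltW T_gt0); apply: mulr_ge0 (sqr_ge0 _); apply: mulr_ge0.
(* The boundary term of the energy on a box is of size [1 / (N + 1)]; the factors [q] and [T] in its
   constant are fixed while the box grows. *)
apply: (box_limit cc) => N.
have tt : 0 <= t <= t by rewrite t0 lexx.
have := mvi_Re (cdt_restr tT (cdt_E N)) (fun u hu => energy_rate N (hQ u hu)) tt.
rewrite !Re_E; have := Hb0_box N init_perp.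
set A := \sum_(k <- zbox N) normc (perp (z t) k) ^+ 2.
set B := \sum_(k <- zbox N) normc (perp (z 0) k) ^+ 2 => hB.
set rate := (1 + Kg ^+ 2) * eps ^+ 8 * q + 2 * Ke * q ^+ 2 / N.+1%:R => hA.
have rate0 : 0 <= rate by rewrite addr_ge0 // ?divr_ge0 // !mulr_ge0 ?exprn_ge0 ?addr_ge0 ?sqr_ge0 ?(ltW q0) ?(ltW e0).
have hA2 := le_trans hA (ler_wpM2l rate0 tT).
have E1 : rate * T = (1 + Kg ^+ 2) * q * eps ^+ 6 * (T * eps ^+ 2) + 2 * Ke * q ^+ 2 * T / N.+1%:R.
  by rewrite /rate; field; rewrite addrC natr1 pnatr_eq0.
have w0 : 0 <= (1 + Kg ^+ 2) * q * eps ^+ 6.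
  by rewrite !mulr_ge0 ?exprn_ge0 ?addr_ge0 ?sqr_ge0 ?(ltW q0) ?(ltW e0).
have h1 := ler_wpM2l w0 hT.
have w1 : 0 <= q * eps ^+ 6 by rewrite mulr_ge0 ?exprn_ge0 ?(ltW q0) ?(ltW e0).
have h2 := ler_wpM2l w1 c2; have h3 := ler_wpM2l w1 c3.
have E2 : (1 + Kg ^+ 2) * q * eps ^+ 6 * (L * p) = q * eps ^+ 6 * (32 * L * (1 + Kg ^+ 2) * p) / 32 by field.
have E3 : (eps ^+ 3 * q / 4) ^+ 2 = q * eps ^+ 6 * q / 16 by field.
have E4 : (eps ^+ 3) ^+ 2 = eps ^+ 6 by ring.
have h4 : eps ^+ 6 <= q * eps ^+ 6 by rewrite ler_peMl ?exprn_ge0 ?(ltW e0) //; move: c3; lra.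
rewrite powR_3theta E3; rewrite E4 in hB; rewrite E1 in hA2; rewrite E2 in h1.
move: hA2 h1 h2 h3 h4 hB w1; set W := q * eps ^+ 6; set Z := 2 * Ke * q ^+ 2 * T / N.+1%:R.
move: (W * (32 * L * (1 + Kg ^+ 2) * p)) (W * q) (eps ^+ 6) => X1 X2 X3; lra.
Qed.

(** By [c1] the drift is at most [eps ^+ 2], which leaves a margin below the value [4 * eps ^+ 2]
    allowed by [Qb]. *)
Lemma improve_top t : 0 <= t <= T -> (forall u, 0 <= u <= t -> Q (z u)) ->
  normc (z t 1) ^+ 2 <= 2 * eps ^+ 2 /\ normc (z t (-1)) ^+ 2 <= 2 * eps ^+ 2.
Proof.
move=> tT hQ; have [d1 d2] := drift tT hQ; have [i1 i2] := init_top.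
have b : 8 * Ct * L * p * eps ^+ 4 <= eps ^+ 2.
  have -> : 8 * Ct * L * p * eps ^+ 4 = (8 * Ct * L * p * eps) * eps ^+ 3 by ring.
  apply: (@le_trans _ _ (eps ^+ 3)).
    by rewrite ler_piMl ?exprn_ge0 // ltW.
  by rewrite exprS ler_piMl ?exprn_ge0 // ltW.
have := ler_norm (normc (z t 1) ^+ 2 - normc (z 0 1) ^+ 2).
have := ler_norm (normc (z t (-1)) ^+ 2 - normc (z 0 (-1)) ^+ 2).
by split; lra.
Qed.

Lemma sqr_le_2eps (x : R) : 0 <= x -> x ^+ 2 <= 4 * eps ^+ 2 -> x <= 2 * eps.
Proof.
move=> x0 h; rewrite -(ler_pXn2r (n := 2)) ?nnegrE ?mulr_ge0 // ?(ltW e0) //.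
by rewrite exprMn -natrX.
Qed.

Lemma Q_intro t : 0 <= t <= T -> normc (z t 1) ^+ 2 <= 4 * eps ^+ 2 ->
  normc (z t (-1)) ^+ 2 <= 4 * eps ^+ 2 -> Hb 0 (perp (z t)) (eps `^ (3 - theta)) -> Q (z t).
Proof.
move=> tT h1 h2 h3; case: hz => _ _ [ib _ _ _] _ hA; split => //.
- by apply: sqr_le_2eps => //; exact: normc_ge0.
- by apply: sqr_le_2eps => //; exact: normc_ge0.
- by apply/sobE_leP; [exact: powR_ge0 | exact: hA].
- by case: (ib t tT).
Qed.

(** The bounds in [Qb] on the modes 1 and -1 and on z^perp in L^2 pass to limits from the left, and
    their improved versions are strict, so continuity in time extends them a little further. The H^s
    bound is assumed on the whole interval. *)
Lemma bootstrap t : 0 <= t <= T -> Q (z t).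
Proof.
have q0 : 0 < q by rewrite powR_gt0.
have M0 : 0 < eps `^ (3 - theta) by rewrite powR_gt0.
have e20 : 0 < eps ^+ 2 by rewrite exprn_gt0.
apply: (@real_induction _ T (fun t => Q (z t))) => {}t tT before.
have Qt : Q (z t).
  (* At time 0 there is no earlier time to pass to the limit from, and the initial data are used
     directly. *)
  have [t00|tn] := eqVneq t 0.
    have [i1 i2] := init_top; rewrite t00 in tT *; apply: Q_intro => //; [lra | lra |].
    apply: Hb_mono init_perp; rewrite powR_3theta ler_peMr ?exprn_ge0 // ?(ltW e0) //.
    by move: c3; lra.
  have tp : 0 < t by rewrite lt_def tn; case/andP: tT.
  apply: Q_intro => //.
  - rewrite -Re_conjM; apply: (cdt_closed (cdt_sqnorm cdt_z1) tT tp) => u /before [h _ _ _ _].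
    have := ler_pM (normc_ge0 _) (normc_ge0 _) h h; rewrite Re_conjM -!expr2; lra.
  - rewrite -Re_conjM; apply: (cdt_closed (cdt_sqnorm cdt_zm1) tT tp) => u /before [_ h _ _ _].
    have := ler_pM (normc_ge0 _) (normc_ge0 _) h h; rewrite Re_conjM -!expr2; lra.
  - apply: box_Hb0 => [|N]; first exact: ltW.
    rewrite -Re_E; apply: (cdt_closed (cdt_E N) tT tp) => u /before [_ _ h _ _].
    by rewrite Re_E; exact: Hb0_box.
split=> // tT'.
have hQ u : 0 <= u <= t -> Q (z u).
  move=> /andP[u0 ut]; have [->//|un] := eqVneq u t.
  by apply: before; rewrite u0 lt_def eq_sym un.
have [i1 i2] := improve_top tT hQ; have i3 := improve_perp tT hQ.
have [d1 d10 h1] := cdt_cont (cdt_sqnorm cdt_z1) tT e20.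
have [d2 d20 h2] := cdt_cont (cdt_sqnorm cdt_zm1) tT e20.
have [d3 d30 h3] : exists2 d, 0 < d & forall u, 0 <= u <= T -> `|u - t| < d ->
    Hb 0 (fun k => z u k - z t k) (eps `^ (3 - theta) / 4).
  case: hz => _ _ [_ hc _ _] _ _.
  have FF : Filter (within `[0, T] (nbhs t)) by apply: within_filter.
  have M4 : 0 < eps `^ (3 - theta) / 4 by rewrite divr_gt0.
  have := @cvg0_small _ _ _ FF _ (hc t tT) _ M4.
  rewrite near_withinE => /nbhs_ballP [d /= d0 hd]; exists d => // u uT ut.
  have := hd u; rewrite /ball /= distrC => /(_ ut); rewrite in_itv /= => /(_ uT) h.
  apply: (Hb_weak _ ((sobE_leP s (fun k => z u k - z t k) (ltW M4)).1 h)).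
  by move: s1_ge0; lra.
exists (Num.min d1 (Num.min d2 d3)); first by rewrite !lt_min d10 d20.
move=> u /andP[u1 u2] uT.
have t0 : 0 <= t by case/andP: tT.
have uT2 : 0 <= u <= T by rewrite uT andbT; lra.
have : `|u - t| < Num.min d1 (Num.min d2 d3) by rewrite gtr0_norm ?subr_gt0 //; lra.
rewrite !lt_min => /andP[b1 /andP[b2 b3]].
apply: Q_intro => //.
- have := le_trans (normc_Re _) (h1 u uT2 b1); rewrite ReD ReN !Re_conjM ler_norml => /andP[_]; lra.
- have := le_trans (normc_Re _) (h2 u uT2 b2); rewrite ReD ReN !Re_conjM ler_norml => /andP[_]; lra.
- have := HbD i3 (Hb_perp (h3 u uT2 b3)).
  rewrite (_ : 2 * (eps `^ (3 - theta) / 4 + eps `^ (3 - theta) / 4) = eps `^ (3 - theta)); last by field.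
  by apply: Hb_ext => k; rewrite perp_diff addrC subrK.
Qed.

Lemma drift_T t : 0 <= t <= T ->
  `|normc (z t 1) ^+ 2 - normc (z 0 1) ^+ 2| <= 8 * Ct * L * p * eps ^+ 4 /\
  `|normc (z t (-1)) ^+ 2 - normc (z 0 (-1)) ^+ 2| <= 8 * Ct * L * p * eps ^+ 4.
Proof.
move=> tT; apply: drift => // u /andP[u0 ut]; apply: bootstrap; rewrite u0 (le_trans ut) //.
by case/andP: tT.
Qed.

(** The left side is what bounds [d1] and [dm1]: freezing the squared modulus at its initial value
    leaves the drift times the mode, plus the forcing. All constants are absorbed into
    [eps ^ (- theta)] by [c4]. *)
Lemma amplitude_defect t k : 0 <= t <= T -> k = 1 \/ k = -1 ->
  normc (((normc (z t k) ^+ 2 - normc (z 0 k) ^+ 2)%:C) * z t k) + normc (y k t) <= eps `^ (5 - theta).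
Proof.
move=> tT hk; have Qt := bootstrap tT; have q0 : 0 < q by rewrite powR_gt0.
have [hd hzk] : `|normc (z t k) ^+ 2 - normc (z 0 k) ^+ 2| <= 8 * Ct * L * p * eps ^+ 4 /\
   normc (z t k) <= 2 * eps.
  by have [d1 d2] := drift_T tT; case: Qt => b1 b2 _ _ _; case: hk => ->.
have := ler_pM (normr_ge0 _) (normc_ge0 _) hd hzk; have := htop k Qt.
rewrite normcM normc_real -/(y k t).
have -> : eps `^ (5 - theta) = eps ^+ 5 * q by rewrite powR_pD // powR_natr // ltW.
have e50 : 0 <= eps ^+ 5 by rewrite exprn_ge0 // ltW.
have h1 := ler_wpM2l e50 c4.
have h2 : Ct * eps ^+ 5 <= Ct * eps ^+ 5 * p by rewrite ler_peMr // mulr_ge0.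
have -> : 8 * Ct * L * p * eps ^+ 4 * (2 * eps) = 16 * L * Ct * p * eps ^+ 5 by ring.
lra.
Qed.

(** The linear rotations cancel in the product of [x1] with the conjugate of [x2]. The cubic ones
    have opposite signs in the two equations and therefore add up to [a + b]; [c] is the speed of
    the compensating rotation [e]. *)
Lemma phase_rate (x1 x2 y1 y2 e : C) (a b c : R) :
  ((- 'i%C * (1 + a)%:C * x1 + y1) * x2^*%C + x1 * (- 'i%C * (1 - b)%:C * x2 + y2)^*%C) * e
   + x1 * x2^*%C * ('i%C * (c)%:C * e)
  = 'i%C * (c - a - b)%:C * (x1 * x2^*%C * e) + (y1 * x2^*%C + x1 * y2^*%C) * e.
Proof.
case: x1 => ? ?; case: x2 => ? ?; case: y1 => ? ?; case: y2 => ? ?; case: e => ? ?.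
by apply: complex_eqP; rewrite /=; ring.
Qed.

Let J1 := (normc (z 0 1) ^+ 2 + normc (z 0 (-1)) ^+ 2) / 2.

(** In the frame rotating with speed [2 * J1] the product moves only through the drift of the
    amplitudes and the forcing, at a rate of size [p * eps ^+ 6]. Integration in time brings a
    second factor [p] and removes two powers of [eps]; [p ^+ 2 <= q] then gives
    [eps ^ (4 - theta)]. *)
Lemma phase_locking t : 0 <= t <= T ->
  normc (z t 1 * (z t (-1))^*%C - z 0 1 * (z 0 (-1))^*%C * cexp (- (2 * J1 * t)))
  <= 2 * (64 * L + 4) * Ct * L * eps `^ (4 - theta).
Proof.
move=> tT; have q0 : 0 < q by rewrite powR_gt0.
have p0 : 0 <= p by move: p1; lra.
have hW := cdtM (cdtM cdt_z1 (cdt_conj cdt_zm1)) (@cdt_cexp R T (2 * J1)).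
have e60 : 0 <= eps ^+ 6 by rewrite exprn_ge0 // ltW.
have rate u : 0 <= u <= T -> normc
    (((- 'i%C * (1 + normc (z u 1) ^+ 2)%:C * z u 1 + y 1 u) * (z u (-1))^*%C
      + z u 1 * (- 'i%C * (1 - normc (z u (-1)) ^+ 2)%:C * z u (-1) + y (-1) u)^*%C) * cexp (2 * J1 * u)
     + z u 1 * (z u (-1))^*%C * ('i%C * (2 * J1)%:C * cexp (2 * J1 * u)))
    <= (64 * L + 4) * Ct * p * eps ^+ 6.
  move=> uT; rewrite phase_rate; have [d1 d2] := drift_T uT; have Qu := bootstrap uT.
  have y1 := htop 1 Qu; have y2 := htop (-1) Qu; case: Qu => b1 b2 _ _ _.
  apply: (le_trans (le_normcD _ _)); rewrite !normcM !normc_conj normc_i normc_real !normc_cexp !mul1r !mulr1.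
  have r1 : `|2 * J1 - normc (z u 1) ^+ 2 - normc (z u (-1)) ^+ 2| <= 16 * Ct * L * p * eps ^+ 4.
    have -> : 2 * J1 - normc (z u 1) ^+ 2 - normc (z u (-1)) ^+ 2 =
      - ((normc (z u 1) ^+ 2 - normc (z 0 1) ^+ 2) + (normc (z u (-1)) ^+ 2 - normc (z 0 (-1)) ^+ 2)).
      by rewrite /J1; field.
    by rewrite normrN; apply: (le_trans (ler_normD _ _)); lra.
  have m1 := ler_pM (normc_ge0 _) (normc_ge0 _) b1 b2.
  have m2 := ler_pM (normr_ge0 _) (mulr_ge0 (normc_ge0 _) (normc_ge0 _)) r1 m1.
  have m3 := ler_pM (normc_ge0 _) (normc_ge0 _) y1 b2.
  have m4 := ler_pM (normc_ge0 _) (normc_ge0 _) b1 y2.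
  have m5 := le_normcD (y 1 u * (z u (-1))^*%C) (z u 1 * (y (-1) u)^*%C).
  rewrite !normcM !normc_conj in m5.
  have w1 : Ct * eps ^+ 6 <= Ct * eps ^+ 6 * p by rewrite ler_peMr // mulr_ge0.
  have E1 : 16 * Ct * L * p * eps ^+ 4 * (2 * eps * (2 * eps)) = 64 * L * Ct * p * eps ^+ 6 by ring.
  have E2 : Ct * eps ^+ 5 * (2 * eps) = 2 * (Ct * eps ^+ 6) by ring.
  have E3 : 2 * eps * (Ct * eps ^+ 5) = 2 * (Ct * eps ^+ 6) by ring.
  rewrite E1 in m2; rewrite E2 in m3; rewrite E3 in m4.
  have E4 : (64 * L + 4) * Ct * p * eps ^+ 6 = 64 * L * Ct * p * eps ^+ 6 + 4 * (Ct * eps ^+ 6 * p) by ring.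
  rewrite E4; apply: lerD m2 _; apply: (le_trans m5).
  move: m3 m4 w1; rewrite -!/(y _ u).
  move: (Ct * eps ^+ 6 * p) (Ct * eps ^+ 6) => X1 X2; lra.
have := mvi_normc hW rate tT.
rewrite mulr0 cexp0 mulr1.
have -> : z t 1 * (z t (-1))^*%C * cexp (2 * J1 * t) - z 0 1 * (z 0 (-1))^*%C =
   (z t 1 * (z t (-1))^*%C - z 0 1 * (z 0 (-1))^*%C * cexp (- (2 * J1 * t))) * cexp (2 * J1 * t).
  by rewrite mulrBl -[_ * cexp (- _) * _]mulrA -cexpD addNr cexp0 mulr1.
rewrite normcM normc_cexp mulr1 => h; apply: (le_trans h).
have -> : eps `^ (4 - theta) = eps ^+ 4 * q by rewrite powR_pD // powR_natr // ltW.
have tT2 : t * eps ^+ 2 <= L * p.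
  by apply: le_trans hT; rewrite ler_wpM2r ?sqr_ge0 //; case/andP: tT.
have K0 : 0 <= 2 * (64 * L + 4) * Ct * p * eps ^+ 4.
  have e40 : 0 <= eps ^+ 4 by rewrite exprn_ge0 // ltW.
  by apply: mulr_ge0 e40; apply: mulr_ge0 p0; apply: mulr_ge0 Ct0; rewrite mulr_ge0 // addr_ge0 // mulr_ge0.
have h1 := ler_wpM2l K0 tT2.
have K1 : 0 <= 2 * (64 * L + 4) * Ct * L * eps ^+ 4.
  have e40 : 0 <= eps ^+ 4 by rewrite exprn_ge0 // ltW.
  by apply: mulr_ge0 e40; apply: mulr_ge0 L0; apply: mulr_ge0 Ct0; rewrite mulr_ge0 // addr_ge0 // mulr_ge0.
have h2 := ler_wpM2l K1 c5.
apply: (@le_trans _ _ (2 * (64 * L + 4) * Ct * p * eps ^+ 4 * (t * eps ^+ 2))).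
  by apply: le_of_eq; ring.
apply: (le_trans h1).
apply: (@le_trans _ _ (2 * (64 * L + 4) * Ct * L * eps ^+ 4 * p ^+ 2)).
  by apply: le_of_eq; ring.
by apply: (le_trans h2); rewrite mulrA.
Qed.

End Bootstrap.

(** * Choice of the threshold for eps *)

Section SmallParameters.
Context {R : realType}.
Implicit Types (a c eps d : R).

Lemma powR_small a c : 0 < a -> exists2 e1, 0 < e1 & forall eps, 0 < eps < e1 -> c * eps `^ a <= 1.
Proof.
move=> a0; pose K := `|c| + 1; have K0 : 0 < K by rewrite ltr_wpDl.
exists (K `^ (- a^-1)); first exact: powR_gt0.
move=> eps /andP[e0 e1].
have h : eps `^ a <= K^-1.
  apply: (le_trans (powR_mono (ltW a0) (ltW e0) (ltW e1))).
  by rewrite -powRrM mulNr mulVf ?gt_eqF // powR_inv1 // ltW.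
apply: (@le_trans _ _ (K * K^-1)); last by rewrite divff // gt_eqF.
apply: (@le_trans _ _ (K * eps `^ a)); last by rewrite ler_pM2l.
rewrite ler_wpM2r ?powR_ge0 //; apply: (le_trans (ler_norm c)); rewrite lerDl //.
Qed.

(** From [ln x < x] at [x = eps ^ (- d)]: the logarithm in the life span costs an arbitrarily small
    power of [eps]. *)
Lemma ln_inv_le_powR d eps : 0 < d -> 0 < eps -> ln (eps^-1) <= d^-1 * eps `^ (- d).
Proof.
move=> d0 e0; rewrite -(ler_pM2l d0) mulrA divff ?gt_eqF // mul1r.
apply: (@le_trans _ _ (ln (eps `^ (- d)))); last by apply/ltW/ln_sublinear; exact: powR_gt0.
by rewrite ln_powR lnV ?posrE // mulrN mulNr.
Qed.

(** The ratio of the two sides is in each case a power of [eps], up to the constant [A]: the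
    exponent is [3 * theta / 4] for [A * p <= q], [theta / 2] for [p ^+ 2 <= q], and [1 - theta / 4]
    for the last condition. *)
Lemma small_parameters theta A : 0 < theta -> theta < 5^-1 -> exists2 e1, 0 < e1 <= 1 &
  forall eps, 0 < eps < e1 -> let p := eps `^ (- (theta / 4)) in let q := eps `^ (- theta) in
  [/\ 1 <= p, A * p <= q, p ^+ 2 <= q & A * p * eps <= 1].
Proof.
move=> t0 t1.
have [|f1 f10 h1] := @powR_small (theta * 3 / 4) A; first by lra.
have [|f2 f20 h2] := @powR_small (1 - theta / 4) A; first by lra.
exists (Num.min 1 (Num.min f1 f2)); first by rewrite !lt_min ltr01 f10 f20 ge_min lexx.
move=> eps /andP[e0]; rewrite !lt_min => /andP[e1 /andP[e2 e3]] p q.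
have q0 : 0 < q by exact: powR_gt0.
split.
- rewrite -(powRr0 eps); apply: powR_eps_le => //; [exact: ltW | lra].
- have -> : p = eps `^ (theta * 3 / 4) * q by rewrite -powR_pD //; congr (_ `^ _); field.
  rewrite mulrA ler_piMl ?(ltW q0) // h1 ?e0 //.
- rewrite -powR_natr ?(ltW (powR_gt0 _ _)) // -powRrM; apply: powR_eps_le => //; [exact: ltW | lra].
- have := h2 eps; rewrite e0 e3 powR_pD // powRr1 ?(ltW e0) // -/p => /(_ isT).
  by rewrite -mulrA [p * eps]mulrC.
Qed.

End SmallParameters.

(** * Recombination of the symbol *)

Section Reduction.
Context {R : realType}.
Local Notation C := R[i].

Lemma is_cdt_eq T (f f' g g' : R -> C) : f =1 f' -> g =1 g' -> is_cdt T f g -> is_cdt T f' g'.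
Proof. by move=> /funext -> /funext ->. Qed.

Lemma is_dt_eq s T (z w w' : R -> fseq R) : (forall t k, w t k = w' t k) -> is_dt s T z w -> is_dt s T z w'.
Proof. by move=> h; have -> : w = w' by apply/funext => t; apply/funext => k. Qed.

(** By the hypothesis on [v + V] both sides have the same real part, and [msym] has no imaginary
    part on the ball. *)
Lemma msym_real alpha s0 r mu (S : system R) z (v V : R -> R) :
  admissible alpha s0 r mu S -> inball s0 r z ->
  (forall x, v x + V x = Vavg z x + complex.Re (V4 S z x)) ->
  (fun x xi => (v x * xi + V x * xi + complex.Re (qeval (a2 S) z x xi + a4 S z x xi))%:C) = msym S z.
Proof.
case=> _ _ _ _ [im _ _ _] ib h; apply/funext => x; apply/funext => xi.
apply: complex_eqP; last by rewrite im.
rewrite /msym -mulrDl h; case: (qeval _ _ _ _) => a b; case: (V4 _ _ _) => c d; case: (a4 _ _ _ _) => e f /=.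
by ring.
Qed.

Lemma perp_regroup (a b c d e : C) : a + b + c + d = a + e + (b + c + d - e).
Proof. by ring. Qed.

End Reduction.


(** * Assembly of the reduced system *)

Unset Implicit Arguments.

Theorem proposition5p4 (R : realType) (alpha delta0 mu : R)
    (chi : 'rV[R]_1 * R -> R) (chi2 : 'rV[R]_2 * R -> R)
    (halpha : 0 < alpha < 1) (hdelta0 : 0 < delta0 <= 10^-1) (hmu : 0 <= mu)
    (hchi : cutoff delta0 chi) (hchi2 : cutoff delta0 chi2) :
  exists smin : R, forall (s0 r : R) (S : system R),
    smin <= s0 -> 0 < r -> admissible alpha s0 r mu S ->
  forall s theta T0 : R,
    3 * s0 < s ->
    0 < theta < Num.min ((s - 3 * s0) / (2 * s - s0)) (5^-1) ->
    0 < T0 ->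
  exists (epsstar K : R) (Kn : nat -> R),
    [/\ 0 < epsstar, 0 < K & forall n, 0 < Kn n] /\
  forall (eps T : R) (z : R -> fseq R),
    0 < eps < epsstar ->
    T <= T0 / eps ^+ 2 * ln (eps^-1) ->
    long_time_controlled alpha s0 r chi chi2 S s theta T eps z ->
  let J1 := (normc (z 0 1) ^+ 2 + normc (z 0 (-1)) ^+ 2) / 2 in
  let v := fun x : R => 2 * complex.Re (z 0 1 * (z 0 (-1))^* * cexp (2 * x)) in
  exists (V : R -> R -> R) (b : R -> R -> R -> R) (d1 dm1 : R -> R[i])
         (Y : R -> fseq R),
    [/\ is_cdt T (fun t => z t 1) (fun t =>
          - 'i * (1 + normc (z 0 1) ^+ 2)%:C * z t 1 + d1 t),
        is_cdt T (fun t => z t (-1)) (fun t =>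
          - 'i * (1 - normc (z 0 (-1)) ^+ 2)%:C * z t (-1) + dm1 t) &
        is_dt (s - 1) T (fun t => perp (z t)) (fun t k =>
          - 'i * absD alpha (perp (z t)) k
          + 'i * OpBW chi (fun x xi =>
                   (v (x - J1 * t) * xi + V t x * xi + b t x xi)%:C)
                 (perp (z t)) k
          + Y t k)] /\
    forall t, 0 <= t <= T ->
      [/\ (Winf 2 (fun x => (V t x)%:C) <= (K * eps `^ (4 - theta))%:E)%E,
          Gamma alpha 2 (fun x xi => (b t x xi)%:C) /\
          (forall n, (symnorm alpha 2 n (fun x xi => (b t x xi)%:C)
                        <= (Kn n * eps ^+ 2)%:E)%E),
          normc (d1 t) <= eps `^ (5 - theta),
          normc (dm1 t) <= eps `^ (5 - theta) &
          (sobE s (Y t) <= (K * eps `^ (3 - theta))%:E)%E].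
Proof.
(* The value [mu + 10] leaves room for the derivative counts above: [mu + 4] for the quadratic
   symbols, 4 for [Vavg], 3 for the quartic symbol. *)
exists (mu + 10) => s0 r S hs0 hr hS s theta T0 hs /andP[th0].
rewrite lt_min => /andP[thS th1] hT0.
have hs10 : 10 <= s0 by lra.
(* The denominator [2 * s - s0] is larger than [s], so the bound on [theta] implies the form used in
   the interpolation. *)
have hth2 : theta * s <= s - 3 * s0.
  have d0 : 0 < 2 * s - s0 by lra.
  move: thS; rewrite ltr_pdivlMr // => h; apply: le_trans (ltW h).
  by apply: ler_wpM2l; [exact: ltW | lra].
have [Kt [et [Kt0 et0 htop]]] := top_forcing hmu hs0 hS hs hth2.
have [Kg [eg [Kg0 eg0 hperp]]] := perp_forcing hdelta0 hchi hchi2 halpha hmu hs0 hS hs hth2.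
have [KY [eY [KY0 eY0 hY]]] := perp_remainder hdelta0 hchi hchi2 halpha hmu hs0 hS hs hth2.
have [Ke Ke0 hen] := tt_energy hdelta0 hchi2 halpha hmu hs0 hr hS.
have [KV KV0 hV] := V_bound hmu hs0 hS hs hth2.
(* The constants must be fixed before [eps] and [z]; choice turns them into a function of [n]. *)
have [Kn hKn] : exists Kn : nat -> R, forall n, 0 < Kn n /\ forall eps z, 0 < eps <= 1 ->
    Qb s0 r s theta eps z -> (symnorm alpha 2 n (bsym S z) <= (Kn n * eps ^+ 2)%:E)%E.
  have h n : exists K : R, 0 < K /\ forall eps z, 0 < eps <= 1 ->
      Qb s0 r s theta eps z -> (symnorm alpha 2 n (bsym S z) <= (K * eps ^+ 2)%:E)%E.
    by have [K K0 hK] := bsym_bound hmu hs0 hS hs hth2 n; exists K.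
  by have [Kn hKn] := boolp.choice h; exists Kn.
(* Since [ln (1 / eps)] is at most [(theta / 4)^-1 * p], the assumption on [T] becomes
   [T * eps ^+ 2 <= L * p]. *)
pose L := T0 * (theta / 4)^-1.
have L0 : 0 <= L by rewrite mulr_ge0 ?invr_ge0 ?divr_ge0 ?(ltW hT0) ?(ltW th0).
(* Sum of all constants to be absorbed, so that [small_parameters] at the single constant [A] yields
   [c1] to [c4]. *)
pose A := 32 * L * (1 + Kg ^+ 2) + 8 * Kt * L + (16 * L + 1) * Kt + 32.
have Kg1 : 0 <= 1 + Kg ^+ 2 by rewrite addr_ge0 // sqr_ge0.
have A1 : 0 <= 32 * L * (1 + Kg ^+ 2) by apply: mulr_ge0 Kg1; exact: mulr_ge0.
have A2 : 0 <= 8 * Kt * L by apply: mulr_ge0 L0; exact: mulr_ge0.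
have A3 : 0 <= (16 * L + 1) * Kt by apply: mulr_ge0 Kt0; rewrite addr_ge0 // mulr_ge0.
have [e1 /andP[e10 e11] he1] := small_parameters A th0 th1.
pose Cw := 2 * (64 * L + 4) * Kt * L.
have Cw0 : 0 <= Cw.
  have h : 0 <= 64 * L + 4 by apply: addr_ge0 => //; exact: mulr_ge0.
  by rewrite /Cw; apply: mulr_ge0 L0; apply: mulr_ge0 Kt0; exact: mulr_ge0.
exists (Num.min e1 (Num.min et (Num.min eg eY))), (KY + KV * (Cw + 1)), Kn; split.
  split=> [||n]; [by rewrite !lt_min e10 et0 eg0| |by case: (hKn n)].
  by rewrite ltr_wpDl // mulr_gt0 // ltr_wpDl.
move=> eps T z /andP[e0]; rewrite !lt_min => /andP[eE1 /andP[eEt /andP[eEg eEY]]] hT hlt J1 v.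
have eps1 : eps <= 1 by apply: ltW; apply: lt_le_trans eE1 e11.
have epsI : 0 < eps <= 1 by rewrite e0.
have [p1 Ap pq Ape] := he1 eps (introT andP (conj e0 eE1)).
set p := eps `^ (- (theta / 4)) in p1 Ap pq Ape.
have le_coef (a : R) : 0 <= a -> a <= A -> a * p <= eps `^ (- theta).
  by move=> a0 aA; apply: le_trans Ap; apply: ler_wpM2r => //; lra.
have c1 : 8 * Kt * L * p * eps <= 1.
  apply: le_trans Ape; apply: ler_wpM2r; first exact: ltW.
  by apply: ler_wpM2r; [lra | rewrite /A; lra].
have c2 : 32 * L * (1 + Kg ^+ 2) * p <= eps `^ (- theta).
  by apply: le_coef => //; rewrite /A; lra.
have c3 : 32 <= eps `^ (- theta).
  have h : 32 * p <= eps `^ (- theta) by apply: le_coef => //; rewrite /A; lra.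
  by apply: le_trans h; lra.
have c4 : (16 * L + 1) * Kt * p <= eps `^ (- theta).
  by apply: le_coef => //; rewrite /A; lra.
have hTL : T * eps ^+ 2 <= L * p.
  have e20 : 0 < eps ^+ 2 by rewrite exprn_gt0.
  apply: le_trans (ler_wpM2r (ltW e20) hT) _.
  rewrite mulrAC divfK ?gt_eqF // /L -mulrA; apply: ler_wpM2l; first exact: ltW.
  by apply: ln_inv_le_powR => //; rewrite divr_gt0.
have htop' w k : Qb s0 r s theta eps w -> normc (Y3top S w k + Y5top S w k) <= Kt * eps ^+ 5.
  by apply: htop; rewrite e0.
have hperp' w : Qb s0 r s theta eps w -> Hb 0 (Gperp chi chi2 S w) (Kg * eps ^+ 5).
  by apply: hperp; rewrite e0.
have boot t : 0 <= t <= T -> Qb s0 r s theta eps (z t) :=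
  bootstrap hs10 hs e0 eps1 Kt0 Ke0 htop' hperp' hen hlt hTL c1 c2 c3 (t := t).
have defect t k := amplitude_defect hs10 hs e0 eps1 Kt0 Ke0 htop' hperp' hen hlt p1 hTL c1 c2 c3 c4
  (t := t) (k := k).
have phase t := phase_locking hs10 hs e0 eps1 Kt0 Ke0 L0 htop' hperp' hen hlt p1 hTL c1 c2 c3 pq (t := t).
(* The phase of [v (x - J1 * t)] is [2 * x - 2 * J1 * t], so the subtracted term is exactly that
   profile. What <V> and the real part of [V4] leave after it is small by [phase_locking]. *)
pose V t x := Vavg (z t) x
  - 2 * complex.Re (z 0 1 * (z 0 (-1))^*%C * cexp (- (2 * J1 * t)) * cexp (2 * x))
  + complex.Re (V4 S (z t) x).
pose b t x xi := complex.Re (qeval (a2 S) (z t) x xi + a4 S (z t) x xi).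
pose y k t := Y3top S (z t) k + Y5top S (z t) k.
pose d1 t := - 'i * (normc (z t 1) ^+ 2 - normc (z 0 1) ^+ 2)%:C * z t 1 + y 1 t.
pose dm1 t := 'i * (normc (z t (-1)) ^+ 2 - normc (z 0 (-1)) ^+ 2)%:C * z t (-1) + y (-1) t.
(* Defined so that the third equation holds identically; its size is that of [perp_remainder] once
   the symbol is recognized as [msym]. *)
pose Y t : fseq R := fun k => OpBW_im chi chi2 S (z t) (perp (z t)) k + Y3perp S (z t) k + Y5perp S (z t) k
  - 'i * OpBW chi (fun x xi => (v (x - J1 * t) * xi + V t x * xi + b t x xi)%:C) (perp (z t)) k.
have s1 : 0 <= s - 1 by lra.
case: (hlt) => _ _ [hball _ dtop dperp] _ _.
exists V, b, d1, dm1, Y; split.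
  split.
  - apply: is_cdt_eq (is_dt_cdt 1 s1 dtop) => // t.
    rewrite /absD /Y3Lambda /top /= normr1 powR1 /d1 /y rmorphB rmorphD; ring.
  - apply: is_cdt_eq (is_dt_cdt (-1) s1 dtop) => // t.
    rewrite /absD /Y3Lambda /top /= normrN1 powR1 /dm1 /y !rmorphB; ring.
  - apply: is_dt_eq dperp => t k; rewrite /Y.
    by exact: perp_regroup.
move=> t tT; have Qt := boot t tT.
have normi : normc ('i : R[i]) = 1 by exact: normc_i.
split.
- apply: le_trans (hV eps (z t) _ _ epsI Qt (phase t tT)) _.
  rewrite lee_fin.
  have h4 : eps ^+ 4 <= eps `^ (4 - theta) by apply: powR_eps_pow => //; lra.
  have q0 : 0 <= eps `^ (4 - theta) by exact: powR_ge0.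
  have h5 : KV * (Cw * eps `^ (4 - theta) + eps ^+ 4) <= KV * (Cw + 1) * eps `^ (4 - theta).
    rewrite -mulrA; apply: ler_wpM2l; first exact: ltW.
    by rewrite mulrDl mul1r lerD2l.
  apply: le_trans h5 _; apply: ler_wpM2r => //; lra.
- split; first by have hG := bsym_Gamma hmu hs0 hS hs hth2 epsI Qt.
  by move=> n; have [_ hb] := hKn n; exact: hb.
- apply: le_trans (defect t 1 tT (or_introl erefl)); rewrite /d1.
  by apply: le_trans (le_normcD _ _) _; rewrite !normcM normcN normi mul1r.
- apply: le_trans (defect t (-1) tT (or_intror erefl)); rewrite /dm1.
  by apply: le_trans (le_normcD _ _) _; rewrite !normcM normi mul1r.
- have [_ ib] := hball t tT.
  have hm := @msym_real R alpha s0 r mu S (z t) (fun x => v (x - J1 * t)) (V t) hS ib.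
  have := hY eps (z t) _ Qt; rewrite -hm => [|x].
    move=> /(_ (introT andP (conj e0 eEY))) h.
    apply: le_trans (Hb_le h) _; rewrite lee_fin; apply: ler_wpM2r; first exact: powR_ge0.
    by rewrite lerDl mulr_ge0 ?(ltW KV0) // addr_ge0.
  rewrite /v /V (_ : 2 * (x - J1 * t) = - (2 * J1 * t) + 2 * x); last by ring.
  rewrite cexpD mulrA; ring.
Qed.
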